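(* Let $E\subset\mathbb T$ be a nonempty closed set, let $p\ge 0$ and $q>0$ be real numbers, and let $\varphi(z):=d(z,E)^q$ for $z\in\mathbb D$. Then there is a constant $c(\varphi)>0$, not depending on $f$, such that for every $f\in\mathcal N_{\varphi,p}(\mathbb D)$ with $|f(0)|=1$, $$\sum_{a\in Z(f)}(1-|a|^2)^{1+p}\,\varphi(a)\le c(\varphi)\,\|f\|_{\mathcal N_{\varphi,p}} .$$
   Context: $\mathbb D$ is the open unit disc of $\mathbb C$, $\mathbb T=\partial\mathbb D$, $d(z,E)$ is the euclidean distance from $z$ to $E$, $\log^+x=\max(\log x,0)$. Integrals over $\mathbb D$ are with respect to area Lebesgue measure, integrals over $\mathbb T$ with respect to $d\theta$. $Z(f)$ is the set of zeros of $f$ in $\mathbb D$, counted with multiplicity. Definition of the classes. A holomorphic function $f$ in $\mathbb D$ belongs to $\mathcal N_{\varphi,p}(\mathbb D)$ if there is $\delta\in(0,1)$ such that $\|f\|_{\mathcal N_{\varphi,p}}<\infty$ (the norm below being taken with such a $\delta$), where - for $p>0$: $$\|f\|_{\mathcal N_{\varphi,p}}:=\sup_{1-\delta<s<1}\int_{\mathbb D}(1-|z|)^{p-1}\varphi(sz)\log^+|f(sz)| ;$$ - for $p=0$: $$\|f\|_{\mathcal N_{\varphi,0}}:=\sup_{1-\delta<s<1}\Big\{\int_{\mathbb T}d(se^{i\theta},E)^q\log^+|f(se^{i\theta})|+\int_{\mathbb D}d(sz,E)^{q-1}\log^+|f(sz)|+\int_{\mathbb D}(1-|sz|^2)^{q-1}\log^+|f(sz)|\Big\}.$$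 *)

(* Defs.v *)
From mathcomp Require Import all_boot all_order all_algebra.
From mathcomp Require Export complex.
From mathcomp Require Import all_classical all_reals all_analysis.

Set Implicit Arguments.
Unset Strict Implicit.
Unset Printing Implicit Defensive.

Import Order.TTheory GRing.Theory Num.Theory.
Import numFieldNormedType.Exports.
Local Open Scope complex_scope.
Local Open Scope classical_set_scope.
Local Open Scope ring_scope.

(* The library norm `|z| lives in R[i]; its value is the real number [cabs z]. *)
Notation cabs := ComplexField.Normc.normc.

Definition unit_disc (R : realType) : set R[i] := [set z | cabs z < 1].

Definition unit_circle (R : realType) : set R[i] := [set z | cabs z = 1].

(* The topology of the complex plane is the one the library puts on R[i]^o. *)
Definition closed_plane (R : realType) (E : set R[i]) : Prop :=
  closed (E : set R[i]^o).

(* [derivable] is taken over the scalar field R[i], so this is complex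
   differentiability; values of f outside the disc play no role. *)
Definition holomorphic (R : realType) (f : R[i] -> R[i]) : Prop :=
  forall z : R[i], unit_disc z -> derivable (f : R[i]^o -> R[i]^o) z 1.

Definition dist_set (R : realType) (z : R[i]) (E : set R[i]) : R :=
  inf [set cabs (z - w) | w in E].

Definition phi (R : realType) (E : set R[i]) (q : R) (z : R[i]) : R :=
  dist_set z E `^ q.

(* At x = 0 the convention ln 0 = 0 gives the intended value log^+ 0 = 0. *)
Definition logp (R : realType) (x : R) : R := Num.max (ln x) 0.

Definition circle_pt (R : realType) (s t : R) : R[i] :=
  (s * cos t) +i* (s * sin t).

(* Integrals over the circle with respect to arc length, and over the disc with
   respect to area, i.e. the product Lebesgue measure in z = x + iy. *)
Definition circle_int (R : realType) (g : R -> R) : \bar R :=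
  (\int[@lebesgue_measure R]_(t in `[0%R, (2 * pi)%R]) (g t)%:E)%E.

Definition disc_int (R : realType) (g : R[i] -> R) : \bar R :=
  (\int[(@lebesgue_measure R \x @lebesgue_measure R)%E]_(u in
     [set u : R * R | unit_disc (u.1 +i* u.2)]) (g (u.1 +i* u.2)%C)%:E)%E.

Definition term_pos (R : realType) (E : set R[i]) (q p : R)
    (f : R[i] -> R[i]) (s : R) : \bar R :=
  disc_int (fun z =>
    (1 - cabs z) `^ (p - 1) * phi E q (s%:C * z) * logp (cabs (f (s%:C * z)))).

Definition term_zero (R : realType) (E : set R[i]) (q : R)
    (f : R[i] -> R[i]) (s : R) : \bar R :=
  (circle_int (fun t =>
     (dist_set (circle_pt s t) E `^ q * logp (cabs (f (circle_pt s t))))%R) +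
   disc_int (fun z =>
     (dist_set (s%:C * z) E `^ (q - 1) * logp (cabs (f (s%:C * z))))%R) +
   disc_int (fun z =>
     ((1 - cabs (s%:C * z) ^+ 2) `^ (q - 1) *
      logp (cabs (f (s%:C * z))))%R))%E.

Definition Nnorm (R : realType) (E : set R[i]) (q p delta : R)
    (f : R[i] -> R[i]) : \bar R :=
  ereal_sup [set (if p == 0 then term_zero E q f s else term_pos E q p f s)
            | s in [set s : R | 1 - delta < s < 1]].

Definition admissible (R : realType) (E : set R[i]) (q p : R)
    (f : R[i] -> R[i]) (delta : R) : Prop :=
  0 < delta < 1 /\ (Nnorm E q p delta f < +oo)%E.

Definition Nclass (R : realType) (E : set R[i]) (q p : R) :
    set (R[i] -> R[i]) :=
  [set f | holomorphic f /\ exists delta, admissible E q p f delta].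

Definition zero_order (R : realType) (f : R[i] -> R[i]) (a : R[i]) (m : nat) :
    Prop :=
  exists g : R[i] -> R[i], [/\ holomorphic g, g a != 0 &
    forall z, unit_disc z -> f z = (z - a) ^+ m * g z].

(* A zero a of order m occurs as the m elements (a, 0), ..., (a, m - 1). *)
Definition Zset (R : realType) (f : R[i] -> R[i]) : set (R[i] * nat) :=
  [set ak | unit_disc ak.1 /\ exists2 m, zero_order f ak.1 m & (ak.2 < m)%N].

Definition zero_sum (R : realType) (E : set R[i]) (q p : R)
    (f : R[i] -> R[i]) : \bar R :=
  (\esum_(ak in Zset f)
     ((1 - cabs ak.1 ^+ 2) `^ (1 + p) * phi E q ak.1)%:E)%E.

(* Main.v *)
(** Write z = exp (- x + i t), so that x = - ln |z|, let d be the distance to E,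
    and let U be ln |f|, truncated from below near the zeros.  The mean M U of U
    over the points (x (1 - cos b_k / 2), t + x sin b_k / 2), b_k = 2 pi k / n,
    is at least U, and it exceeds U by ln 2 near a zero.  Integrating M U - U
    against a weight w of size x^(p-1) d^q and moving M to its dual therefore
    bounds the sum of the
    x_a^(1+p) d_a^q by the integral of (w* - w) U.  For a suitable w one has
    w* >= w when x is small; in the remaining collar, Jensen's inequality lets one
    add a radial bump to w* - w.  The weight so obtained is nonnegative, hence U
    may be replaced by log^+ |f|, and it is at most C x^(p-1) d^q.  If p = 0 and w
    vanishes for x <= tau, it is at most C d^(q-1) for x >= 2 tau and C d^q / tau
    for tau / 2 <= x <= 2 tau; the second range is controlled by the circle
    integrals.  The inequality M U >= U is the maximum principle for a product of
    rotated copies of f, which only needs Goursat's theorem in the variables (x, t). *)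
Require Import Defs.
From mathcomp Require Import all_boot all_order all_algebra complex.
From mathcomp Require Import all_classical all_reals all_analysis.
From mathcomp Require Import measurable_realfun ring lra.

Set Implicit Arguments.
Unset Strict Implicit.
Unset Printing Implicit Defensive.

Import Order.TTheory GRing.Theory Num.Theory.
Import numFieldNormedType.Exports.

Local Open Scope complex_scope.
Local Open Scope classical_set_scope.
Local Open Scope ring_scope.

(** * Integrals of continuous functions over segments and rectangles *)

Section Segment_integral.
Variable R : realType.
Implicit Types (f g : R -> R) (h : R -> R -> R) (a b c d e m r x y M : R).

Notation mu := (@lebesgue_measure R).

(** The domination of w by w* is a quantitative Jensen inequality. With u = cos b_k / 2, ln (1 / (1
    - u)) is at least u + u^2 / 5; the linear term has mean 0 and the quadratic one mean 1/40. The
    function d has no convexity and may drop by 2 x along the circle, so d^q is replaced by (d + 240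
    x)^q: the relative loss 2/240 then costs at most 3/120 = 1/40. For p = 0 the crude size d^q / x
    of w* is too large for the norm. The factors 1 - cos b_k / 2 have mean 1, so the radial parts of
    w* and w agree; what remains are variations over a distance of order x, smaller by a factor x /
    d. Finitely many zeros are treated at a time: f is the product of the z - a and of a holomorphic
    g, and each factor is truncated separately, at a cost C eta. In the collar the circle means of
    ln |z - a| may be as low as ln |a|; the sum of these losses is balanced by ln |g(0)| because
    |f(0)| = 1. The parameters tau, eta and n depend on f and on the zeros; the constants do not. *)

Definition segint a b f : R := Rintegral mu `[a, b] f.

Lemma integrable_segment a b f :
  continuous f -> mu.-integrable `[a, b] (EFin \o f).
Proof.
move=> cf; apply: continuous_compact_integrable; first exact: segment_compact.
exact: continuous_subspaceT.
Qed.

Lemma eq_segint a b f g :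
  (forall x, a <= x <= b -> f x = g x) -> segint a b f = segint a b g.
Proof.
move=> fg; apply: eq_Rintegral => x; rewrite inE/= in_itv/= => xab.
exact: fg.
Qed.

Lemma segintD a b f g : continuous f -> continuous g ->
  segint a b (fun x => f x + g x) = segint a b f + segint a b g.
Proof. by move=> cf cg; rewrite /segint RintegralD//; exact: integrable_segment. Qed.

Lemma segintB a b f g : continuous f -> continuous g ->
  segint a b (fun x => f x - g x) = segint a b f - segint a b g.
Proof. by move=> cf cg; rewrite /segint RintegralB//; exact: integrable_segment. Qed.

Lemma segintZ a b f r : continuous f ->
  segint a b (fun x => r * f x) = r * segint a b f.
Proof. by move=> cf; rewrite /segint RintegralZl//; exact: integrable_segment. Qed.

Lemma le_segint a b f g : continuous f -> continuous g ->
  (forall x, a <= x <= b -> f x <= g x) -> segint a b f <= segint a b g.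
Proof.
move=> cf cg fg; apply: le_Rintegral => //; try exact: integrable_segment.
Qed.

Lemma segint_cst a b r : a <= b -> segint a b (fun=> r) = r * (b - a).
Proof.
move=> ab; rewrite /segint Rintegral_cst//.
rewrite /= -[X in mu X]/([set` `[a, b]]) lebesgue_measure_itv/= lte_fin.
case: ltP => [_//|ba]; have -> : b = a by apply/le_anti; rewrite ab ba.
by rewrite subrr.
Qed.

Lemma segint_norm_le a b f M : a <= b -> continuous f ->
  (forall x, a <= x <= b -> `|f x| <= M) -> `|segint a b f| <= M * (b - a).
Proof.
move=> ab cf fM; rewrite ler_norml; apply/andP; split.
  rewrite -mulNr -segint_cst//; apply: le_segint => //.
    by move=> ?; exact: cvg_cst.
  by move=> x /fM; rewrite ler_norml => /andP[].
rewrite -segint_cst//; apply: le_segint => //.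
  by move=> ?; exact: cvg_cst.
by move=> x /fM; rewrite ler_norml => /andP[].
Qed.

Lemma segint_ge0 a b f : (forall x, a <= x <= b -> 0 <= f x) ->
  0 <= segint a b f.
Proof.
by move=> f0; apply: Rintegral_ge0 => x; rewrite /= in_itv/=; exact: f0.
Qed.

Lemma segint_cat a b c f : a <= c -> c <= b -> continuous f ->
  segint a b f = segint a c f + segint c b f.
Proof.
move=> ac cb cf; rewrite /segint.
have := @Rintegral_itvB R f (BLeft a) (BRight b) c.
move=> /(_ (integrable_segment _ _ cf)); rewrite !bnd_simp => /(_ ac cb).
rewrite Rintegral_itv_obnd_cbnd; last first.
  apply: integrableS (integrable_segment c b cf) => //.
  by apply: subset_itvr; rewrite bnd_simp.
by move=> <-; rewrite addrC subrK.
Qed.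

Lemma segint_sub a b a' b' f : a <= a' -> a' <= b' -> b' <= b ->
  continuous f -> (forall x, a <= x <= b -> 0 <= f x) ->
  segint a' b' f <= segint a b f.
Proof.
move=> aa ab bb cf f0.
rewrite (@segint_cat a b a')//; last exact: le_trans bb.
rewrite (@segint_cat a' b b')//.
rewrite addrA -addrAC lerDr addr_ge0//; apply: segint_ge0 => x /andP[xa xb];
  apply: f0; apply/andP; split=> //.
- by rewrite (le_trans xb)// (le_trans ab).
- by rewrite (le_trans _ xa)// (le_trans aa).
Qed.

Lemma segint_affine a b m r f : a <= b -> 0 < m -> continuous f ->
  segint (a * m + r) (b * m + r) f = m * segint a b (fun x => f (x * m + r)).
Proof.
move=> ab m0 cf.
have dF (x : R^o) : is_derive x 1 (fun x : R^o => x * m + r : R^o) m.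
  by apply: is_derive_eq; rewrite scaler0 add0r addr0 [_ *: _]mulr1.
have D : derive1 (fun x : R => x * m + r : R) = cst m.
  by apply/funext => x; rewrite derive1E; exact: (@derive_val _ _ _ _ _ _ _ (dF x)).
have cF : continuous (fun x : R => x * m + r : R).
  by move=> x; apply: cvgD; [apply: cvgM => //; exact: cvg_cst|exact: cvg_cst].
have -> : segint (a * m + r) (b * m + r) f =
    fine (\int[mu]_(x in `[a, b]) (f (x * m + r) * m)%:E)%E.
  rewrite /segint /Rintegral.
  rewrite (@integration_by_substitution_increasing R (fun x => x * m + r) f a b ab) ?D//.
  - by move=> x y _ _ xy; rewrite ltrD2r ltr_pM2r.
  - by move=> x _; exact: cvg_cst.
  - by apply/cvg_ex; exists m; exact: cvg_cst.
  - by apply/cvg_ex; exists m; exact: cvg_cst.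
  - split.
    + by move=> x _; exact: (@ex_derive _ _ _ _ _ _ _ (dF x)).
    + by apply: cvg_at_right_filter; exact: cF.
    + by apply: cvg_at_left_filter; exact: cF.
  - exact: continuous_subspaceT.
have -> : (fun x => (f (x * m + r) * m)%:E) = (fun x => m%:E * (f (x * m + r))%:E)%E.
  by apply/funext => x; rewrite -EFinM mulrC.
have ci : mu.-integrable `[a, b] (EFin \o (fun x => f (x * m + r))).
  apply: (integrable_segment a b).
  by move=> x; apply: continuous_comp; [exact: cF|exact: cf].
by rewrite integralZl// fineM//; exact: integrable_fin_num.
Qed.

(** Joint continuity on the whole plane: integrands that make sense only on a strip are clamped or
    cut off first, so that no domain has to be carried along. *)
Definition continuous2 h := continuous (fun z : R * R => h z.1 z.2).

(** Only the first point is confined to the box, so compactness is used as a covering property with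
    the radius as parameter. *)
Lemma continuous2_unif h M e : continuous2 h -> 0 < e ->
  exists2 d : R, 0 < d & forall x y x' y',
    `|x| <= M -> `|y| <= M -> `|x - x'| <= d -> `|y - y'| <= d ->
    `|h x y - h x' y'| <= e.
Proof.
move=> ch e0.
have cK : compact (`[- M, M] `*` `[- M, M] : set (R * R)).
  by apply: compact_setX; exact: segment_compact.
pose P (d : R) (z : R * R) := forall z' : R * R, `|z.1 - z'.1| <= d ->
  `|z.2 - z'.2| <= d -> `|h z.1 z.2 - h z'.1 z'.2| <= e.
have : \forall d \near (0:R)^'+, `[- M, M] `*` `[- M, M] `<=` P d.
  apply: (iffLR (compact_near_coveringP _) cK) => z _.
  have e20 : 0 < e / 2 by rewrite divr_gt0.
  have [d d0 zd] : exists2 d : R, 0 < d & forall z' : R * R, `|z.1 - z'.1| < d ->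
      `|z.2 - z'.2| < d -> `|h z.1 z.2 - h z'.1 z'.2| <= e / 2.
    have /cvgrPdist_le/(_ _ e20)/nbhs_ballP[d /= d0 zd] := ch z.
    by exists d => // z' z1 z2; apply: zd; split.
  have d20 : 0 < d / 2 by rewrite divr_gt0.
  exists (ball z (d / 2), [set x | x < d / 2]).
    by split; [exact: nbhsx_ballx|exact: nbhs_right_lt].
  case=> w r [/= [w1 w2]] rd z' z1 z2.
  have r0 : 0 <= r by exact: le_trans z1.
  have split2 (u v t : R) : `|u - v| < d / 2 -> `|v - t| <= r -> `|u - t| < d.
    by move=> uv vt; rewrite -(subrK v u) -addrA (le_lt_trans (ler_normD _ _))//; lra.
  have d2d (u v : R) : `|u - v| < d / 2 -> `|u - v| < d by move=> ?; lra.
  have h1 := zd w (d2d _ _ w1) (d2d _ _ w2).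
  have h2 := zd z' (split2 _ _ _ w1 z1) (split2 _ _ _ w2 z2).
  rewrite distrC in h1.
  rewrite -(subrK (h z.1 z.2) (h w.1 w.2)) -addrA (le_trans (ler_normD _ _))//.
  lra.
move=> [d /= d0 dP]; exists (d / 2); first by rewrite divr_gt0.
move=> x y x' y' xM yM xx yy.
apply: (dP (d / 2) _ _ (x, y) _ (x', y')) => //=.
- rewrite sub0r normrN gtr0_norm ?divr_gt0//; lra.
- by rewrite divr_gt0.
- by split; rewrite /= in_itv/= -ler_norml.
Qed.

Lemma continuous2_fst : continuous2 (fun x _ => x).
Proof. by move=> z; exact: cvg_fst. Qed.

Lemma continuous2_snd : continuous2 (fun _ y => y).
Proof. by move=> z; exact: cvg_snd. Qed.

Lemma continuous2_cst r : continuous2 (fun _ _ => r).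
Proof. by move=> z; exact: cvg_cst. Qed.

Lemma continuous2D h k : continuous2 h -> continuous2 k ->
  continuous2 (fun x y => h x y + k x y).
Proof. by move=> ch ck z; apply: cvgD; [exact: ch|exact: ck]. Qed.

Lemma continuous2N h : continuous2 h -> continuous2 (fun x y => - h x y).
Proof. by move=> ch z; apply: cvgN; exact: ch. Qed.

Lemma continuous2B h k : continuous2 h -> continuous2 k ->
  continuous2 (fun x y => h x y - k x y).
Proof. by move=> ch ck z; apply: cvgB; [exact: ch|exact: ck]. Qed.

Lemma continuous2M h k : continuous2 h -> continuous2 k ->
  continuous2 (fun x y => h x y * k x y).
Proof. by move=> ch ck z; apply: cvgM; [exact: ch|exact: ck]. Qed.

Lemma continuous2_comp f h : continuous f -> continuous2 h ->
  continuous2 (fun x y => f (h x y)).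
Proof. by move=> cf ch z; apply: continuous_comp; [exact: ch|exact: cf]. Qed.

Lemma continuous2_max h k : continuous2 h -> continuous2 k ->
  continuous2 (fun x y => Num.max (h x y) (k x y)).
Proof. by move=> ch ck z; apply: continuous_max; [exact: ch|exact: ck]. Qed.

Lemma continuous2_comp2 h k l : continuous2 h -> continuous2 k ->
  continuous2 l -> continuous2 (fun x y => h (k x y) (l x y)).
Proof.
move=> ch ck cl z.
apply: (@continuous_comp _ _ _ (fun z : R * R => (k z.1 z.2, l z.1 z.2))
  (fun z => h z.1 z.2)); last exact: ch.
exact: (cvg_pair (ck z) (cl z)).
Qed.

Lemma continuous2_sum (I : Type) (s : seq I) (P : pred I)
    (h : I -> R -> R -> R) : (forall i, continuous2 (h i)) ->
  continuous2 (fun x y => \sum_(i <- s | P i) h i x y).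
Proof.
move=> ch; elim: s => [|i s ih].
  by under eq_fun do (under eq_fun do rewrite big_nil); exact: continuous2_cst.
under eq_fun do (under eq_fun do rewrite big_cons).
case: (P i); [exact: (continuous2D (ch i) ih)|exact: ih].
Qed.

Lemma continuous2_row h x : continuous2 h -> continuous (h x).
Proof.
move=> ch y; apply: (@continuous_comp _ _ _ (fun y : R => (x, y))
  (fun z => h z.1 z.2)); last exact: ch.
exact: (cvg_pair (cvg_cst x) cvg_id).
Qed.

Lemma continuous2_col h y : continuous2 h -> continuous (h^~ y).
Proof.
move=> ch x; apply: (@continuous_comp _ _ _ (fun x : R => (x, y))
  (fun z => h z.1 z.2)); last exact: ch.
exact: (cvg_pair cvg_id (cvg_cst y)).
Qed.

Lemma continuous2_lift f : continuous f -> continuous2 (fun x _ => f x).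
Proof. by move=> cf; apply: continuous2_comp => //; exact: continuous2_fst. Qed.

Lemma continuous_segint h c d : c <= d -> continuous2 h ->
  continuous (fun x => segint c d (h x)).
Proof.
move=> cd ch x; apply/cvgrPdist_le => e e0.
have e'0 : 0 < e / (d - c + 1) by rewrite divr_gt0// ltr_wpDl// subr_ge0.
have [r r0 hr] := continuous2_unif (`|x| + `|c| + `|d|) ch e'0.
near=> x'.
have xx : `|x - x'| <= r by near: x'; exact: cvgr_dist_le.
rewrite -segintB; try exact: continuous2_row.
apply: (@le_trans _ _ (e / (d - c + 1) * (d - c))).
  apply: segint_norm_le => //.
    by move=> y; apply: cvgB; exact: continuous2_row.
  move=> y /andP[cy yd]; apply: hr => //.
  - by rewrite -addrA lerDl addr_ge0.
  - have := ler_norm d; have := ler_norm (- c); rewrite normrN => hc hd.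
    by rewrite ler_norml; have := normr_ge0 x; have := normr_ge0 c; have := normr_ge0 d; lra.
  - by rewrite subrr normr0 ltW.
rewrite mulrAC ler_pdivrMr; last by rewrite ltr_wpDl// subr_ge0.
by rewrite ler_pM2l// lerDl.
Unshelve. all: by end_near. Qed.

(** An iterated integral; the product measure enters only when the norm is compared with it, through
    [rectint_prod]. *)
Definition rectint a b c d h : R := segint a b (fun x => segint c d (h x)).

Section Rectangle.
Variables a b c d : R.
Hypotheses (ab : a <= b) (cd : c <= d).

Lemma eq_rectint h k :
  (forall x y, a <= x <= b -> c <= y <= d -> h x y = k x y) ->
  rectint a b c d h = rectint a b c d k.
Proof.
move=> hk; apply: eq_segint => x xab; apply: eq_segint => y ycd; exact: hk.
Qed.

Lemma rectintD h k : continuous2 h -> continuous2 k ->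
  rectint a b c d (fun x y => h x y + k x y) =
  rectint a b c d h + rectint a b c d k.
Proof.
move=> ch ck; rewrite /rectint -segintD; try exact: continuous_segint.
by apply: eq_segint => x _; apply: segintD; exact: continuous2_row.
Qed.

Lemma rectintB h k : continuous2 h -> continuous2 k ->
  rectint a b c d (fun x y => h x y - k x y) =
  rectint a b c d h - rectint a b c d k.
Proof.
move=> ch ck; rewrite /rectint -segintB; try exact: continuous_segint.
by apply: eq_segint => x _; apply: segintB; exact: continuous2_row.
Qed.

Lemma rectintZ h r : continuous2 h ->
  rectint a b c d (fun x y => r * h x y) = r * rectint a b c d h.
Proof.
move=> ch; rewrite /rectint -segintZ; last exact: continuous_segint.
by apply: eq_segint => x _; apply: segintZ; exact: continuous2_row.
Qed.

Lemma rectint_sum (I : Type) (s : seq I) (h : I -> R -> R -> R) :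
  (forall i, continuous2 (h i)) ->
  rectint a b c d (fun x y => \sum_(i <- s) h i x y) =
  \sum_(i <- s) rectint a b c d (h i).
Proof.
move=> ch; elim: s => [|i s ih].
  rewrite big_nil (_ : (fun _ _ => _) = (fun _ _ => 0 * 0)); last first.
    by apply/funext => x; apply/funext => y; rewrite big_nil mul0r.
  by rewrite (rectintZ _ (@continuous2_cst 0)) mul0r.
have cs : continuous2 (fun x y => \sum_(j <- s) h j x y) by exact: continuous2_sum.
rewrite big_cons -ih -(rectintD (ch i) cs).
by apply: eq_rectint => x y _ _; rewrite big_cons.
Qed.

Lemma le_rectint h k : continuous2 h -> continuous2 k ->
  (forall x y, a <= x <= b -> c <= y <= d -> h x y <= k x y) ->
  rectint a b c d h <= rectint a b c d k.
Proof.
move=> ch ck hk; apply: le_segint; try exact: continuous_segint.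
move=> x xab; apply: le_segint; try exact: continuous2_row.
by move=> y ycd; exact: hk.
Qed.

Lemma rectint_ge0 h :
  (forall x y, a <= x <= b -> c <= y <= d -> 0 <= h x y) ->
  0 <= rectint a b c d h.
Proof.
move=> h0; apply: segint_ge0 => x xab; apply: segint_ge0 => y ycd; exact: h0.
Qed.

Lemma rectint_cst r : rectint a b c d (fun _ _ => r) = r * (d - c) * (b - a).
Proof. by rewrite /rectint -segint_cst//; apply: eq_segint => x _; rewrite segint_cst. Qed.

Lemma rectint_sub_ge h a' b' c' d' r : a <= a' -> a' <= b' -> b' <= b ->
  c <= c' -> c' <= d' -> d' <= d -> continuous2 h ->
  (forall x y, a <= x <= b -> c <= y <= d -> 0 <= h x y) ->
  (forall x y, a' <= x <= b' -> c' <= y <= d' -> r <= h x y) ->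
  r * (d' - c') * (b' - a') <= rectint a b c d h.
Proof.
move=> aa a'b' bb cc c'd' dd ch h0 hr.
apply: (@le_trans _ _ (segint a' b' (fun x => segint c d (h x)))); last first.
  apply: segint_sub => //; first exact: continuous_segint.
  by move=> x xab; apply: segint_ge0 => y ycd; exact: h0.
rewrite -segint_cst//; apply: le_segint; first by move=> ?; exact: cvg_cst.
  exact: continuous_segint.
move=> x /andP[xa xb].
apply: (@le_trans _ _ (segint c' d' (h x))); last first.
  apply: segint_sub => //; first exact: continuous2_row.
  move=> y ycd; apply: h0 => //.
  by rewrite (le_trans aa)//= (le_trans xb).
rewrite -segint_cst//; apply: le_segint; first by move=> ?; exact: cvg_cst.
  exact: continuous2_row.
by move=> y ycd; apply: hr => //; rewrite xa.
Qed.

End Rectangle.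

Lemma segint_shift a b r f : a <= b -> continuous f ->
  segint a b (fun x => f (x + r)) = segint (a + r) (b + r) f.
Proof.
move=> ab cf; have := segint_affine r ab ltr01 cf; rewrite mul1r => E.
rewrite !mulr1 in E; rewrite E.
by apply: eq_segint => x _; rewrite mulr1.
Qed.

Lemma segint_periodic T f r : 0 < T -> continuous f ->
  (forall x, f (x + T) = f x) -> segint 0 T (fun x => f (x + r)) = segint 0 T f.
Proof.
move=> T0; have T0' := ltW T0.
have pos g s : continuous g -> (forall x, g (x + T) = g x) -> 0 <= s ->
    segint 0 T (fun x => g (x + s)) = segint 0 T g.
  move=> cg gT s0; rewrite segint_shift// add0r.
  have E : segint 0 s g = segint T (T + s) g.
    rewrite (_ : segint 0 s g = segint 0 s (fun x => g (x + T))); last first.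
      by apply: eq_segint => x _; rewrite gT.
    by rewrite segint_shift// add0r (addrC s).
  have E1 : segint 0 (T + s) g = segint 0 T g + segint T (T + s) g.
    by apply: segint_cat => //; rewrite lerDl.
  have E2 : segint 0 (T + s) g = segint 0 s g + segint s (T + s) g.
    by apply: segint_cat => //; rewrite lerDr.
  by move: E2; rewrite E1 E addrC => /addrI.
move=> cf fT; have [r0|r0] := leP 0 r; first exact: pos.
rewrite -(pos (fun x => f (x + r)) (- r)).
- by apply: eq_segint => x _; rewrite subrK.
- move=> x; apply: continuous_comp; last exact: cf.
  by apply: cvgD; [exact: cvg_id|exact: cvg_cst].
- by move=> x; rewrite addrAC fT.
- by rewrite oppr_ge0 ltW.
Qed.

End Segment_integral.

(** * Goursat's theorem on rectangles *)

Section Goursat.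
Variable R : realType.
Implicit Types (u v : R -> R -> R) (a b c d e w x y : R).

(** The imaginary part of the contour integral of u + i v over the boundary of the rectangle; in the
    smooth case, the double integral of u_x - v_y. *)
Definition flux u v a b c d : R :=
  segint c d (u b) - segint c d (u a) -
  (segint a b (v^~ d) - segint a b (v^~ c)).

(** The left endpoints increase and are bounded by every right endpoint, so their supremum lies in
    all the intervals. *)
Lemma nested_dyadic (a : nat -> R) w : 0 <= w ->
  (forall k, a k <= a k.+1 <= a k + w / 2 ^+ k.+1) ->
  exists x, forall k, a k <= x <= a k + w / 2 ^+ k.
Proof.
move=> w0 aS.
have w2 k : w / 2 ^+ k = w / 2 ^+ k.+1 + w / 2 ^+ k.+1.
  by rewrite exprS; field; rewrite expf_neq0.
have nest j m : a j <= a (j + m)%N /\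
    a (j + m)%N + w / 2 ^+ (j + m) <= a j + w / 2 ^+ j.
  elim: m => [|m [ih1 ih2]]; first by rewrite addn0.
  rewrite addnS; have /andP[h1 h2] := aS (j + m)%N.
  split; first exact: le_trans h1.
  apply: le_trans ih2; rewrite (w2 (j + m)%N); lra.
have wp k : 0 <= w / 2 ^+ k by rewrite divr_ge0// exprn_ge0.
have ub j k : a k <= a j + w / 2 ^+ j.
  have [jk|kj] := leqP j k.
    rewrite -(subnKC jk); have [_] := nest j (k - j)%N; apply: le_trans.
    by rewrite lerDl.
  rewrite -(subnKC (ltnW kj)); have [h _] := nest k (j - k)%N.
  by rewrite (le_trans h)// lerDl.
have hs : has_sup (range a).
  by split; [exists (a 0%N), 0%N|exists (a 0%N + w / 2 ^+ 0) => _ [k _ <-]].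
exists (sup (range a)) => k; apply/andP; split.
  by apply: sup_ubound; [exact: hs.2|exists k].
by apply: ge_sup; [exact: hs.1|move=> _ [j _ <-]].
Qed.

Lemma fluxDx u v a m b c d : a <= m -> m <= b -> continuous2 v ->
  flux u v a b c d = flux u v a m c d + flux u v m b c d.
Proof.
move=> am mb cv; rewrite /flux (@segint_cat _ a b m (v^~ d))//; last first.
  exact: continuous2_col.
rewrite (@segint_cat _ a b m (v^~ c))//; last exact: continuous2_col.
by ring.
Qed.

Lemma fluxDy u v a b c m d : c <= m -> m <= d -> continuous2 u ->
  flux u v a b c d = flux u v a b c m + flux u v a b m d.
Proof.
move=> cm md cu; rewrite /flux (@segint_cat _ c d m (u b))//; last first.
  exact: continuous2_row.
rewrite (@segint_cat _ c d m (u a))//; last exact: continuous2_row.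
by ring.
Qed.

Definition square_flux u v (z : R * R) w h :=
  flux u v z.1 (z.1 + w) z.2 (z.2 + h).

(** The fluxes of the four quarters add up, so one of them has at least a quarter of the modulus. *)
Lemma square_flux_quarter u v z w h : 0 <= w -> 0 <= h ->
  continuous2 u -> continuous2 v ->
  exists z' : R * R, [/\ z'.1 = z.1 \/ z'.1 = z.1 + w / 2,
    z'.2 = z.2 \/ z'.2 = z.2 + h / 2 &
    `|square_flux u v z w h| / 4 <= `|square_flux u v z' (w / 2) (h / 2)|].
Proof.
case: z => x y w0 h0 cu cv; rewrite /square_flux /=.
have half t : t = t / 2 + t / 2 :> R by field.
have E : flux u v x (x + w) y (y + h) =
    flux u v x (x + w / 2) y (y + h / 2) +
    flux u v x (x + w / 2) (y + h / 2) (y + h / 2 + h / 2) +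
    (flux u v (x + w / 2) (x + w / 2 + w / 2) y (y + h / 2) +
     flux u v (x + w / 2) (x + w / 2 + w / 2) (y + h / 2) (y + h / 2 + h / 2)).
  rewrite (@fluxDx u v x (x + w / 2))//; try lra.
  rewrite (@fluxDy u v x (x + w / 2) y (y + h / 2))//; try lra.
  rewrite (@fluxDy u v (x + w / 2) (x + w) y (y + h / 2))//; try lra.
  by rewrite -!(addrA x) -!(addrA y) -!half.
rewrite E.
set A := flux u v x _ y _; set B := flux u v x _ _ _.
set C := flux u v _ _ y _; set D := flux u v (x + _) _ _ _.
have := ler_normD (A + B) (C + D); have := ler_normD A B.
have := ler_normD C D.
have [h1|h1] := leP (`|A + B + (C + D)| / 4) `|A|.
  by exists (x, y) => /=; split; [left|left|].
have [h2|h2] := leP (`|A + B + (C + D)| / 4) `|B|.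
  by exists (x, y + h / 2) => /=; split; [left|right|].
have [h3|h3] := leP (`|A + B + (C + D)| / 4) `|C|.
  by exists (x + w / 2, y) => /=; split; [right|left|].
move=> h4 h5 h6; exists (x + w / 2, y + h / 2) => /=; split; [right|right|]=> //.
rewrite -/D; lra.
Qed.

Lemma dist_segment_le x x' y w : x <= y -> y <= x + w -> x <= x' <= x + w ->
  `|x' - y| <= w.
Proof.
by move=> h1 h2 /andP[h3 h4]; rewrite ler_norml; apply/andP; split; lra.
Qed.

Lemma affine_increment (A B o m p p' q al be : R) :
  `|A - o - (al * p + be * q)| <= m -> `|B - o - (al * p' + be * q)| <= m ->
  `|A - B - al * (p - p')| <= 2 * m.
Proof.
move=> /ler_normlP[h1 h1'] /ler_normlP[h2 h2'].
by apply/ler_normlP; split; lra.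
Qed.

(** Both pairs of opposite sides contribute the same main term [al * w * h], and the difference
    cancels it: this is where the Cauchy-Riemann equation u_x = v_y enters. *)
Lemma square_flux_le u v z w h al m : 0 <= w -> 0 <= h ->
  continuous2 u -> continuous2 v ->
  (forall t, z.2 <= t <= z.2 + h -> `|u (z.1 + w) t - u z.1 t - al * w| <= m) ->
  (forall t, z.1 <= t <= z.1 + w -> `|v t (z.2 + h) - v t z.2 - al * h| <= m) ->
  `|square_flux u v z w h| <= m * (w + h).
Proof.
case: z => x y /= w0 h0 cu cv um vm.
have cst_cont (r : R) : continuous (fun _ : R => r) by move=> ?; exact: cvg_cst.
have ccol t : continuous (v^~ t) by exact: continuous2_col.
have crow t : continuous (u t) by exact: continuous2_row.
have cB (f g : R -> R) : continuous f -> continuous g ->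
    continuous (fun t => f t - g t).
  by move=> cf cg t; apply: cvgB; [exact: cf|exact: cg].
have yh : y <= y + h by rewrite lerDl.
have xw : x <= x + w by rewrite lerDl.
have := segint_norm_le yh _ um; have := segint_norm_le xw _ vm.
rewrite !segintB ?segint_cst//; try exact: cB.
rewrite /square_flux /flux /= (addrC x w) (addrC y h) !addrK.
set A := segint y _ _ - _; set B := segint x _ _ - _ => Bm Am.
have {}Bm := Bm (cB _ _ (cB _ _ (ccol _) (ccol _)) (cst_cont _)).
have {}Am := Am (cB _ _ (cB _ _ (crow _) (crow _)) (cst_cont _)).
have -> : A - B = (A - al * w * h) - (B - al * h * w) by ring.
by rewrite (le_trans (ler_normB _ _))// mulrDr addrC lerD.
Qed.

(* Goursat's argument: no continuity of the derivatives is needed. *)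
Lemma goursat u v a b c d : a <= b -> c <= d -> continuous2 u -> continuous2 v ->
  (forall x y, a <= x <= b -> c <= y <= d -> exists al be ga : R,
    forall e, 0 < e -> exists2 r : R, 0 < r & forall x' y',
      a <= x' <= b -> c <= y' <= d -> `|x' - x| <= r -> `|y' - y| <= r ->
      `|u x' y' - u x y - (al * (x' - x) + be * (y' - y))|
        <= e * (`|x' - x| + `|y' - y|) /\
      `|v x' y' - v x y - (ga * (x' - x) + al * (y' - y))|
        <= e * (`|x' - x| + `|y' - y|)) ->
  flux u v a b c d = 0.
Proof.
move=> ab cd cu cv uv.
pose w := b - a; pose h := d - c.
have w0 : 0 <= w by rewrite subr_ge0.
have h0 : 0 <= h by rewrite subr_ge0.
have wk k : 0 <= w / 2 ^+ k by rewrite divr_ge0// exprn_ge0.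
have hk k : 0 <= h / 2 ^+ k by rewrite divr_ge0// exprn_ge0.
(* One bisection step, recorded by lower left corners: the new rectangle keeps a quarter of the
   flux. *)
pose Q k (z z' : R * R) := [/\ z'.1 = z.1 \/ z'.1 = z.1 + w / 2 ^+ k.+1,
    z'.2 = z.2 \/ z'.2 = z.2 + h / 2 ^+ k.+1 &
    `|square_flux u v z (w / 2 ^+ k) (h / 2 ^+ k)| / 4 <=
    `|square_flux u v z' (w / 2 ^+ k.+1) (h / 2 ^+ k.+1)|].
have /choice[st' stP'] (kz : nat * (R * R)) : exists z', Q kz.1 kz.2 z'.
  have half t k : t / 2 ^+ k / 2 = t / 2 ^+ k.+1 :> R.
    by rewrite exprS; field; rewrite expf_neq0.
  have := square_flux_quarter kz.2 (wk kz.1) (hk kz.1) cu cv.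
  by rewrite !half.
pose st k z := st' (k, z).
have stP k z : Q k z (st k z) by exact: (stP' (k, z)).
pose z := fix z k := if k is k'.+1 then st k' (z k') else (a, c).
have [X XP] : exists x, forall k, (z k).1 <= x <= (z k).1 + w / 2 ^+ k.
  apply: nested_dyadic => // k; have [+ _ _] := stP k (z k).
  by rewrite /= => -[]->; rewrite ?lexx ?lerDl wk.
have [Y YP] : exists y, forall k, (z k).2 <= y <= (z k).2 + h / 2 ^+ k.
  apply: nested_dyadic => // k; have [_ + _] := stP k (z k).
  by rewrite /= => -[]->; rewrite ?lexx ?lerDl hk.
have zin k : [/\ a <= (z k).1, (z k).1 + w / 2 ^+ k <= b,
    c <= (z k).2 & (z k).2 + h / 2 ^+ k <= d].
  have w2 t k' : t / 2 ^+ k' = t / 2 ^+ k'.+1 + t / 2 ^+ k'.+1 :> R.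
    by rewrite exprS; field; rewrite expf_neq0.
  elim: k => [|k [ih1 ih2 ih3 ih4]].
    by rewrite /= !divr1 /w /h; split; lra.
  have [h1 h2 _] := stP k (z k); have := wk k.+1; have := hk k.+1.
  rewrite (w2 w) in ih2; rewrite (w2 h) in ih4.
  rewrite [z k.+1]/= => hk1 wk1.
  by split; [case: h1|case: h1|case: h2|case: h2] => ->; lra.
have Ek k : `|flux u v a b c d| / 4 ^+ k <=
    `|square_flux u v (z k) (w / 2 ^+ k) (h / 2 ^+ k)|.
  elim: k => [|k ih].
    by rewrite !expr0 !divr1 /square_flux /= /w /h !(addrC _ (_ - _)) !subrK.
  have [_ _] := stP k (z k); apply: le_trans.
  by rewrite exprSr invfM mulrA ler_pM2r// invr_gt0.
have Xab : a <= X <= b.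
  have /andP[] := XP 0%N; have [] := zin 0%N; rewrite /= => *; lra.
have Ycd : c <= Y <= d.
  have /andP[] := YP 0%N; have [] := zin 0%N; rewrite /= => *; lra.
have [al [be [ga D]]] := uv X Y Xab Ycd.
suff small e : 0 < e -> `|flux u v a b c d| <= 2 * e * (w + h) ^+ 2.
  apply/eqP; rewrite -normr_le0; apply/ler_addgt0Pl => e e0; rewrite addr0.
  have wh0 : 0 < 2 * ((w + h) ^+ 2 + 1).
    by rewrite mulr_gt0// ltr_wpDl// sqr_ge0.
  have e'0 : 0 < e / (2 * ((w + h) ^+ 2 + 1)) by rewrite divr_gt0.
  apply: (le_trans (small _ e'0)).
  set S := (w + h) ^+ 2 in wh0 *.
  have S0 : 0 <= S by exact: sqr_ge0.
  have -> : 2 * (e / (2 * (S + 1))) * S = e * (S / (S + 1)) by field; lra.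
  by apply: ler_piMr; [exact: ltW|rewrite ler_pdivrMr ?mul1r ?lerDl// ltr_wpDl].
move=> e0; have [r r0 Dr] := D e e0.
(* From this generation on, the rectangle lies within the radius where the linear approximation at
   (X, Y) is valid. *)
have [k kr] : exists k, (w + h) / 2 ^+ k <= r.
  exists (Num.bound ((w + h) / r)); rewrite ler_pdivrMr ?exprn_gt0// mulrC.
  rewrite -ler_pdivrMr//.
  have wh0 : 0 <= (w + h) / r by apply: divr_ge0; [exact: addr_ge0|exact: ltW].
  apply: (le_trans (ltW (archi_boundP wh0))).
  by rewrite -natrX ler_nat ltnW// ltn_expl.
have [za zb zc zd] := zin k.
have /andP[Xa Xb] := XP k; have /andP[Ya Yb] := YP k.
have wkh : w / 2 ^+ k <= r /\ h / 2 ^+ k <= r.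
  by split; apply: le_trans kr; rewrite [leRHS]mulrDl; [rewrite lerDl; exact: hk|rewrite lerDr; exact: wk].
pose W := w / 2 ^+ k; pose H := h / 2 ^+ k.
have subP (a' b' x W' x' : R) : a' <= x -> x + W' <= b' -> x <= x' <= x + W' ->
    a' <= x' <= b'.
  by move=> h1 h2 /andP[h3 h4]; rewrite (le_trans h1)//= (le_trans h4).
have Du x' y' : (z k).1 <= x' <= (z k).1 + W -> (z k).2 <= y' <= (z k).2 + H ->
   `|u x' y' - u X Y - (al * (x' - X) + be * (y' - Y))| <= e * (W + H) /\
   `|v x' y' - v X Y - (ga * (x' - X) + al * (y' - Y))| <= e * (W + H).
  move=> x1 y1; have xX := dist_segment_le Xa Xb x1; have yY := dist_segment_le Ya Yb y1.
  have [||||h1 h2] := Dr x' y'.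
  - exact: subP x1.
  - exact: subP y1.
  - exact: le_trans wkh.1.
  - exact: le_trans wkh.2.
  by split; [apply: (le_trans h1)|apply: (le_trans h2)]; rewrite ler_pM2l// lerD.
have lb (x W' : R) : 0 <= W' -> x <= x <= x + W' by move=> W0; rewrite lexx lerDl.
have ub (x W' : R) : 0 <= W' -> x <= x + W' <= x + W' by move=> W0; rewrite lexx lerDl W0.
(* The error is quadratic in the side lengths, so the loss 4^k of the bisections is exactly
   compensated. *)
have WH2 : 4 ^+ k * (W + H) ^+ 2 = (w + h) ^+ 2.
  rewrite /W /H -mulrDl exprMn mulrCA -[RHS]mulr1; congr (_ * _).
  have -> : 4 ^+ k = (2 ^+ k) ^+ 2 :> R.
    by rewrite -exprM mulnC exprM expr2 -natrM.
  by rewrite exprVn mulfV// !expf_neq0.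
have := @square_flux_le u v (z k) W H al (2 * (e * (W + H))) (wk k) (hk k) cu cv.
move=> E; move: (Ek k); rewrite ler_pdivrMr ?exprn_gt0// => /le_trans; apply.
rewrite -WH2 mulrC mulrCA ler_pM2l ?exprn_gt0// expr2 mulrA -(mulrA 2).
apply: E => t ht.
  have [h1 _] := Du _ t (ub _ _ (wk k)) ht; have [h2 _] := Du _ t (lb _ _ (wk k)) ht.
  have := affine_increment h1 h2.
  by rewrite (_ : _ + W - X - _ = W)//; ring.
have [_ h1] := Du t _ ht (ub _ _ (hk k)); have [_ h2] := Du t _ ht (lb _ _ (hk k)).
rewrite (addrC (ga * _)) in h1; rewrite (addrC (ga * _)) in h2.
have := affine_increment h1 h2.
by rewrite (_ : _ + H - Y - _ = H)//; ring.
Qed.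

End Goursat.

(** * Complex differentiability, the exponential and the maximum principle *)

Section Complex_preliminaries.
Variable R : realType.
Implicit Types (z w l : R[i]) (f g : R[i] -> R[i]) (e d r x t : R).

Lemma normC_cabs z : `|z| = (cabs z)%:C.
Proof. by []. Qed.

Lemma cabs_ge0 z : 0 <= cabs z.
Proof. by case: z => a b; exact: sqrtr_ge0. Qed.

Lemma cabsM z w : cabs (z * w) = cabs z * cabs w.
Proof. exact: ComplexField.Normc.normcM. Qed.

Lemma cabsV z : cabs z^-1 = (cabs z)^-1.
Proof. exact: ComplexField.Normc.normcV. Qed.

Lemma cabsN z : cabs (- z) = cabs z.
Proof. exact: normcN. Qed.

Lemma cabsD z w : cabs (z + w) <= cabs z + cabs w.
Proof. exact: le_normcD. Qed.

Lemma cabsB z w : cabs (z - w) <= cabs z + cabs w.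
Proof. by rewrite -(cabsN w); exact: cabsD. Qed.

Lemma cabs_sym z w : cabs (z - w) = cabs (w - z).
Proof. by rewrite -cabsN opprB. Qed.

Lemma cabs_dist z w : `|cabs z - cabs w| <= cabs (z - w).
Proof.
have h1 : cabs z <= cabs (z - w) + cabs w by rewrite -{1}(subrK w z) cabsD.
have h2 : cabs w <= cabs (z - w) + cabs z.
  by rewrite cabs_sym -{1}(subrK z w) cabsD.
by rewrite ler_norml; apply/andP; split; lra.
Qed.

Lemma cabs0 : cabs (0 : R[i]) = 0.
Proof. exact: ComplexField.Normc.normc0. Qed.

Lemma cabs1 : cabs (1 : R[i]) = 1.
Proof. exact: ComplexField.Normc.normc1. Qed.

Lemma cabs_eq0 z : (cabs z == 0) = (z == 0).
Proof.
apply/eqP/eqP => [/ComplexField.Normc.eq0_normc//|->]; exact: cabs0.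
Qed.

Lemma cabs_gt0 z : (0 < cabs z) = (z != 0).
Proof. by rewrite lt0r cabs_ge0 andbT cabs_eq0. Qed.

Lemma cabs_real x : cabs x%:C = `|x|.
Proof. by rewrite /= expr0n/= addr0 sqrtr_sqr. Qed.

Lemma Re_le_cabs z : `|complex.Re z| <= cabs z.
Proof.
by case: z => a b /=; rewrite -sqrtr_sqr ler_wsqrtr// lerDl sqr_ge0.
Qed.

Lemma Im_le_cabs z : `|complex.Im z| <= cabs z.
Proof.
by case: z => a b /=; rewrite -sqrtr_sqr ler_wsqrtr// lerDr sqr_ge0.
Qed.

Lemma cabs_le_ReIm z : cabs z <= `|complex.Re z| + `|complex.Im z|.
Proof.
case: z => a b /=; rewrite -[leRHS]ger0_norm ?addr_ge0// -sqrtr_sqr.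
rewrite ler_wsqrtr// sqrrD !real_normK ?num_real//.
by rewrite addrAC lerDl mulrn_wge0// mulr_ge0.
Qed.

Lemma cabs_prod (I : Type) (s : seq I) (F : I -> R[i]) :
  cabs (\prod_(i <- s) F i) = \prod_(i <- s) cabs (F i).
Proof. by elim/big_rec2: _ => [|i y z _ <-]; rewrite ?cabs1 ?cabsM. Qed.

Definition cderivable f z : Prop := derivable (f : R[i]^o -> R[i]^o) z 1.

(** Tolerances and radii of the library are positive elements of R[i], hence real; they become
    elements of R here. *)
Lemma cderivableP f z : cderivable f z <->
  exists l, forall e, 0 < e -> exists2 d, 0 < d & forall w, cabs (w - z) < d ->
    cabs (f w - f z - l * (w - z)) <= e * cabs (w - z).
Proof.
split.
  move=> /cvg_ex[/= l /cvgrPdist_le fl]; exists l => e e0.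
  have e'0 : 0 < e%:C by rewrite ltcR.
  have [d /= d0 dP] := fl _ e'0.
  have d00 : 0 < complex.Re d by move: d0; rewrite ltcE => /andP[].
  have dE : d = (complex.Re d)%:C.
    by move: d0; rewrite ltcE => /andP[/eqP]; case: d {dP d00} => a b /= ->.
  exists (complex.Re d) => // w wz.
  have [->|wz0] := eqVneq w z.
    by rewrite !subrr mulr0 subrr cabs0 mulr0.
  have := dP (w - z).
  rewrite /ball_ /= sub0r normrN normC_cabs dE ltcR subr_eq0 => /(_ wz wz0).
  rewrite normC_cabs lecR !/(_ *: _) /= mulr1 subrK => h.
  have wz00 : w - z != 0 by rewrite subr_eq0.
  have -> : f w - f z - l * (w - z) = ((w - z)^-1 * (f w - f z) - l) * (w - z).
    by rewrite mulrBl mulrAC mulVf// mul1r.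
  rewrite cabsM; apply: ler_wpM2r; [exact: cabs_ge0|by rewrite cabs_sym].
move=> [l fl]; apply/cvg_ex; exists l; apply/cvgrPdist_le => /= e e0.
have e00 : 0 < complex.Re e by move: e0; rewrite ltcE => /andP[].
have eE : e = (complex.Re e)%:C.
  by move: e0; rewrite ltcE => /andP[/eqP]; case: e {e00} => a b /= ->.
have [d d0 dP] := fl _ e00.
exists (d%:C) => /=; first by rewrite ltcR.
move=> h; rewrite /ball_ /= sub0r normrN normC_cabs ltcR => hd h0.
rewrite normC_cabs eE lecR !/(_ *: _) /= mulr1.
have := dP (h + z); rewrite addrK => /(_ hd) {}dP.
have -> : l - h^-1 * (f (h + z) - f z) = - ((f (h + z) - f z - l * h) * h^-1).
  by rewrite mulrBl mulfK// opprB mulrC.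
by rewrite cabsN cabsM cabsV ler_pdivrMr// cabs_gt0.
Qed.

Lemma cderivable_continuous f z e : cderivable f z -> 0 < e ->
  exists2 d, 0 < d & forall w, cabs (w - z) < d -> cabs (f w - f z) <= e.
Proof.
move=> /cderivableP[l /(_ _ ltr01)[d d0 dP]] e0.
have c0 : 0 < 1 + cabs l by rewrite ltr_wpDr// cabs_ge0.
exists (Num.min d (e / (1 + cabs l))).
  by rewrite lt_min d0 divr_gt0.
move=> w; rewrite lt_min => /andP[/dP wd]; rewrite ltr_pdivlMr// => we.
rewrite -(subrK (l * (w - z)) (f w - f z)) (le_trans (cabsD _ _))//.
rewrite mulrDr mulr1 in we; rewrite mul1r in wd.
by apply: le_trans (ltW we); rewrite cabsM (mulrC (cabs l)) lerD2r.
Qed.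

Lemma near_cderivable f g z r : 0 < r ->
  (forall w, cabs (w - z) < r -> f w = g w) -> cderivable g z -> cderivable f z.
Proof.
move=> r0 fg /cderivableP[l gl]; apply/cderivableP; exists l => e /gl[d d0 dP].
exists (Num.min d r); first by rewrite lt_min d0.
move=> w; rewrite lt_min => /andP[wd wr].
by rewrite fg// fg ?subrr ?cabs0//; exact: dP.
Qed.

Lemma cderivable_comp f g z : cderivable g z -> cderivable f (g z) ->
  cderivable (fun w => f (g w)) z.
Proof.
move=> /derivable1_diffP dg /derivable1_diffP df.
apply/derivable1_diffP; exact: (differentiable_comp dg df).
Qed.

Lemma cderivableM f g z : cderivable f z -> cderivable g z ->
  cderivable (fun w => f w * g w) z.
Proof. by move=> df dg; exact: (derivableM df dg). Qed.

Lemma cderivableB f g z : cderivable f z -> cderivable g z ->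
  cderivable (fun w => f w - g w) z.
Proof. by move=> df dg; exact: (derivableB df dg). Qed.

Lemma cderivableD f g z : cderivable f z -> cderivable g z ->
  cderivable (fun w => f w + g w) z.
Proof. by move=> df dg; exact: (derivableD df dg). Qed.

Lemma cderivableV f z : f z != 0 -> cderivable f z ->
  cderivable (fun w => (f w)^-1) z.
Proof. by move=> f0 df; exact: derivableV. Qed.

Lemma cderivable_cst l z : cderivable (fun=> l) z.
Proof. exact: derivable_cst. Qed.

Lemma cderivable_id z : cderivable (fun w => w) z.
Proof. exact: derivable_id. Qed.

Lemma cderivable_prod (I : Type) (s : seq I) (F : I -> R[i] -> R[i]) z :
  (forall i, cderivable (F i) z) -> cderivable (fun w => \prod_(i <- s) F i w) z.
Proof.
move=> dF; elim: s => [|i s ih].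
  have -> : (fun w => \prod_(i <- [::]) F i w) = (fun=> 1 : R[i]).
    by apply/funext => w; rewrite big_nil.
  exact: cderivable_cst.
have -> : (fun w => \prod_(j <- i :: s) F j w) =
    (fun w => F i w * \prod_(j <- s) F j w).
  by apply/funext => w; rewrite big_cons.
exact: (@cderivableM (F i) (fun w => \prod_(j <- s) F j w) z (dF i) ih).
Qed.

Lemma continuous2_cabs_comp f (z : R -> R -> R[i]) :
  (forall x y, cderivable f (z x y)) ->
  continuous2 (fun x y => complex.Re (z x y)) ->
  continuous2 (fun x y => complex.Im (z x y)) ->
  [/\ continuous2 (fun x y => complex.Re (f (z x y))),
    continuous2 (fun x y => complex.Im (f (z x y))) &
    continuous2 (fun x y => cabs (f (z x y)))].
Proof.
move=> df cR cI.
suff H (p : R * R) e : 0 < e ->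
    \forall q \near p, cabs (f (z p.1 p.2) - f (z q.1 q.2)) <= e.
  split=> p; apply/cvgrPdist_le => e e0; near=> q.
  - rewrite -raddfB (le_trans (Re_le_cabs _))//.
    by near: q; exact: H.
  - rewrite -raddfB (le_trans (Im_le_cabs _))//.
    by near: q; exact: H.
  - by rewrite (le_trans (cabs_dist _ _))//; near: q; exact: H.
move=> e0; have [d d0 dP] := cderivable_continuous (df p.1 p.2) e0.
have d40 : 0 < d / 4 by rewrite divr_gt0.
near=> q; rewrite cabs_sym; apply: dP.
rewrite (le_lt_trans (cabs_le_ReIm _))// !raddfB /= distrC.
rewrite [X in _ + X]distrC.
apply: (@le_lt_trans _ _ (d / 4 + d / 4)); last by lra.
apply: lerD; near: q.
- by move/cvgrPdist_le : (cR p); apply.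
- by move/cvgrPdist_le : (cI p); apply.
Unshelve. all: by end_near. Qed.

Definition cexp z : R[i] :=
  (expR (complex.Re z) * cos (complex.Im z)) +i*
  (expR (complex.Re z) * sin (complex.Im z)).

Lemma cexpD z w : cexp (z + w) = cexp z * cexp w.
Proof.
case: z w => [a b] [c d]; rewrite /cexp /= expRD cosD sinD.
by congr (_ +i* _); ring.
Qed.

Lemma cabs_circle_pt r t : cabs (circle_pt r t) = `|r|.
Proof.
by rewrite /= !exprMn -mulrDr cos2Dsin2 mulr1 sqrtr_sqr.
Qed.

Lemma cexp_circle_pt z : cexp z = circle_pt (expR (complex.Re z)) (complex.Im z).
Proof. by []. Qed.

Lemma cabs_cexp z : cabs (cexp z) = expR (complex.Re z).
Proof. by rewrite cexp_circle_pt cabs_circle_pt ger0_norm// expR_ge0. Qed.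

Lemma sin_MVT x : 0 < x ->
  exists2 y, y \in `]0, x[%R & sin x - sin 0 = cos y * (x - 0).
Proof.
move=> x0; apply: MVT => //.
by apply: continuous_subspaceT => y; exact: continuous_sin.
Qed.

Lemma sin_le_norm x : `|sin x| <= `|x|.
Proof.
wlog x0 : x / 0 <= x => [hw|].
  have [/hw//|x0] := leP 0 x.
  by rewrite -(normrN x) -(normrN (sin x)) -sinN; apply: hw; rewrite oppr_ge0 ltW.
have [->|x00] := eqVneq x 0; first by rewrite sin0.
have xp : 0 < x by rewrite lt0r x00.
have [y _] := sin_MVT xp.
rewrite sin0 !subr0 => ->; rewrite normrM ler_piMl//.
exact: cos_max.
Qed.

Lemma cos_sub1_le x : `|cos x - 1| <= x ^+ 2 / 2.
Proof.
have -> : cos x - 1 = - (2 * sin (x / 2) ^+ 2).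
  rewrite {1}(_ : x = (x / 2) *+ 2); last by rewrite mulr2n; field.
  by rewrite cos_mulr2n cos2sin2; ring.
have s0 : 0 <= 2 * sin (x / 2) ^+ 2 by rewrite mulr_ge0// sqr_ge0.
rewrite normrN ger0_norm// -(real_normK (num_real (sin (x / 2)))).
have h : `|sin (x / 2)| ^+ 2 <= `|x / 2| ^+ 2 by rewrite lerXn2r ?nnegrE// sin_le_norm.
move: h; rewrite (real_normK (num_real (x / 2))) expr_div_n; lra.
Qed.

Lemma sin_subx_le x : `|x| <= 1 -> `|sin x - x| <= x ^+ 2 / 2.
Proof.
wlog x0 : x / 0 <= x => [hw|].
  have [/hw//|x0 x1] := leP 0 x.
  have := hw (- x); rewrite normrN oppr_ge0 ltW// sinN opprK sqrrN => /(_ isT x1).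
  by rewrite -normrN opprD !opprK.
rewrite (ger0_norm x0) => x1.
have [->|x00] := eqVneq x 0; first by rewrite sin0 subr0 normr0 expr0n/= mul0r.
have xp : 0 < x by rewrite lt0r x00.
have [y] := sin_MVT xp.
rewrite in_itv/= sin0 !subr0 => /andP[y0 yx] ->.
have -> : cos y * x - x = (cos y - 1) * x by ring.
rewrite normrM (ger0_norm x0).
have y2 : y ^+ 2 <= x ^+ 2 by rewrite lerXn2r ?nnegrE ?ltW.
have h1 : `|cos y - 1| * x <= `|cos y - 1| by rewrite ler_piMr.
have := cos_sub1_le y; lra.
Qed.

Lemma expR_taylor1 x : `|x| <= 1 / 2 -> 0 <= expR x - 1 - x <= 2 * x ^+ 2.
Proof.
move=> /ler_normlP[x1 x2]; have h1 := expR_ge1Dx x; have h2 := expR_ge1Dx (- x).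
have x10 : 0 < 1 - x by lra.
have : expR x <= (1 - x)^-1.
  by rewrite -[leLHS]invrK -expRN lef_pV2 ?posrE ?expR_gt0.
have : (1 - x)^-1 <= 1 + x + 2 * x ^+ 2.
  rewrite -[leLHS]mul1r ler_pdivrMr//.
  have -> : (1 + x + 2 * x ^+ 2) * (1 - x) = 1 + x ^+ 2 * (1 - 2 * x) by ring.
  by rewrite lerDl mulr_ge0 ?sqr_ge0//; lra.
by move=> h3 h4; apply/andP; split; lra.
Qed.

Lemma cexp_taylor1 w : cabs w <= 1 / 2 ->
  cabs (cexp w - 1 - w) <= 3 * cabs w ^+ 2.
Proof.
case: w => a b w2.
have a2 : `|a| <= 1 / 2 by exact: le_trans (Re_le_cabs (a +i* b)) w2.
have b2 : `|b| <= 1 / 2 by exact: le_trans (Im_le_cabs (a +i* b)) w2.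
have -> : cabs (a +i* b) ^+ 2 = a ^+ 2 + b ^+ 2.
  by rewrite /= sqr_sqrtr// addr_ge0 ?sqr_ge0.
apply: (le_trans (cabs_le_ReIm _)); rewrite /=.
have /andP[e0 e1] := expR_taylor1 a2.
have c1 := cos_sub1_le b; have b21 : `|b| <= 1 by apply: (le_trans b2); lra.
have s1 := sin_subx_le b21.
have a22 : a ^+ 2 <= 1 / 4.
  rewrite -(real_normK (num_real a)) (_ : 1 / 4 = (1 / 2) ^+ 2); last by field.
  by rewrite lerXn2r ?nnegrE.
have /ler_normlP[a3 a4] := a2.
have E2 : expR a <= 2 by lra.
have E0 := expR_ge0 a.
have R1 : `|expR a * cos b - 1 - a| <= b ^+ 2 + 2 * a ^+ 2.
  have -> : expR a * cos b - 1 - a = expR a * (cos b - 1) + (expR a - 1 - a) by ring.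
  rewrite (le_trans (ler_normD _ _))// lerD//; last by rewrite ger0_norm.
  rewrite normrM (ger0_norm E0).
  by have := ler_pM E0 (normr_ge0 _) E2 c1; lra.
have ea : `|expR a - 1| <= 2 * `|a|.
  have -> : expR a - 1 = (expR a - 1 - a) + a by ring.
  rewrite (le_trans (ler_normD _ _))// (ger0_norm e0).
  have : `|a| ^+ 2 <= 1 / 2 * `|a| by rewrite expr2 ler_wpM2r.
  by rewrite (real_normK (num_real a)); lra.
have I1 : `|expR a * sin b - 0 - b| <= b ^+ 2 + (a ^+ 2 + b ^+ 2).
  have -> : expR a * sin b - 0 - b = expR a * (sin b - b) + (expR a - 1) * b by ring.
  rewrite (le_trans (ler_normD _ _))// !normrM (ger0_norm E0) lerD//.
    by have := ler_pM E0 (normr_ge0 _) E2 s1; lra.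
  apply: (@le_trans _ _ (2 * `|a| * `|b|)); first by rewrite ler_wpM2r.
  rewrite -(real_normK (num_real a)) -(real_normK (num_real b)).
  by have := sqr_ge0 (`|a| - `|b|); rewrite sqrrB -mulr_natr; lra.
have := sqr_ge0 a; have := sqr_ge0 b; lra.
Qed.

(** For a = exp c the distance from exp (c + w) to a is |a| |exp w - 1|; the lemma makes it
    comparable with |a| |w|. *)
Lemma cexp_sub1 w : cabs w <= 1 / 6 ->
  cabs w / 2 <= cabs (cexp w - 1) <= 3 / 2 * cabs w.
Proof.
move=> w6; have w2 : cabs w <= 1 / 2 by lra.
have := cexp_taylor1 w2.
have h : cabs w ^+ 2 <= 1 / 6 * cabs w by rewrite expr2 ler_wpM2r// cabs_ge0.
have := cabsD (cexp w - 1 - w) w; rewrite subrK.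
have := cabsB (cexp w - 1) (cexp w - 1 - w); rewrite opprD addNKr opprK.
by move=> h1 h2 h3; apply/andP; split; lra.
Qed.

Lemma cderivable_cexp z : cderivable (@cexp) z.
Proof.
apply/cderivableP; exists (cexp z) => e e0.
have c0 : 0 < 3 * (cabs (cexp z) + 1) by rewrite mulr_gt0// ltr_wpDl// cabs_ge0.
exists (Num.min (1 / 2) (e / (3 * (cabs (cexp z) + 1)))).
  by rewrite lt_min !divr_gt0.
move=> w; rewrite lt_min => /andP[/ltW w1]; rewrite ltr_pdivlMr// => w2.
have -> : cexp w - cexp z - cexp z * (w - z) =
    cexp z * (cexp (w - z) - 1 - (w - z)).
  by rewrite !mulrBr -cexpD mulr1 (addrC z) subrK.
rewrite cabsM; set t := cabs (w - z) in w1 w2 *.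
have t0 : 0 <= t by exact: cabs_ge0.
have := cexp_taylor1 w1; rewrite -/t => h.
apply: (le_trans (ler_wpM2l (cabs_ge0 _) h)).
have -> : cabs (cexp z) * (3 * t ^+ 2) = t * (3 * cabs (cexp z)) * t by ring.
rewrite ler_wpM2r//; apply: le_trans (ltW w2).
by rewrite ler_wpM2l// ler_pM2l// lerDl.
Qed.

Lemma periodic_circle_pt r t : circle_pt r (t + 2 * pi) = circle_pt r t :> R[i].
Proof. by rewrite /circle_pt mulr_natl cosD2pi sinD2pi. Qed.

(** In the coordinates z = exp (s + i t) the sides t = 0 and t = 2 pi of a rectangle carry the same
    values, so Goursat makes the mean of Re f over circles independent of the radius. Small circles
    identify this mean with Re f(0). *)
Lemma max_principle_Re f r r' B : 0 < r -> r < r' ->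
  (forall z, cabs z < r' -> cderivable f z) ->
  (forall t, 0 <= t <= 2 * pi -> complex.Re (f (circle_pt r t)) <= B) ->
  complex.Re (f 0) <= B.
Proof.
move=> r0 rr' df fB.
have p0 : 0 <= 2 * pi :> R by rewrite mulr_ge0// pi_ge0.
have p00 : 0 < 2 * pi :> R by rewrite mulr_gt0// pi_gt0.
pose b := ln r.
(* The minimum extends the integrand continuously beyond the circle of radius r. *)
pose z s t : R[i] := cexp (Num.min s b +i* t).
have zr s t : cabs (z s t) < r'.
  rewrite cabs_cexp /=; apply: le_lt_trans rr'.
  by rewrite -(lnK r0) ler_expR ge_min lexx orbT.
pose u s t := complex.Re (f (z s t)); pose v s t := complex.Im (f (z s t)).
have cmin : continuous2 (fun s _ : R => expR (Num.min s b)).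
  apply: continuous2_lift => s; apply: continuous_comp; last exact: continuous_expR.
  by apply: continuous_min; [exact: cvg_id|exact: cvg_cst].
have [cu cv _] : [/\ continuous2 u, continuous2 v &
    continuous2 (fun s t => cabs (f (z s t)))].
  apply: continuous2_cabs_comp => [s t||]; first exact: df.
  - apply: continuous2M => //.
    by apply: continuous2_comp; [exact: continuous_cos|exact: continuous2_snd].
  - apply: continuous2M => //.
    by apply: continuous2_comp; [exact: continuous_sin|exact: continuous2_snd].
have F a : a <= b -> flux u v a b 0 (2 * pi) = 0.
  move=> ab; apply: goursat => // s t /andP[_ sb] _.
  have zE s' t' : s' <= b -> z s' t' = cexp (s' +i* t').
    by move=> sb'; rewrite /z min_l.
  have : cderivable (fun w => f (cexp w)) (s +i* t).
    apply: cderivable_comp; first exact: cderivable_cexp.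
    by apply: df; rewrite -zE.
  move=> /cderivableP[[al be] lP].
  (* The derivative al + i be gives u_s = v_t = al, u_t = - be and v_s = be. *)
  exists al, (- be), be => e e0; have [d d0 dP] := lP e e0.
  exists (d / 3); first by rewrite divr_gt0.
  move=> s' t' /andP[_ sb'] _ ss tt; rewrite /u /v !zE//.
  have wz : cabs ((s' +i* t') - (s +i* t)) <= `|s' - s| + `|t' - t|.
    exact: cabs_le_ReIm.
  have xyd (x y : R) : x <= d / 3 -> y <= d / 3 -> x + y < d.
    by move=> xd yd; clear - d0 xd yd; lra.
  have {}dP := dP (s' +i* t') (le_lt_trans wz (xyd _ _ ss tt)).
  have {}dP : cabs (f (cexp (s' +i* t')) - f (cexp (s +i* t)) -
    (al +i* be) * ((s' +i* t') - (s +i* t))) <= e * (`|s' - s| + `|t' - t|).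
    by apply: (le_trans dP); rewrite ler_wpM2l// ltW.
  split.
  - apply: le_trans dP; apply: le_trans (Re_le_cabs _).
    rewrite (_ : complex.Re (_ - _ - _) = complex.Re (f (cexp (s' +i* t'))) -
      complex.Re (f (cexp (s +i* t))) - (al * (s' - s) + - be * (t' - t)))//.
    by case: (f _) => ? ?; case: (f _) => ? ? /=; ring.
  - apply: le_trans dP; apply: le_trans (Im_le_cabs _).
    rewrite (_ : complex.Im (_ - _ - _) = complex.Im (f (cexp (s' +i* t'))) -
      complex.Im (f (cexp (s +i* t))) - (be * (s' - s) + al * (t' - t)))//.
    by case: (f _) => ? ?; case: (f _) => ? ? /=; ring.
have E a : a <= b -> segint 0 (2 * pi) (u a) = segint 0 (2 * pi) (u b).
  have vE : v^~ (2 * pi) = v^~ 0.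
    apply/funext => s; rewrite /v /z !cexp_circle_pt /=.
    by rewrite -(add0r (2 * pi)) periodic_circle_pt.
  move=> /F; rewrite /flux vE.
  move: (segint _ _ (u b)) (segint _ _ (u a)) (segint _ _ (v^~ 0)) => X Y Z.
  by clear; lra.
apply/ler_addgt0Pr => e e0.
have f0 : cderivable f 0 by apply: df; rewrite cabs0 (lt_trans r0).
have [d d0 dP] := cderivable_continuous f0 e0.
(* On the circle of radius exp a <= d / 2, f stays within e of f(0). *)
pose a := Num.min b (ln (d / 2)).
have ab : a <= b by rewrite ge_min lexx.
have ua t : complex.Re (f 0) - e <= u a t.
  have : cabs (f (z a t) - f 0) <= e.
    apply: dP; rewrite subr0 cabs_cexp /= (min_l ab).
    apply: (@le_lt_trans _ _ (d / 2)); last by lra.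
    by rewrite -[leRHS](@lnK _ (d / 2)) ?posrE ?divr_gt0// ler_expR ge_min lexx orbT.
  by move/(le_trans (Re_le_cabs _)); rewrite raddfB => /ler_normlP[]; rewrite /u; lra.
have : (complex.Re (f 0) - e) * (2 * pi - 0) <= B * (2 * pi - 0).
  rewrite -!segint_cst//.
  apply: (@le_trans _ _ (segint 0 (2 * pi) (u a))).
    apply: le_segint; [by move=> ?; exact: cvg_cst|exact: continuous2_row|].
    by move=> t _; exact: ua.
  rewrite E//; apply: le_segint; [exact: continuous2_row|by move=> ?; exact: cvg_cst|].
  move=> t tp; have := fB t tp.
  by rewrite /u /z cexp_circle_pt /= minxx lnK.
by rewrite subr0 ler_pM2r// lerBlDr.
Qed.

(** Applied to f / f(0): its real part is 1 at the centre and at most its modulus on the circle. *)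
Lemma max_principle f r r' B : 0 < r -> r < r' ->
  (forall z, cabs z < r' -> cderivable f z) ->
  (forall t, 0 <= t <= 2 * pi -> cabs (f (circle_pt r t)) <= B) ->
  cabs (f 0) <= B.
Proof.
move=> r0 rr' df fB.
have [f0|f0] := eqVneq (f 0) 0.
  rewrite f0 cabs0; apply: (le_trans (cabs_ge0 _) (fB 0 _)).
  by rewrite lexx mulr_ge0// pi_ge0.
have := @max_principle_Re (fun z => (f 0)^-1 * f z) r r' ((cabs (f 0))^-1 * B) r0 rr'.
rewrite mulVf// => H.
suff : 1 <= (cabs (f 0))^-1 * B by rewrite mulrC ler_pdivlMr ?cabs_gt0// mul1r.
apply: H => [z /df dfz|t /fB fBt].
  exact (cderivableM (@cderivable_cst (f 0)^-1 z) dfz).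
apply: (le_trans (ler_norm _)); apply: (le_trans (Re_le_cabs _)).
by rewrite cabsM cabsV ler_wpM2l// invr_ge0 cabs_ge0.
Qed.

End Complex_preliminaries.

(** * Discrete submean inequalities *)

Section Discrete_submean.
Variable R : realType.
Implicit Types (z w c a : R[i]) (f g : R[i] -> R[i]) (x y t r e eta : R).

(** The maximum with eta keeps the logarithm continuous across the zeros, and the submean inequality
    survives because constants satisfy it too. *)
Definition ltrunc eta z : R := ln (Num.max (cabs z) eta).

Lemma expR_ltrunc eta z : 0 < eta -> expR (ltrunc eta z) = Num.max (cabs z) eta.
Proof. by move=> e0; rewrite lnK// posrE lt_max e0 orbT. Qed.

Lemma circle_pt_rot r t y : circle_pt r (t + y) = circle_pt 1 y * circle_pt r t :> R[i].
Proof.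
by rewrite /circle_pt cosD sinD; congr (_ +i* _); rewrite !mul1r; ring.
Qed.

(* The modulus of w |-> prod_k f (c + omega^k w), omega = exp (2 pi i / n), at 0
   is |f c|^n; on the circle |w| = r it is a geometric mean over n equidistant
   points, up to the oscillation e. *)
Lemma product_submean f c r r' n eta e : 0 < r -> r < r' ->
  (forall z, cabs (z - c) < r' -> cderivable f z) ->
  (0 < n)%N -> 0 < eta -> 0 <= e ->
  (forall k y, (k < n)%N -> 0 <= y <= 2 * pi / n%:R ->
    ltrunc eta (f (c + circle_pt r (k%:R * (2 * pi / n%:R) + y))) <=
    ltrunc eta (f (c + circle_pt r (k%:R * (2 * pi / n%:R)))) + e) ->
  ltrunc eta (f c) <=
  n%:R^-1 * (\sum_(0 <= k < n)
    ltrunc eta (f (c + circle_pt r (k%:R * (2 * pi / n%:R))))) + e.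
Proof.
move=> r0 rr' df n0 eta0 e0 osc.
have n00 : 0 < n%:R :> R by rewrite ltr0n.
pose b : R := 2 * pi / n%:R.
have b0 : 0 < b by rewrite divr_gt0// mulr_gt0// pi_gt0.
pose L t := ltrunc eta (f (c + circle_pt r t)).
pose S t := \sum_(0 <= k < n) L (k%:R * b + t).
(* The term of index n equals that of index 0, since n steps make a full turn. *)
have Sb t : S (t + b) = S t.
  have Lper : L (n%:R * b + t) = L t.
    have -> : n%:R * b = 2 * pi by rewrite /b mulrC divfK ?gt_eqF.
    by rewrite (addrC (2 * pi)) /L periodic_circle_pt.
  have E1 : \sum_(0 <= k < n.+1) L (k%:R * b + t) = S t + L t.
    by rewrite big_nat_recr//= Lper.
  have E2 : \sum_(0 <= k < n.+1) L (k%:R * b + t) = L t + S (t + b).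
    rewrite big_nat_recl//= mul0r add0r; congr (_ + _).
    by apply: eq_bigr => k _; congr L; rewrite -natr1 mulrDl mul1r -addrA (addrC b).
  by apply: (@addrI _ (L t)); rewrite -E2 E1 addrC.
have SbM t j : S (t + j%:R * b) = S t.
  elim: j => [|j ih]; first by rewrite mul0r addr0.
  by rewrite -natr1 mulrDl mul1r addrA Sb.
have S0 y : 0 <= y <= b -> S y <= S 0 + n%:R * e.
  move=> yb; rewrite /S.
  apply: (@le_trans _ _ (\sum_(0 <= k < n) (L (k%:R * b) + e))).
    by apply: ler_sum_nat => k kn; exact: osc.
  rewrite big_split/= sumr_const_nat subn0 -[e *+ n]mulr_natl lerD2r.
  by apply: ler_sum_nat => k kn; rewrite addr0.
(* By periodicity every shift reduces to one in [0, b], where the oscillation hypothesis applies. *)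
have SS t : 0 <= t -> S t <= S 0 + n%:R * e.
  move=> t0; have tb0 : 0 <= t / b by rewrite divr_ge0// ltW.
  have /andP[h1 h2] := truncn_itv tb0.
  set j := Num.truncn (t / b) in h1 h2.
  have -> : t = (t - j%:R * b) + j%:R * b by rewrite subrK.
  rewrite SbM; apply: S0; apply/andP; split.
    by rewrite subr_ge0 -ler_pdivlMr.
  by move: h2; rewrite ltr_pdivrMr// -natr1 mulrDl mul1r => h2; rewrite lerBlDl addrC ltW// addrC.
have prodexp t : \prod_(0 <= k < n) Num.max (cabs (f (c + circle_pt r (k%:R * b + t)))) eta
    = expR (S t).
  rewrite /S expR_sum; apply: eq_bigr => k _.
  by rewrite expR_ltrunc.
have P0 : cabs (f c) ^+ n <= expR (S 0 + n%:R * e).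
  pose P w := \prod_(0 <= k < n) f (c + circle_pt 1 (k%:R * b) * w).
  have -> : cabs (f c) ^+ n = cabs (P 0).
    rewrite /P cabs_prod (eq_bigr (fun=> cabs (f c))).
      by rewrite prodr_const_nat subn0.
    by move=> k _; rewrite mulr0 addr0.
  apply: (@max_principle _ P r r') => // [z zr|t /andP[t0 _]].
    apply: cderivable_prod => k.
    apply: (@cderivable_comp _ f (fun w => c + circle_pt 1 (k%:R * b) * w)).
      apply: cderivableD; first exact: cderivable_cst.
      apply: (@cderivableM _ (fun=> circle_pt 1 (k%:R * b)) (fun w => w)).
        exact: cderivable_cst.
      exact: cderivable_id.
    by apply: df; rewrite addrC addKr cabsM cabs_circle_pt normr1 mul1r.
  apply: (@le_trans _ _ (expR (S t))); last by rewrite ler_expR SS.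
  rewrite -prodexp cabs_prod; apply: ler_prod => k _.
  by rewrite cabs_ge0 -circle_pt_rot (addrC t) le_max lexx.
(* The other half of the maximum: every factor of the truncated product is at least eta. *)
have E0 : eta ^+ n <= expR (S 0 + n%:R * e).
  apply: (@le_trans _ _ (expR (S 0))); last first.
    by rewrite ler_expR lerDl mulr_ge0// ltW.
  rewrite -prodexp -[X in _ ^+ X]subn0 -prodr_const_nat; apply: ler_prod => k _.
  by rewrite ltW//= le_max lexx orbT.
have M0 : Num.max (cabs (f c)) eta ^+ n <= expR (S 0 + n%:R * e).
  by case: (leP (cabs (f c)) eta).
have : expR (n%:R * ltrunc eta (f c)) <= expR (S 0 + n%:R * e).
  by rewrite expRM_natl expR_ltrunc.
rewrite ler_expR -ler_pdivlMl// mulrDr mulKf ?gt_eqF//.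
by rewrite /S; under eq_bigr do rewrite addr0.
Qed.

Lemma sin_lip x y : `|sin x - sin y| <= `|x - y|.
Proof.
have [m [d [-> ->]]] : exists m d, x = m + d /\ y = m - d.
  by exists ((x + y) / 2), ((x - y) / 2); split; field.
have -> : sin (m + d) - sin (m - d) = 2 * (cos m * sin d).
  by rewrite sinD sinB; ring.
have -> : m + d - (m - d) = 2 * (1 * d) by ring.
rewrite [leLHS]normrM [leRHS]normrM ler_wpM2l// !normrM normr1.
by apply: ler_pM => //; [exact: cos_max|exact: sin_le_norm].
Qed.

Lemma cos_lip x y : `|cos x - cos y| <= `|x - y|.
Proof.
have [m [d [-> ->]]] : exists m d, x = m + d /\ y = m - d.
  by exists ((x + y) / 2), ((x - y) / 2); split; field.
have -> : cos (m + d) - cos (m - d) = 2 * (- (sin m * sin d)).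
  by rewrite cosD cosB; ring.
have -> : m + d - (m - d) = 2 * (1 * d) by ring.
rewrite [leLHS]normrM [leRHS]normrM ler_wpM2l// normrN !normrM normr1.
by apply: ler_pM => //; [exact: sin_max|exact: sin_le_norm].
Qed.

Definition log_polar x t : R[i] := circle_pt (expR (- x)) t.

Lemma log_polarE x t : log_polar x t = cexp (- x +i* t).
Proof. by []. Qed.

Lemma cabs_log_polar x t : cabs (log_polar x t) = expR (- x).
Proof. by rewrite cabs_circle_pt ger0_norm// expR_ge0. Qed.

Lemma log_polar_periodic x t : log_polar x (t + 2 * pi) = log_polar x t.
Proof. exact: periodic_circle_pt. Qed.

(** The open disc of radius x about - x + i t lies in the left half-plane, which exp maps into the
    unit disc; so f composed with exp is holomorphic there. *)
Lemma log_polar_submean f x t r n eta e : 0 < r -> r < x ->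
  (forall z, cabs z < 1 -> cderivable f z) ->
  (0 < n)%N -> 0 < eta -> 0 <= e ->
  (forall u v, 0 <= u -> u <= v -> v <= u + 2 * pi / n%:R -> v <= 2 * pi ->
    ltrunc eta (f (log_polar (x - r * cos v) (t + r * sin v))) <=
    ltrunc eta (f (log_polar (x - r * cos u) (t + r * sin u))) + e) ->
  ltrunc eta (f (log_polar x t)) <=
  n%:R^-1 * (\sum_(0 <= k < n)
    ltrunc eta (f (log_polar (x - r * cos (k%:R * (2 * pi / n%:R)))
                             (t + r * sin (k%:R * (2 * pi / n%:R)))))) + e.
Proof.
move=> r0 rx df n0 eta0 e0 osc.
have n00 : 0 < n%:R :> R by rewrite ltr0n.
have b0 : 0 < 2 * pi / n%:R :> R by rewrite divr_gt0// mulr_gt0// pi_gt0.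
have cE u : cexp ((- x +i* t) + circle_pt r u) =
    log_polar (x - r * cos u) (t + r * sin u).
  by rewrite log_polarE (_ : - (x - r * cos u) = - x + r * cos u)// opprB addrC.
have := @product_submean (fun z => f (cexp z)) (- x +i* t) r x n eta e r0 rx.
move=> H; have {}H := H _ n0 eta0 e0 _.
rewrite -!log_polarE in H; under eq_bigr do rewrite -cE.
apply: H.
  move=> z zx; apply: cderivable_comp; first exact: cderivable_cexp.
  apply: df; rewrite cabs_cexp -expR0 ltr_expR.
  have := le_lt_trans (Re_le_cabs _) zx; rewrite raddfB /= opprK ltr_norml => /andP[_].
  by rewrite -ltrBrDr subrr.
move=> k y kn /andP[y0 yb]; rewrite !cE; apply: osc.
- by rewrite mulr_ge0// ltW.
- by rewrite lerDl.
- by rewrite lerD2l.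
- rewrite (@le_trans _ _ (k.+1%:R * (2 * pi / n%:R)))//.
    have -> (b : R) : k.+1%:R * b = k%:R * b + b by rewrite -natr1 mulrDl mul1r.
    by rewrite lerD2l.
  rewrite mulrCA ler_piMr// ?mulr_ge0 ?pi_ge0//.
  by rewrite ler_pdivrMr// mul1r ler_nat.
Qed.

Lemma continuous2_log_polar_Re : continuous2 (fun x t => complex.Re (log_polar x t)).
Proof.
apply: continuous2M.
  apply: continuous2_lift => x; apply: continuous_comp; last exact: continuous_expR.
  by apply: cvgN; exact: cvg_id.
by apply: continuous2_comp; [exact: continuous_cos|exact: continuous2_snd].
Qed.

Lemma continuous2_log_polar_Im : continuous2 (fun x t => complex.Im (log_polar x t)).
Proof.
apply: continuous2M.
  apply: continuous2_lift => x; apply: continuous_comp; last exact: continuous_expR.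
  by apply: cvgN; exact: cvg_id.
by apply: continuous2_comp; [exact: continuous_sin|exact: continuous2_snd].
Qed.

Lemma continuous2_ltrunc (h : R -> R -> R[i]) eta : 0 < eta ->
  continuous2 (fun x t => cabs (h x t)) ->
  continuous2 (fun x t => ltrunc eta (h x t)).
Proof.
move=> eta0 ch z.
have c1 : {for z, continuous (fun z : R * R => Num.max (cabs (h z.1 z.2)) eta)}.
  by apply: continuous_max; [exact: ch|exact: cvg_cst].
have c2 : {for Num.max (cabs (h z.1 z.2)) eta, continuous (@ln R)}.
  by apply: continuous_ln; rewrite lt_max eta0 orbT.
exact: (continuous_comp c1 c2).
Qed.

Lemma continuous_sumr (I : Type) (s : seq I) (F : I -> R -> R) :
  (forall i, continuous (F i)) -> continuous (fun t => \sum_(i <- s) F i t).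
Proof.
move=> cF; elim: s => [|i s ih] t.
  rewrite (_ : (fun t => _) = (fun=> 0 : R)); first exact: cvg_cst.
  by apply/funext => u; rewrite big_nil.
rewrite (_ : (fun t => _) = (fun t => F i t + \sum_(j <- s) F j t)).
  by apply: cvgD; [exact: cF|exact: ih].
by apply/funext => u; rewrite big_cons.
Qed.

Lemma segint_sumr (I : Type) (s : seq I) (F : I -> R -> R) x y :
  (forall i, continuous (F i)) ->
  segint x y (fun t => \sum_(i <- s) F i t) = \sum_(i <- s) segint x y (F i).
Proof.
move=> cF; elim: s => [|i s ih].
  rewrite big_nil -[RHS](mul0r (segint x y (fun=> 0))) -segintZ.
    by apply: eq_segint => t _; rewrite big_nil mul0r.
  by move=> t; exact: cvg_cst.
rewrite big_cons -ih -segintD//; last exact: continuous_sumr.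
by apply: eq_segint => t _; rewrite big_cons.
Qed.

(** The inequality for n equidistant points is averaged over all rotations. By periodicity the n
    terms have the same integral, and the oscillation error is arbitrarily small for large n. *)
Lemma segint_submean f r r' eta : 0 < r -> r < r' -> 0 < eta ->
  (forall z, cabs z < r' -> cderivable f z) ->
  ltrunc eta (f 0) * (2 * pi) <=
  segint 0 (2 * pi) (fun t => ltrunc eta (f (circle_pt r t))).
Proof.
move=> r0 rr' eta0 df.
have p00 : 0 < 2 * pi :> R by rewrite mulr_gt0// pi_gt0.
have p0 := ltW p00.
pose h (_ t : R) := ltrunc eta (f (circle_pt r t)).
have ch : continuous2 h.
  apply: continuous2_ltrunc => //.
  have [//|||_ _ //] := @continuous2_cabs_comp R f (fun _ t => circle_pt r t).
  - by move=> _ t; apply: df; rewrite cabs_circle_pt gtr0_norm.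
  - apply: continuous2M; first exact: continuous2_cst.
    by apply: continuous2_comp; [exact: continuous_cos|exact: continuous2_snd].
  - apply: continuous2M; first exact: continuous2_cst.
    by apply: continuous2_comp; [exact: continuous_sin|exact: continuous2_snd].
have ch1 : continuous (h 0) by exact: continuous2_row.
have hper t : h 0 (t + 2 * pi) = h 0 t by rewrite /h periodic_circle_pt.
apply/ler_addgt0Pr => e e0.
have e'0 : 0 < e / (2 * pi) by rewrite divr_gt0.
have [d d0 dP] := continuous2_unif (4 * pi) ch e'0.
pose n := (Num.bound (2 * pi / d)).+1.
have n0 : 0 < n%:R :> R by rewrite ltr0n.
have nd : 2 * pi / n%:R <= d.
  rewrite ler_pdivrMr// [d * _]mulrC -ler_pdivrMr//.
  apply: (le_trans (ltW (archi_boundP _))); last by rewrite ler_nat.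
  by rewrite divr_ge0// ltW.
have pw t : 0 <= t <= 2 * pi -> ltrunc eta (f 0) <=
    n%:R^-1 * (\sum_(0 <= k < n) h 0 (t + k%:R * (2 * pi / n%:R))) + e / (2 * pi).
  move=> /andP[t0 t2].
  have E u : circle_pt 1 t * (0 + circle_pt r u) = circle_pt r (t + u).
    by rewrite add0r -circle_pt_rot addrC.
  have := @product_submean (fun z => f (circle_pt 1 t * z)) 0 r r' n eta (e / (2 * pi)).
  rewrite mulr0 => H; have {}H := H r0 rr' _ isT eta0 (ltW e'0) _.
  rewrite /h; under eq_bigr do rewrite -E.
  apply: H.
    move=> z; rewrite subr0 => zr.
    apply: (@cderivable_comp _ f (fun z => circle_pt 1 t * z)).
      apply: (@cderivableM _ (fun=> circle_pt 1 t) (fun w => w)).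
        exact: cderivable_cst.
      exact: cderivable_id.
    by apply: df; rewrite cabsM cabs_circle_pt normr1 mul1r.
  move=> k y kn /andP[y0 yb]; rewrite !E -lerBlDl.
  have kb : k%:R * (2 * pi / n%:R) <= 2 * pi - 2 * pi / n%:R :> R.
    rewrite lerBrDr -{2}[2 * pi / _]mul1r -mulrDl natr1 mulrCA ler_piMr//.
    by rewrite ler_pdivrMr// mul1r ler_nat.
  have kb0 : 0 <= k%:R * (2 * pi / n%:R) :> R by rewrite mulr_ge0// divr_ge0// ltW.
  apply: (le_trans (ler_norm _)); apply: (dP 0 _ 0) => //.
  - by rewrite normr0 mulr_ge0// pi_ge0.
  - rewrite ger0_norm; last by rewrite !addr_ge0.
    by move: y0 yb kb kb0 t0 t2; move: (_ / _) (_ * (_ / _)) => *; lra.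
  - by rewrite subrr normr0 ltW.
  - rewrite (_ : t + _ - _ = y); last by ring.
    by rewrite ger0_norm// (le_trans yb).
have cs k : continuous (fun t => h 0 (t + k)).
  move=> t; apply: continuous_comp; last exact: ch1.
  by apply: cvgD; [exact: cvg_id|exact: cvg_cst].
have csum : continuous (fun t => \sum_(0 <= k < n) h 0 (t + k%:R * (2 * pi / n%:R))).
  by apply: continuous_sumr => k; exact: cs.
have Esum : segint 0 (2 * pi)
    (fun t => \sum_(0 <= k < n) h 0 (t + k%:R * (2 * pi / n%:R))) =
    n%:R * segint 0 (2 * pi) (h 0).
  rewrite segint_sumr; last by move=> k; exact: cs.
  rewrite (eq_bigr (fun=> segint 0 (2 * pi) (h 0))).
    by rewrite sumr_const_nat subn0 -[LHS]mulr_natl.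
  by move=> k _; exact: segint_periodic.
have : ltrunc eta (f 0) * (2 * pi - 0) <= segint 0 (2 * pi)
   (fun t => n%:R^-1 * (\sum_(0 <= k < n) h 0 (t + k%:R * (2 * pi / n%:R))) + e / (2 * pi)).
  rewrite -segint_cst//; apply: le_segint => //.
  - by move=> ?; exact: cvg_cst.
  - move=> t; apply: cvgD; last exact: cvg_cst.
    by apply: cvgM; [exact: cvg_cst|exact: csum].
rewrite segintD; last 2 first.
- by move=> t; apply: cvgM; [exact: cvg_cst|exact: csum].
- by move=> ?; exact: cvg_cst.
by rewrite segintZ// Esum segint_cst// subr0 mulKf ?gt_eqF// divfK ?gt_eqF.
Qed.

(** With w the offset from (xa, ta), |z - a| = |a| |exp w - 1|: at most 3 r / 16 |a| at the centre,
    where |w| <= r / 8, and at least 7 r / 16 |a| on the circle, where |w| >= 7 r / 8. The quotient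
    exceeds 2, and eta is small enough for the truncation not to spoil this. *)
Lemma ltrunc_gain a x t xa ta r u eta : 0 < eta -> 0 < r -> r <= 1 / 8 ->
  a = log_polar xa ta -> `|x - xa| + `|t - ta| <= r / 8 ->
  eta <= cabs a * (r / 8) ->
  ltrunc eta (log_polar x t - a) + ln 2 <=
  ltrunc eta (log_polar (x - r * cos u) (t + r * sin u) - a).
Proof.
move=> eta0 r0 r8 aE xt etar.
pose c : R[i] := (- x +i* t) - (- xa +i* ta).
have cr : cabs c <= r / 8.
  apply: (le_trans (cabs_le_ReIm _)).
  have -> : complex.Re c = - (x - xa) by rewrite /c /=; ring.
  by rewrite normrN.
have fact z : cexp ((- xa +i* ta) + z) - a = a * (cexp z - 1).
  by rewrite cexpD aE log_polarE mulrBr mulr1.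
have a0 : 0 < cabs a by rewrite aE cabs_log_polar expR_gt0.
have -> : log_polar x t - a = a * (cexp c - 1).
  by rewrite -fact log_polarE (addrC _ c) /c subrK.
have -> : log_polar (x - r * cos u) (t + r * sin u) - a =
    a * (cexp (c + circle_pt r u) - 1).
  rewrite -fact log_polarE addrA (addrC _ c) /c subrK.
  by rewrite (_ : - (x - r * cos u) = - x + r * cos u)// opprB addrC.
have /andP[_ h1] := @cexp_sub1 _ c ltac:(lra).
have w1 : cabs (c + circle_pt r u) <= r + r / 8.
  by rewrite (le_trans (cabsD _ _))// cabs_circle_pt gtr0_norm// addrC lerD2l.
have w2 : r - r / 8 <= cabs (c + circle_pt r u).
  have := cabsB (c + circle_pt r u) c; rewrite addrC addKr cabs_circle_pt gtr0_norm//.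
  lra.
have /andP[h2 _] := @cexp_sub1 _ (c + circle_pt r u) ltac:(lra).
have m0 z : 0 < Num.max (cabs z) eta by rewrite lt_max eta0 orbT.
rewrite /ltrunc -lnM ?posrE// ler_ln ?posrE ?mulr_gt0//.
rewrite !cabsM.
have U1 : Num.max (cabs a * cabs (cexp c - 1)) eta <= cabs a * (3 * r / 16).
  rewrite ge_max; apply/andP; split.
    by rewrite ler_pM2l//; lra.
  by apply: (le_trans etar); rewrite ler_pM2l//; lra.
have U2 : cabs a * (7 * r / 16) <= cabs a * cabs (cexp (c + circle_pt r u) - 1).
  by rewrite ler_pM2l//; lra.
rewrite le_max; apply/orP; left; apply: le_trans U2.
apply: (@le_trans _ _ (cabs a * (3 * r / 16) * 2)); first by rewrite ler_pM2r.
by rewrite -mulrA ler_pM2l//; lra.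
Qed.

End Discrete_submean.

(** * The weights *)

Section Kernel_inequality.
Variable R : realType.
Implicit Types (x y u p q tau kap b B w : R) (n k : nat).

Definition root_angle n k : R := k%:R * (2 * pi / n%:R).

(** Telescoping: 2 sin (b / 2) cos (k b) = sin (k b + b / 2) - sin (k b - b / 2). *)
Lemma sum_cos_mul b n :
  2 * sin (b / 2) * (\sum_(0 <= k < n) cos (k%:R * b)) =
  sin (n%:R * b - b / 2) + sin (b / 2).
Proof.
elim: n => [|n ih].
  by rewrite big_geq// mulr0 mul0r sub0r sinN addNr.
rewrite big_nat_recr//= mulrDr ih.
have -> : n.+1%:R * b - b / 2 = n%:R * b + b / 2 by rewrite -[n.+1%:R]natr1; field.
by rewrite sinB sinD; ring.
Qed.

Lemma sin_pi_frac_gt0 n : (2 <= n)%N -> 0 < sin (pi / n%:R : R).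
Proof.
move=> n2; have n0 : 0 < n%:R :> R by rewrite ltr0n; apply: leq_trans n2.
apply: sin_gt0_pi; rewrite divr_gt0 ?pi_gt0//= ltr_pdivrMr// ltr_pMr ?pi_gt0//.
by rewrite ltr1n.
Qed.

Lemma sum_cos_root n : (2 <= n)%N -> \sum_(0 <= k < n) cos (root_angle n k) = 0.
Proof.
move=> n2; have n0 : n%:R != 0 :> R by rewrite pnatr_eq0; case: n n2.
have := sum_cos_mul (2 * pi / n%:R) n.
have -> : n%:R * (2 * pi / n%:R) - 2 * pi / n%:R / 2 = - (pi / n%:R) + pi *+ 2 :> R.
  by rewrite -mulr_natl; field.
have -> : 2 * pi / n%:R / 2 = pi / n%:R :> R by field.
rewrite sinD2pi sinN addNr => /eqP; rewrite mulf_eq0 => /orP[|/eqP//].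
by rewrite gt_eqF// mulr_gt0// sin_pi_frac_gt0.
Qed.

(** After linearisation the angle 4 pi / n must not be a multiple of 2 pi, which excludes n = 1 and
    n = 2. *)
Lemma sum_cos2_root n : (3 <= n)%N ->
  \sum_(0 <= k < n) cos (root_angle n k) ^+ 2 = n%:R / 2.
Proof.
move=> n3; have n0 : 0 < n%:R :> R by rewrite ltr0n; case: n n3.
have E : \sum_(0 <= k < n) cos (k%:R * (4 * pi / n%:R)) = 0 :> R.
  have := sum_cos_mul (4 * pi / n%:R) n.
  have -> : n%:R * (4 * pi / n%:R) - 4 * pi / n%:R / 2 =
      - (2 * pi / n%:R) + pi *+ 2 + pi *+ 2 :> R.
    by rewrite -mulr_natl; field; rewrite gt_eqF.
  have -> : 4 * pi / n%:R / 2 = 2 * pi / n%:R :> R by field; rewrite gt_eqF.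
  rewrite !sinD2pi sinN addNr => /eqP; rewrite mulf_eq0 => /orP[|/eqP//].
  rewrite gt_eqF// mulr_gt0// sin_gt0_pi// divr_gt0 ?mulr_gt0 ?pi_gt0//=.
  rewrite ltr_pdivrMr// mulrC ltr_pM2l ?pi_gt0//.
  by rewrite ltr_nat.
rewrite (eq_bigr (fun k => 1 / 2 + 1 / 2 * cos (k%:R * (4 * pi / n%:R)))).
rewrite big_split/= -[X in _ + X]mulr_sumr E mulr0 addr0 sumr_const_nat subn0.
  by rewrite -[LHS]mulr_natl; field.
move=> k _; rewrite (_ : k%:R * (4 * pi / n%:R) = (root_angle n k) *+ 2).
  by rewrite cos_mulr2n -[X in _ * (X - 1)]mulr_natl; field.
by rewrite /root_angle -[RHS]mulr_natl; field; rewrite gt_eqF.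
Qed.

(** The k-th point of the circle of radius x / 2 about depth x lies at depth x times this factor. *)
Definition radius_factor n k : R := 1 - cos (root_angle n k) / 2.

Lemma radius_factor_bound n k : 1 / 2 <= radius_factor n k <= 3 / 2.
Proof.
rewrite /radius_factor; have := cos_geN1 (root_angle n k).
by have := cos_le1 (root_angle n k) => h1 h2; apply/andP; split; lra.
Qed.

Lemma ln_ge_expR w z : expR z <= w -> z <= ln w.
Proof.
move=> zw; rewrite -ler_expR lnK//.
by rewrite posrE (lt_le_trans (expR_gt0 _) zw).
Qed.

(** The second-order gain u^2 / 5 of - ln (1 - u), set against a perturbation kap. Since exp (- z)
    >= (1 - z / 2)^2, it reduces to a polynomial inequality, where u >= - 1/2 ensures 1/20 + u / 10
    >= 0. *)
Lemma ln_sub_ge u kap : - (1 / 2) <= u <= 1 / 2 -> 0 <= kap <= 1 / 120 ->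
  u + u ^+ 2 / 5 - 3 * kap <= ln ((1 - u)^-1 - kap).
Proof.
move=> /andP[u1 u2] /andP[k0 k1]; apply: ln_ge_expR.
set z := _ - 3 * kap; set m := 1 - u.
have m0 : 0 < m by rewrite /m; lra.
pose P := 1 - u / 2 - u ^+ 2 / 10.
have u24 : u ^+ 2 <= 1 / 4 by nra.
have u20 : 0 <= u ^+ 2 by exact: sqr_ge0.
have P0 : 7 / 10 <= P by rewrite /P; lra.
have PE : 1 - z / 2 = P + 3 / 2 * kap by rewrite /z /P; field.
have Pm : m <= P ^+ 2.
  rewrite (_ : P ^+ 2 = m + u ^+ 2 * (1 / 20 + u / 10 + u ^+ 2 / 100)).
    by rewrite lerDl mulr_ge0//; lra.
  by rewrite /P /m; field.
have km : kap * m <= 1 / 80.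
  by apply: (@le_trans _ _ (1 / 120 * (3 / 2))); [apply: ler_pM => //; rewrite /m; lra|lra].
have Pm2 : m ^+ 2 <= 3 * P * (1 - kap * m).
  apply: (@le_trans _ _ (3 * P * (79 / 80))); first by rewrite /m /P; nra.
  by rewrite ler_pM2l; lra.
have key : m <= (1 - kap * m) * (1 - z / 2) ^+ 2.
  rewrite PE; apply: (@le_trans _ _ ((1 - kap * m) * (m + 3 * kap * P))).
    rewrite (_ : _ * _ = m + kap * (3 * P * (1 - kap * m) - m ^+ 2)); last by ring.
    by rewrite lerDl mulr_ge0// subr_ge0.
  rewrite ler_pM2l; last by lra.
  rewrite (_ : (P + _) ^+ 2 = P ^+ 2 + 3 * kap * P + 9 / 4 * kap ^+ 2); last by field.
  by have := sqr_ge0 kap; lra.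
have z2 : 0 < 1 - z / 2 by rewrite PE; lra.
have ez : (1 - z / 2) ^+ 2 <= expR (- z).
  have -> : - z = 2%:R * (- (z / 2)) by field.
  rewrite expRM_natl lerXn2r ?nnegrE ?expR_ge0//; first exact: ltW.
  exact: expR_ge1Dx.
have : m * expR z <= 1 - kap * m.
  rewrite -[leRHS]mulr1 -[X in _ <= _ * X](expRxMexpNx_1 z) mulrCA [leLHS]mulrC.
  rewrite ler_pM2l ?expR_gt0//.
  by apply: (le_trans key); rewrite ler_wpM2l//; lra.
rewrite mulrC -ler_pdivlMr// => /le_trans; apply.
by rewrite mulrBl mul1r mulfK ?gt_eqF.
Qed.

Lemma ln_concave B w : 0 <= B <= 1 -> 0 < w -> B * ln w <= ln (1 + B * (w - 1)).
Proof.
move=> /andP[B0 B1] w0; set m := 1 + B * (w - 1).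
have mE : m = (1 - B) + B * w by rewrite /m; ring.
have m0 : 0 < m.
  rewrite mE; have [->|B00] := eqVneq B 0; first by rewrite subr0 mul0r addr0.
  by rewrite ltr_wpDl ?subr_ge0// mulr_gt0// lt0r B00.
have lnsub v : 0 < v -> ln v <= v - 1.
  move=> v0; have := @le_ln1Dx _ (v - 1); rewrite (addrC 1) subrK; apply.
  by rewrite ltrBDl addrN.
have h1 : ln w - ln m <= w / m - 1.
  by rewrite -ln_div ?posrE//; apply: lnsub; rewrite divr_gt0.
have h2 : - ln m <= m^-1 - 1.
  by rewrite -lnV ?posrE//; apply: lnsub; rewrite invr_gt0.
have E : B * (w / m - 1) + (1 - B) * (m^-1 - 1) = 0.
  by rewrite {1 2}mE; field; rewrite -mE gt_eqF.
have := ler_wpM2l B0 h1; have := @ler_wpM2l _ (1 - B) _ _ _ h2.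
rewrite subr_ge0 => /(_ B1); lra.
Qed.

Lemma powRE x p : 0 < x -> x `^ p = expR (p * ln x).
Proof. by move=> x0; rewrite /powR gt_eqF. Qed.

(** The double sum of the (a_j - a_k) (l_j - l_k) equals 2 n times the sum of the a_k l_k minus
    twice the product of the two sums. *)
Lemma chebyshev_sum_ge0 n (a l : nat -> R) :
  (forall j k, 0 <= (a j - a k) * (l j - l k)) ->
  0 <= \sum_(0 <= k < n) l k -> (forall k, 0 <= a k) ->
  0 <= \sum_(0 <= k < n) a k * l k.
Proof.
move=> mono l0 a0; have [->|n0] := posnP n; first by rewrite big_geq.
have n00 : 0 < n%:R :> R by rewrite ltr0n.
have : 0 <= \sum_(0 <= j < n) \sum_(0 <= k < n) (a j - a k) * (l j - l k).
  by apply: sumr_ge0 => j _; apply: sumr_ge0.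
have -> : \sum_(0 <= j < n) \sum_(0 <= k < n) (a j - a k) * (l j - l k) =
    2 * n%:R * (\sum_(0 <= k < n) a k * l k) -
    2 * (\sum_(0 <= k < n) a k) * (\sum_(0 <= k < n) l k).
  set A := \sum_(0 <= k < n) a k; set L := \sum_(0 <= k < n) l k.
  set AL := \sum_(0 <= k < n) a k * l k.
  have inner j : \sum_(0 <= k < n) (a j - a k) * (l j - l k) =
      n%:R * (a j * l j) - a j * L - l j * A + AL.
    rewrite (eq_bigr (fun k => a j * l j - a j * l k - l j * a k + a k * l k)).
      rewrite !big_split/= !sumrN sumr_const_nat subn0 -!mulr_sumr.
      by rewrite -[a j * l j *+ n]mulr_natl.
    by move=> k _; ring.
  rewrite (eq_bigr _ (fun j _ => inner j)) !big_split/= !sumrN -mulr_sumr.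
  rewrite -!mulr_suml sumr_const_nat subn0 -/A -/L -/AL -[AL *+ n]mulr_natl.
  by ring.
rewrite subr_ge0 => h; have h2 : 0 <= 2 * n%:R * \sum_(0 <= k < n) a k * l k.
  by apply: le_trans h; rewrite !mulr_ge0//; apply: sumr_ge0.
by move: h2; rewrite pmulr_rge0// mulr_gt0.
Qed.

(** By exp s >= 1 + s and concavity of ln, the k-th product of powers is at least G^q (1 + (p + q B)
    l_k), with B = 240 x / G in [0, 1] and l_k = ln (1 / m_k - 1/120). The l_k have nonnegative sum;
    they and the positive parts a_k both decrease with m_k, so Chebyshev makes the sum of the a_k
    l_k nonnegative as well. *)
Lemma kernel_sum n p q tau x G (g : nat -> R) : (3 <= n)%N ->
  0 <= p -> 0 < q -> 0 < tau -> 0 < x -> 240 * x <= G ->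
  (forall k, G + 240 * x * ((radius_factor n k)^-1 - 1 / 120 - 1) <= g k) ->
  n%:R * (Num.max 0 (x - tau) * G `^ q) <=
  \sum_(0 <= k < n) Num.max 0 (x - tau * radius_factor n k) *
     ((radius_factor n k)^-1 `^ p * g k `^ q).
Proof.
move=> n3 p0 q0 tau0 x0 xG Gg.
have n2 : (2 <= n)%N by exact: leq_trans n3.
have n00 : 0 < n%:R :> R by rewrite ltr0n (leq_trans _ n3).
pose u k := cos (root_angle n k) / 2; pose m k := radius_factor n k.
have mE k : m k = 1 - u k by [].
have ub k : - (1 / 2) <= u k <= 1 / 2.
  by have /andP[] := radius_factor_bound n k; rewrite -/(m k) mE => ? ?; apply/andP; split; lra.
have m0 k : 0 < m k by have /andP[] := ub k; rewrite mE; lra.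
have y1 k : 2 / 3 <= (m k)^-1.
  rewrite -[leRHS]mul1r ler_pdivlMr// mE.
  by have /andP[] := ub k; lra.
pose kap : R := 1 / 120.
have kapP : 0 <= kap <= 1 / 120 by rewrite /kap; apply/andP; split; lra.
pose l k := ln ((m k)^-1 - kap).
pose a k := Num.max 0 (x - tau * m k).
have G0 : 0 < G by apply: lt_le_trans xG; apply: mulr_gt0; first by rewrite ltr0n.
pose B := 240 * x / G.
have B01 : 0 <= B <= 1.
  apply/andP; split; last by rewrite /B ler_pdivrMr// mul1r.
  by apply: divr_ge0; [apply: mulr_ge0; [rewrite ler0n|exact: ltW]|exact: ltW].
have [B0 B1] := andP B01.
have w0 k : 0 < (m k)^-1 - kap by have := y1 k; rewrite /kap; lra.
have wm0 k : 0 < 1 + B * ((m k)^-1 - kap - 1).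
  rewrite (_ : _ + _ = (1 - B) + B * ((m k)^-1 - kap)); last by ring.
  have [->|B00] := eqVneq B 0; first by rewrite subr0 mul0r addr0.
  by rewrite ltr_wpDl ?subr_ge0// mulr_gt0// lt0r B00.
have a0 k : 0 <= a k by rewrite le_max lexx.
have step k : G `^ q * (1 + (p + q * B) * l k) <= (m k)^-1 `^ p * g k `^ q.
  have ge : G * (1 + B * ((m k)^-1 - kap - 1)) <= g k.
    apply: le_trans (Gg k); rewrite -/(m k) /kap mulrDr mulr1 lerD2l mulrA.
    by rewrite [G * B](_ : _ = 240 * x)// /B mulrC divfK ?gt_eqF.
  have gk0 : 0 < G * (1 + B * ((m k)^-1 - kap - 1)) by rewrite mulr_gt0.
  apply: (@le_trans _ _ ((m k)^-1 `^ p *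
      (G * (1 + B * ((m k)^-1 - kap - 1))) `^ q)); last first.
    rewrite ler_wpM2l ?powR_ge0//; apply: ge0_ler_powR => //; first exact: ltW.
      by rewrite nnegrE; exact: ltW.
    by rewrite nnegrE; exact: (ltW (lt_le_trans gk0 ge)).
  rewrite (powRM _ (ltW G0) (ltW (wm0 k))) [leRHS]mulrCA ler_wpM2l ?powR_ge0//.
  rewrite !powRE ?invr_gt0// -expRD; apply: le_trans (expR_ge1Dx _).
  rewrite lerD2l mulrDl; apply: lerD.
    rewrite ler_wpM2l// /l ler_ln ?posrE ?invr_gt0//.
    by rewrite lerBlDr lerDl; case/andP: kapP.
  rewrite -mulrA ler_pM2l//; exact: ln_concave.
(* Jensen for the positive part: the radius factors have mean 1. *)
have suma : n%:R * Num.max 0 (x - tau) <= \sum_(0 <= k < n) a k.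
  have : 0 <= \sum_(0 <= k < n) a k by apply: sumr_ge0.
  have : n%:R * (x - tau) <= \sum_(0 <= k < n) a k.
    apply: (@le_trans _ _ (\sum_(0 <= k < n) (x - tau + tau / 2 * cos (root_angle n k)))).
      by rewrite big_split/= sumr_const_nat subn0 -mulr_sumr sum_cos_root// mulr0 addr0 mulr_natl.
    apply: ler_sum => k _; rewrite /a le_max; apply/orP; right.
    by rewrite mE /u; lra.
  by case: (leP 0 (x - tau)) => // _; rewrite mulr0.
(* The mean of u is 0 and that of u^2 / 5 is 1/40, which is exactly 3 kap: this equality dictates
   1/120, and with it 240. *)
have suml : 0 <= \sum_(0 <= k < n) l k.
  apply: (@le_trans _ _ (\sum_(0 <= k < n)
     (1 / 2 * cos (root_angle n k) + 1 / 20 * cos (root_angle n k) ^+ 2 - 1 / 40))).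
    rewrite !big_split/= -!mulr_sumr sum_cos_root// sum_cos2_root//.
    rewrite sumr_const_nat subn0 -mulr_natl; lra.
  apply: ler_sum => k _; apply: le_trans (ln_sub_ge (ub k) kapP).
  by rewrite /kap /u; lra.
have cheb : 0 <= \sum_(0 <= k < n) a k * l k.
  apply: chebyshev_sum_ge0 => // j k.
  wlog jk : j k / m j <= m k.
    move=> hw; have [/hw//|/ltW/hw] := leP (m j) (m k).
    by rewrite -mulrNN !opprB.
  rewrite mulr_ge0// subr_ge0.
    rewrite /a ge_max le_max lexx/= le_max; apply/orP; right.
    by rewrite lerB// ler_pM2l.
  by rewrite /l ler_ln ?posrE// lerD2r lef_pV2 ?posrE.
apply: (@le_trans _ _ (\sum_(0 <= k < n) a k * (G `^ q * (1 + (p + q * B) * l k)))); last first.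
  by apply: ler_sum => k _; rewrite ler_wpM2l.
have -> : \sum_(0 <= k < n) a k * (G `^ q * (1 + (p + q * B) * l k)) =
    G `^ q * (\sum_(0 <= k < n) a k) +
    G `^ q * (p + q * B) * \sum_(0 <= k < n) a k * l k.
  rewrite !mulr_sumr -big_split/=; apply: eq_bigr => k _; ring.
rewrite mulrA mulrC; apply: (@le_trans _ _ (G `^ q * \sum_(0 <= k < n) a k)).
  by rewrite ler_wpM2l// powR_ge0.
by rewrite lerDl mulr_ge0// mulr_ge0 ?powR_ge0// addr_ge0// mulr_ge0// ltW.
Qed.

End Kernel_inequality.

(** * The weight, its dual and their pointwise bounds *)

Section Weights.
Variable R : realType.
Implicit Types (x y t a s M tau : R) (n k : nat).
Notation radius_factor := (@radius_factor R).
Notation root_angle := (@root_angle R).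

Lemma sum_le_muln n (F : nat -> R) a : (forall k, F k <= a) ->
  \sum_(0 <= k < n) F k <= a *+ n.
Proof.
move=> Fa; rewrite -[in leRHS](subn0 n) -sumr_const_nat.
by apply: ler_sum => k _; exact: Fa.
Qed.

Lemma powR_ub a M s : 1 <= M -> M^-1 <= s <= M -> s `^ a <= M `^ `|a|.
Proof.
move=> M1 /andP[s1 s2]; have M0 : 0 < M by exact: lt_le_trans M1.
have s0 : 0 < s by apply: lt_le_trans s1; rewrite invr_gt0.
rewrite !powRE// ler_expR (le_trans (ler_norm _))// normrM ler_wpM2l//.
rewrite ler_norml ler_ln ?posrE// s2 andbT -lnV ?posrE//.
by rewrite ler_ln ?posrE ?invr_gt0.
Qed.

Lemma powR_lb a M s : 1 <= M -> M^-1 <= s <= M -> (M `^ `|a|)^-1 <= s `^ a.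
Proof.
move=> M1 sM; have M0 : 0 < M by exact: lt_le_trans M1.
have s0 : 0 < s by case/andP: sM => + _; apply: lt_le_trans; rewrite invr_gt0.
have := powR_ub (- a) M1 sM; rewrite normrN powRN => h.
by rewrite -[leRHS]invrK lef_pV2 ?posrE ?invr_gt0 ?powR_gt0.
Qed.

Lemma powR_le_quot a M x y : 1 <= M -> 0 < y -> 0 < x -> x <= M * y -> y <= M * x ->
  x `^ a <= M `^ `|a| * y `^ a.
Proof.
move=> M1 y0 x0 xy yx; have M0 : 0 < M by exact: lt_le_trans M1.
rewrite -{1}(divfK (lt0r_neq0 y0) x) powRM; [|by apply: divr_ge0; exact: ltW|exact: ltW].
apply: ler_wpM2r; first exact: powR_ge0.
by apply: powR_ub => //; rewrite ler_pdivlMr// ler_pdivrMl// yx ler_pdivrMr.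
Qed.

Lemma ge0_powR_le a x y : 0 <= a -> 0 <= x -> x <= y -> x `^ a <= y `^ a.
Proof.
by move=> a0 x0 xy; apply: ge0_ler_powR => //; rewrite nnegrE// (le_trans x0).
Qed.

Lemma continuous_powR_pos a x : 0 < x -> {for x, continuous (fun s : R => s `^ a)}.
Proof.
move=> x0; apply/differentiable_continuous/derivable1_diffP.
exact: (@ex_derive _ _ _ _ _ _ _ (is_derive1_powR a x0)).
Qed.

Lemma continuous2_powR (h : R -> R -> R) a : (forall x t, 0 < h x t) ->
  continuous2 h -> continuous2 (fun x t => h x t `^ a).
Proof.
move=> h0 ch z.
have c1 : {for z, continuous (fun z : R * R => h z.1 z.2)} by exact: ch.
exact: (continuous_comp c1 (continuous_powR_pos (h0 z.1 z.2))).
Qed.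

Lemma continuous_minmax (f g : R -> R) : continuous f -> continuous g ->
  continuous (fun x => Num.min (f x) (g x)) /\
  continuous (fun x => Num.max (f x) (g x)).
Proof.
move=> cf cg; split=> x.
  by apply: continuous_min; [exact: cf|exact: cg].
by apply: continuous_max; [exact: cf|exact: cg].
Qed.

Lemma continuous_affine a b : continuous (fun x : R => a * x + b).
Proof.
move=> x; apply: cvgD; last exact: cvg_cst.
by apply: cvgM; [exact: cvg_cst|exact: cvg_id].
Qed.

(** [D] stands for the distance to E in the coordinates (x, t), and [tau] for the depth up to which
    the weight vanishes. *)
Variable D : R -> R -> R.
Hypothesis D_ge : forall x t, 0 <= x -> x <= 1 -> x / 2 <= D x t.
Hypothesis D_ge0 : forall x t, 0 <= D x t.
Hypothesis D_le : forall x t, D x t <= 2.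
Hypothesis D_lip : forall x t x' t', `|D x t - D x' t'| <= `|x - x'| + `|t - t'|.
Hypothesis D_per : forall x t, D x (t + 2 * pi) = D x t.
Variables p q tau : R.
Hypotheses (p0 : 0 <= p) (q0 : 0 < q) (tau0 : 0 < tau) (tau1 : tau <= 1 / 100).

Lemma continuous2_lip : continuous2 D.
Proof.
move=> z; apply/cvgrPdist_le => e e0.
have e20 : 0 < e / 2 by rewrite divr_gt0.
have c1 := @continuous2_fst R z; have c2 := @continuous2_snd R z.
near=> w; apply: (le_trans (D_lip _ _ _ _)).
rewrite [leRHS](_ : e = e / 2 + e / 2); last by field.
apply: lerD; near: w.
- by move/cvgrPdist_le : c1; exact.
- by move/cvgrPdist_le : c2; exact.
Unshelve. all: by end_near. Qed.

(* The factor 240 makes the gauge grow faster with x than it can decrease through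
   the shifts in t that occur in the dual weight. *)
Definition gauge x t : R := D x t + 240 * Num.max x (tau / 2).

Definition cutoff x : R := Num.max 0 (Num.min 1 (- 8 * x + 2)).

(** The positive part of x - tau switches the weight off near the circle and is convex in x, as the
    comparison with the dual requires. The maximum with tau / 2 merely avoids a singular power where
    the weight is 0 anyway. *)
Definition weight x t : R :=
  Num.max x (tau / 2) `^ (p - 2) * Num.max 0 (x - tau) * cutoff x *
  gauge x t `^ q.

(** The adjoint of the circle mean applied to the weight; the leading inverse factor is the Jacobian
    of the dilation in x. *)
Definition dual_weight n x t : R := n%:R^-1 * (\sum_(0 <= k < n)
  (radius_factor n k)^-1 *
  weight (x / radius_factor n k)
    (t - x / radius_factor n k / 2 * sin (root_angle n k))).

(* Supported on [1/32, 1/2] and equal to 1 on [1/16, 1/4], where the weight need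
   not be dominated by its dual. *)
Definition collar x : R :=
  Num.max 0 (Num.min 1 (Num.min (32 * x - 1) (- 4 * x + 2))).

Lemma gauge_gt0 x t : 0 < gauge x t.
Proof.
apply: ltr_wpDl; first exact: D_ge0.
apply: mulr_gt0; first by rewrite ltr0n.
by rewrite lt_max; apply/orP; right; rewrite divr_gt0 ?ltr0n.
Qed.

Lemma cutoff_ge0 x : 0 <= cutoff x.
Proof. by rewrite le_max lexx. Qed.

Lemma cutoff_le1 x : cutoff x <= 1.
Proof. by rewrite ge_max ler01 ge_min lexx. Qed.

Lemma cutoff1 x : x <= 1 / 8 -> cutoff x = 1.
Proof.
move=> x8; rewrite /cutoff min_l; last by lra.
by rewrite max_r.
Qed.

Lemma cutoff0 x : 1 / 4 <= x -> cutoff x = 0.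
Proof.
move=> x4; rewrite /cutoff max_l// ge_min; apply/orP; right; lra.
Qed.

Lemma cutoff_lip x y : cutoff x - cutoff y <= 8 * `|x - y|.
Proof.
rewrite /cutoff; have := ler_norm (x - y); have := ler_norm (y - x).
rewrite (distrC y) => h1 h2.
have [] := leP 1 (- 8 * x + 2); have [] := leP 1 (- 8 * y + 2).
- by rewrite !max_r//; lra.
- by have [] := leP 0 (- 8 * y + 2); rewrite max_r//; lra.
- by have [] := leP 0 (- 8 * x + 2); rewrite max_r//; lra.
- by have [] := leP 0 (- 8 * x + 2); have [] := leP 0 (- 8 * y + 2); lra.
Qed.

Lemma collar_ge0 x : 0 <= collar x.
Proof. by rewrite le_max lexx. Qed.

Lemma collar_le1 x : collar x <= 1.
Proof. by rewrite ge_max ler01 ge_min lexx. Qed.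

Lemma collar1 x : 1 / 16 <= x <= 1 / 4 -> collar x = 1.
Proof.
move=> /andP[x1 x2]; rewrite /collar min_l ?max_r// le_min.
by apply/andP; split; lra.
Qed.

Lemma collar0 x : x <= 1 / 32 \/ 1 / 2 <= x -> collar x = 0.
Proof.
move=> x1; rewrite /collar max_l// !ge_min; apply/orP; right; apply/orP.
by case: x1 => x1; [left|right]; lra.
Qed.

Lemma continuous_cutoff : continuous cutoff.
Proof.
apply: (continuous_minmax _ _).2; first by move=> x; exact: cvg_cst.
apply: (continuous_minmax _ _).1; first by move=> x; exact: cvg_cst.
exact: continuous_affine.
Qed.

Lemma continuous_collar : continuous collar.
Proof.
apply: (continuous_minmax _ _).2; first by move=> x; exact: cvg_cst.
apply: (continuous_minmax _ _).1; first by move=> x; exact: cvg_cst.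
apply: (continuous_minmax _ _).1; last exact: continuous_affine.
exact: continuous_affine.
Qed.

Lemma continuous2_maxr a : continuous2 (fun x _ => Num.max x a).
Proof.
by apply: continuous2_max; [exact: continuous2_fst|exact: continuous2_cst].
Qed.

Lemma continuous2_gauge : continuous2 gauge.
Proof.
apply: continuous2D; first exact: continuous2_lip.
by apply: continuous2M; [exact: continuous2_cst|exact: continuous2_maxr].
Qed.

Lemma continuous2_weight : continuous2 weight.
Proof.
apply: continuous2M; last first.
  by apply: continuous2_powR; [exact: gauge_gt0|exact: continuous2_gauge].
apply: continuous2M; last exact: continuous2_lift continuous_cutoff.
apply: continuous2M.
  apply: continuous2_powR; last exact: continuous2_maxr.
  by move=> x _; rewrite lt_max divr_gt0// orbT.
apply: continuous2_max; first exact: continuous2_cst.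
by apply: continuous2B; [exact: continuous2_fst|exact: continuous2_cst].
Qed.

Lemma continuous2_dual_weight n : continuous2 (dual_weight n).
Proof.
apply: continuous2M; first exact: continuous2_cst.
apply: continuous2_sum => k; apply: continuous2M; first exact: continuous2_cst.
apply: continuous2_comp2; first exact: continuous2_weight.
  by apply: continuous2M; [exact: continuous2_fst|exact: continuous2_cst].
apply: continuous2B; first exact: continuous2_snd.
apply: continuous2M; last exact: continuous2_cst.
apply: continuous2M; last exact: continuous2_cst.
by apply: continuous2M; [exact: continuous2_fst|exact: continuous2_cst].
Qed.

Lemma weight_ge0 x t : 0 <= weight x t.
Proof.
rewrite /weight mulr_ge0 ?powR_ge0// mulr_ge0 ?cutoff_ge0//.
by rewrite mulr_ge0 ?powR_ge0// le_max lexx.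
Qed.

Lemma weight_eq0 x t : x <= tau \/ 1 / 4 <= x -> weight x t = 0.
Proof.
case=> h; rewrite /weight; last by rewrite (cutoff0 h) mulr0 mul0r.
by rewrite [Num.max 0 _]max_l ?subr_le0// mulr0 !mul0r.
Qed.

Lemma weight_periodic x t : weight x (t + 2 * pi) = weight x t.
Proof. by rewrite /weight /gauge D_per. Qed.

Lemma radius_factor_gt0 n k : 0 < radius_factor n k :> R.
Proof. by have /andP[+ _] := radius_factor_bound R n k; lra. Qed.

Lemma div_radius_factor n k x : 0 <= x ->
  2 / 3 * x <= x / radius_factor n k <= 2 * x.
Proof.
move=> x0; have /andP[h1 h2] := radius_factor_bound R n k.
have m0 := radius_factor_gt0 n k.
rewrite ler_pdivlMr// ler_pdivrMr//; apply/andP; split; nra.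
Qed.

Lemma dual_weight_ge0 n x t : 0 <= dual_weight n x t.
Proof.
rewrite mulr_ge0 ?invr_ge0//; apply: sumr_ge0 => k _.
by rewrite mulr_ge0 ?weight_ge0// invr_ge0 ltW// radius_factor_gt0.
Qed.

Lemma dual_weight_eq0 n x t : 0 <= x -> x <= tau / 2 \/ 3 / 8 <= x ->
  dual_weight n x t = 0.
Proof.
move=> x0 h; rewrite /dual_weight big1 ?mulr0// => k _.
have /andP[h1 h2] := div_radius_factor n k x0.
by rewrite weight_eq0 ?mulr0//; case: h => h; [left|right]; lra.
Qed.

(** The radial term changes exactly by 240 (y - x), while the Lipschitz bound lets [D] change by |y
    - x| + |s| <= 2 x. *)
Lemma gauge_shift x t y s : tau / 2 <= x -> tau / 2 <= y -> `|y - x| <= x -> `|s| <= x ->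
  gauge x t + 240 * (y - x) - 2 * x <= gauge y (t - s) <= 
  gauge x t + 240 * (y - x) + 2 * x.
Proof.
move=> xt yt yx sx; rewrite /gauge !max_l//.
have := D_lip y (t - s) x t; rewrite (_ : t - s - t = - s); last by ring.
rewrite normrN => /ler_normlP[h1 h2].
by apply/andP; split; lra.
Qed.

Lemma shift_le n k x : 0 <= x -> `|x / radius_factor n k / 2 * sin (root_angle n k)| <= x.
Proof.
move=> x0; have /andP[h1 h2] := div_radius_factor n k x0.
rewrite normrM -[leRHS]mulr1; apply: ler_pM => //; last exact: sin_max.
by rewrite ger0_norm; lra.
Qed.

Lemma dist_div_radius_factor n k x : 0 <= x -> `|x / radius_factor n k - x| <= x.
Proof.
move=> x0; have /andP[h1 h2] := div_radius_factor n k x0.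
by rewrite ler_norml; apply/andP; split; lra.
Qed.

(** The Jacobian, the power of exponent p - 2 and the positive part contribute 1 / m, m^(2 - p) and
    1 / m; together they leave m^(- p), the form required by [kernel_sum]. *)
Lemma weight_div n k x t : tau / 2 <= x / radius_factor n k -> 0 < x ->
  (radius_factor n k)^-1 * weight (x / radius_factor n k) t =
  x `^ (p - 2) * (Num.max 0 (x - tau * radius_factor n k) *
  ((radius_factor n k)^-1 `^ p * (cutoff (x / radius_factor n k) *
    gauge (x / radius_factor n k) t `^ q))).
Proof.
move=> xt x0.
have m0 := radius_factor_gt0 n k; set m := radius_factor n k in m0 xt *.
rewrite /weight (max_l xt).
have -> : Num.max 0 (x / m - tau) = m^-1 * Num.max 0 (x - tau * m).
  rewrite maxr_pMr ?invr_ge0 ?ltW// mulr0; congr Num.max.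
  by field; rewrite gt_eqF.
have -> : (x / m) `^ (p - 2) = x `^ (p - 2) * (m^-1 `^ p * m ^+ 2).
  rewrite powRM ?invr_ge0 ?ltW//; congr (_ * _).
  rewrite powRB; last by apply/implyP => _; rewrite invr_eq0 gt_eqF.
  by rewrite (powR_mulrn 2) ?invr_ge0 ?ltW// exprVn invrK.
by field; rewrite gt_eqF.
Qed.

(** For x <= 1/16 all depths x / m_k are at most 1/8, where the cutoff is 1, so [kernel_sum]
    applies. *)
Lemma weight_le_dual n x t : (3 <= n)%N -> x <= 1 / 16 ->
  weight x t <= dual_weight n x t.
Proof.
move=> n3 x16; have [xt|xt] := leP x tau.
  by rewrite weight_eq0 ?dual_weight_ge0//; left.
have x0 : 0 < x by exact: lt_trans xt.
have n00 : 0 < n%:R :> R by rewrite ltr0n (leq_trans _ n3).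
rewrite /dual_weight mulrC ler_pdivlMr//.
rewrite (eq_bigr (fun k => x `^ (p - 2) * (Num.max 0 (x - tau * radius_factor n k) *
  ((radius_factor n k)^-1 `^ p * gauge (x / radius_factor n k)
    (t - x / radius_factor n k / 2 * sin (root_angle n k)) `^ q)))); last first.
  move=> k _; have /andP[h1 h2] := div_radius_factor n k (ltW x0).
  rewrite weight_div//; last by lra.
  by rewrite cutoff1 ?mul1r//; lra.
rewrite -mulr_sumr /weight cutoff1; last by lra.
rewrite (max_l (_ : tau / 2 <= x)); last by lra.
rewrite mulr1 -!mulrA ler_wpM2l ?powR_ge0//.
rewrite mulrA mulrC; apply: kernel_sum => //.
  by rewrite /gauge max_l ?lerDr//; lra.
move=> k.
have /andP[h1 h2] := div_radius_factor n k (ltW x0).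
have /andP[+ _] := @gauge_shift x t (x / radius_factor n k) _ ltac:(lra) ltac:(lra)
  (dist_div_radius_factor n k (ltW x0)) (shift_le n k (ltW x0)).
(* The loss 2 x of [gauge_shift] is 240 x times 1/120. *)
apply: le_trans; rewrite le_eqVlt; apply/orP; left; apply/eqP; field.
by rewrite gt_eqF// radius_factor_gt0.
Qed.

Definition weight_max : R := 16 `^ `|p - 2| * 242 `^ q.

Lemma weight_max_ge0 : 0 <= weight_max.
Proof. by rewrite mulr_ge0 ?powR_ge0. Qed.

Lemma weight_le_max x t : 1 / 16 <= x -> weight x t <= weight_max.
Proof.
have t0 := tau0; have t1 := tau1.
move=> x16; have [x4|x4] := leP (1 / 4) x.
  by rewrite weight_eq0 ?weight_max_ge0//; right.
rewrite /weight (max_l (_ : tau / 2 <= x)); last by lra.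
apply: ler_pM; rewrite ?powR_ge0//.
- by rewrite mulr_ge0 ?cutoff_ge0// mulr_ge0 ?powR_ge0// le_max lexx.
- rewrite -[leRHS]mulr1; apply: ler_pM; rewrite ?cutoff_ge0 ?cutoff_le1//.
    by rewrite mulr_ge0 ?powR_ge0// le_max lexx.
  rewrite -[leRHS]mulr1; apply: ler_pM; rewrite ?powR_ge0 ?le_max ?lexx//.
    by apply: powR_ub; [lra|apply/andP; split; lra].
  by rewrite ge_max ler01/=; lra.
- apply: ge0_powR_le; [exact: ltW|exact: ltW (gauge_gt0 _ _)|].
  by rewrite /gauge max_l; have := D_le x t; lra.
Qed.

Definition total_weight n x t : R :=
  dual_weight n x t - weight x t + weight_max * collar x.

Lemma continuous2_total_weight n : continuous2 (total_weight n).
Proof.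
apply: continuous2D.
  apply: continuous2B; [exact: continuous2_dual_weight|exact: continuous2_weight].
apply: continuous2M; first exact: continuous2_cst.
exact: continuous2_lift continuous_collar.
Qed.

Lemma total_weight_ge0 n x t : (3 <= n)%N -> 0 <= total_weight n x t.
Proof.
move=> n3; rewrite /total_weight.
have [x16|x16] := leP x (1 / 16).
  apply: addr_ge0; first by rewrite subr_ge0 weight_le_dual.
  by apply: mulr_ge0; [exact: weight_max_ge0|exact: collar_ge0].
have [x4|x4] := leP (1 / 4) x.
  rewrite (weight_eq0 _ (or_intror x4)) subr0.
  apply: addr_ge0; first exact: dual_weight_ge0.
  by apply: mulr_ge0; [exact: weight_max_ge0|exact: collar_ge0].
rewrite collar1; last by apply/andP; split; exact: ltW.
rewrite mulr1 -addrA addr_ge0 ?dual_weight_ge0// addrC subr_ge0.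
by rewrite weight_le_max// ltW.
Qed.

Lemma total_weight_eq0 n x t : 0 <= x -> x <= tau / 2 \/ 1 / 2 <= x ->
  total_weight n x t = 0.
Proof.
have t0 := tau0; have t1 := tau1.
move=> x0 h; rewrite /total_weight dual_weight_eq0//; last first.
  by case: h => h; [left|right; lra].
rewrite weight_eq0; last by case: h => h; [left|right]; lra.
by rewrite collar0 ?mulr0 ?subrr ?addr0//; case: h => h; [left|right]; lra.
Qed.

(** The depth grows by at most x, hence the gauge by at most 240 x + 2 x; as x <= 2 D, D + 482 x is
    at most 965 D. *)
Lemma gauge_div_le n k x t : tau / 2 <= x -> x <= 1 / 2 ->
  tau / 2 <= x / radius_factor n k ->
  gauge (x / radius_factor n k)
    (t - x / radius_factor n k / 2 * sin (root_angle n k)) <= 965 * D x t /\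
  gauge (x / radius_factor n k)
    (t - x / radius_factor n k / 2 * sin (root_angle n k)) <= gauge x t + 242 * x.
Proof.
have t0 := tau0; have t1 := tau1.
move=> xt x2 xmt; have x0 : 0 <= x by lra.
have /andP[h1 h2] := div_radius_factor n k x0.
have /andP[_ h] := @gauge_shift x t (x / radius_factor n k) _ xt xmt
  (dist_div_radius_factor n k x0) (shift_le n k x0).
have GE : gauge x t = D x t + 240 * x by rewrite /gauge max_l.
by have := D_ge t x0 ltac:(lra); rewrite GE in h * => h3; split; lra.
Qed.

Definition weight_bound : R :=
  2 `^ p * 965 `^ q + weight_max * (32 `^ `|p - 1| * 64 `^ q).

Lemma weight_bound_ge0 : 0 <= weight_bound.
Proof. by rewrite addr_ge0 ?mulr_ge0 ?powR_ge0 ?weight_max_ge0. Qed.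

Lemma collar_bound x t : 0 <= x ->
  collar x = 0 \/ [/\ 1 / 32 <= x <= 1 / 2, 1 / 64 <= D x t & 0 < D x t].
Proof.
move=> x0; have [x1|x1] := leP x (1 / 32).
  by left; rewrite collar0//; left.
have [x2|x2] := leP (1 / 2) x.
  by left; rewrite collar0//; right.
right; have := D_ge t x0 ltac:(lra) => h.
by split; [apply/andP; split| |]; lra.
Qed.

Lemma total_weight_le n x t : (3 <= n)%N -> tau / 2 <= x -> x <= 1 / 2 ->
  total_weight n x t <= weight_bound * (x `^ (p - 1) * D x t `^ q).
Proof.
have t0 := tau0; have t1 := tau1.
move=> n3 xt x2; have x0 : 0 < x by lra.
have n00 : 0 < n%:R :> R by rewrite ltr0n (leq_trans _ n3).
have dual : dual_weight n x t <= 2 `^ p * 965 `^ q * (x `^ (p - 1) * D x t `^ q).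
  rewrite /dual_weight mulrC ler_pdivrMr// mulr_natr.
  apply: sum_le_muln => k.
  have m0 := radius_factor_gt0 n k; have /andP[h1 h2] := div_radius_factor n k (ltW x0).
  have [xm|xm] := leP (x / radius_factor n k) tau.
    by rewrite weight_eq0 ?mulr0 ?mulr_ge0 ?powR_ge0//; left.
  have xm2 : tau / 2 <= x / radius_factor n k by lra.
  rewrite weight_div//.
  have [g1 _] := gauge_div_le t xt x2 xm2.
  have gq : gauge (x / radius_factor n k)
      (t - x / radius_factor n k / 2 * sin (root_angle n k)) `^ q <= 965 `^ q * D x t `^ q.
    rewrite -(powRM q (ler0n R 965) (D_ge0 x t)).
    by apply: ge0_powR_le; [exact: ltW|exact: ltW (gauge_gt0 _ _)|exact: g1].
  have mp : (radius_factor n k)^-1 `^ p <= 2 `^ p.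
    apply: ge0_powR_le => //; first by rewrite invr_ge0 ltW.
    by move: h2; rewrite mulrC ler_pM2r.
  have mx : x `^ (p - 2) * Num.max 0 (x - tau * radius_factor n k) <= x `^ (p - 1).
    have -> : x `^ (p - 1) = x `^ (p - 2) * x.
      rewrite -{3}(powRr1 (ltW x0)) -powRD; first by congr (_ `^ _); ring.
      by apply/implyP => _; rewrite gt_eqF.
    rewrite ler_wpM2l ?powR_ge0// ge_max ltW//= lerBlDr lerDl.
    by rewrite mulr_ge0 ?ltW.
  have -> : 2 `^ p * 965 `^ q * (x `^ (p - 1) * D x t `^ q) =
      x `^ (p - 1) * (2 `^ p * (1 * (965 `^ q * D x t `^ q))) by ring.
  rewrite [leLHS]mulrA; apply: ler_pM => //.
  - by rewrite mulr_ge0 ?powR_ge0// le_max lexx.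
  - by rewrite !mulr_ge0 ?powR_ge0 ?cutoff_ge0.
  apply: ler_pM => //; rewrite ?powR_ge0 ?mulr_ge0 ?powR_ge0 ?cutoff_ge0//.
  by apply: ler_pM; rewrite ?powR_ge0 ?cutoff_ge0 ?cutoff_le1.
have bmp : weight_max * collar x <=
    weight_max * (32 `^ `|p - 1| * 64 `^ q) * (x `^ (p - 1) * D x t `^ q).
  rewrite -mulrA ler_wpM2l ?weight_max_ge0//.
  have [->|[/andP[x3 x4] D1 D0]] := collar_bound t (ltW x0).
    by rewrite !mulr_ge0 ?powR_ge0.
  apply: (le_trans (collar_le1 x)).
  rewrite mulrACA -[leLHS]mulr1; apply: ler_pM => //.
    rewrite -ler_pdivrMl ?powR_gt0// mulr1; apply: powR_lb; first by lra.
    by apply/andP; split; lra.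
  rewrite -powRM//; apply: le_trans (_ : 1 `^ q <= _); first by rewrite powR1.
  by apply: ge0_powR_le; [exact: ltW|exact: ler01|lra].
rewrite /total_weight /weight_bound mulrDl; apply: lerD => //.
by rewrite (le_trans _ dual)// lerBlDr lerDl weight_ge0.
Qed.

Definition weight_bound0 : R :=
  16 * 965 `^ q + 242 * q * 965 `^ q + weight_max * 64 `^ `|q - 1|.

Lemma weight_bound0_ge0 : 0 <= weight_bound0.
Proof.
by rewrite !addr_ge0 ?mulr_ge0 ?powR_ge0 ?weight_max_ge0 ?ler0n ?(ltW q0).
Qed.

(** From exp s >= 1 + s at s = - q ln (y / x) and ln (y / x) <= (y - x) / x; this covers q < 1 and q
    >= 1 alike. *)
Lemma powR_sub_le x y : 0 < x -> x <= y -> y `^ q - x `^ q <= q * ((y - x) / x) * y `^ q.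
Proof.
move=> x0 xy; have y0 : 0 < y by exact: lt_le_trans xy.
have h1 : ln y - ln x <= (y - x) / x.
  rewrite -ln_div ?posrE//.
  have -> : y / x = 1 + (y - x) / x by field; rewrite gt_eqF.
  apply: le_ln1Dx; apply: lt_le_trans (_ : 0 <= _); first by lra.
  by rewrite divr_ge0 ?subr_ge0// ltW.
have h2 : 1 - q * (ln y - ln x) <= x `^ q / y `^ q.
  rewrite !powRE// -expRN -expRD; apply: le_trans (expR_ge1Dx _).
  by rewrite lerD2l; lra.
have yq : 0 < y `^ q by exact: powR_gt0.
move: h2; rewrite ler_pdivlMr// => h2.
have : (1 - q * ((y - x) / x)) * y `^ q <= x `^ q.
  apply: le_trans h2; rewrite ler_pM2r// lerB// ler_pM2l//.
by rewrite mulrBl mul1r; lra.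
Qed.

(** The radius factors have mean 1 and x >= 2 tau keeps every x - tau m_k positive, so the weight is
    itself the mean of terms with x - tau m_k in place of x - tau. Compared termwise with the dual,
    only the cutoff and the power of the gauge differ, each by a constant times x D^(q - 1); the
    remaining x^(-2) (x - tau m_k) x is at most 1. *)
Lemma total_weight_le0 n x t : p = 0 -> (3 <= n)%N -> 2 * tau <= x -> x <= 1 / 2 ->
  total_weight n x t <= weight_bound0 * D x t `^ (q - 1).
Proof.
have t0 := tau0; have t1 := tau1.
move=> pE n3 xt x2; have x0 : 0 < x by lra.
have n00 : 0 < n%:R :> R by rewrite ltr0n (leq_trans _ n3).
have Dx : x / 2 <= D x t by apply: D_ge; lra.
have D0 : 0 < D x t by apply: lt_le_trans Dx; rewrite divr_gt0.
have DD : D x t `^ q = D x t * D x t `^ (q - 1) by rewrite mulr_powRB1.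
have wE : weight x t = n%:R^-1 * \sum_(0 <= k < n)
    x `^ (p - 2) * ((x - tau * radius_factor n k) * (cutoff x * gauge x t `^ q)).
  rewrite -mulr_sumr -mulr_suml sumrB sumr_const_nat subn0 -mulr_sumr sumrB.
  rewrite sumr_const_nat subn0 -mulr_suml sum_cos_root ?mul0r ?subr0; last exact: leq_trans n3.
  rewrite /weight max_l; last by lra.
  rewrite max_r ?subr_ge0; last by lra.
  by rewrite -mulr_natr; field; rewrite gt_eqF.
have main : dual_weight n x t - weight x t <=
    (16 * 965 `^ q + 242 * q * 965 `^ q) * D x t `^ (q - 1).
  rewrite wE /dual_weight -mulrBr -sumrB mulrC ler_pdivrMr// mulr_natr.
  apply: sum_le_muln => k.
  have m0 := radius_factor_gt0 n k; have /andP[h1 h2] := div_radius_factor n k (ltW x0).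
  have /andP[m1 m2] := radius_factor_bound R n k.
  have xt2 : tau / 2 <= x by lra.
  have xm2 : tau / 2 <= x / radius_factor n k by lra.
  rewrite weight_div// -mulrBr.
  have [g1 g2] := gauge_div_le t xt2 x2 xm2.
  set g := gauge _ (t - _) in g1 g2 *; set m := radius_factor n k in m0 m1 m2 h1 h2 xm2 g1 g2 *.
  have g0 : 0 < g by exact: gauge_gt0.
  have tm : tau * m <= x by nra.
  rewrite max_r ?subr_ge0//.
  have -> : m^-1 `^ p = 1 by rewrite pE powRr0.
  rewrite mul1r -mulrBr.
  have gq : g `^ q <= 965 `^ q * (D x t * D x t `^ (q - 1)).
    rewrite -DD -(powRM q (ler0n R 965) (D_ge0 x t)).
    by apply: ge0_powR_le; [exact: ltW|exact: ltW|exact: g1].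
  (* The cutoff is 8-Lipschitz and moves by a distance at most x; one factor [D] is spent on D <=
     2. *)
  have T1 : (cutoff (x / m) - cutoff x) * g `^ q <= x * (16 * 965 `^ q * D x t `^ (q - 1)).
    apply: (@le_trans _ _ (8 * x * (965 `^ q * (D x t * D x t `^ (q - 1))))).
      apply: (@le_trans _ _ (8 * x * g `^ q)).
        rewrite ler_wpM2r ?powR_ge0//; apply: (le_trans (cutoff_lip _ _)).
        by rewrite ler_pM2l// /m dist_div_radius_factor// ltW.
      by rewrite ler_wpM2l// mulr_ge0// ltW.
    have -> : 8 * x * (965 `^ q * (D x t * D x t `^ (q - 1))) =
      D x t * (8 * (x * (965 `^ q * D x t `^ (q - 1)))) by ring.
    have -> : x * (16 * 965 `^ q * D x t `^ (q - 1)) =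
      2 * (8 * (x * (965 `^ q * D x t `^ (q - 1)))) by ring.
    by rewrite ler_wpM2r ?mulr_ge0 ?powR_ge0// ltW.
  have T2 : cutoff x * (g `^ q - gauge x t `^ q) <=
      x * (242 * q * 965 `^ q * D x t `^ (q - 1)).
    have [gg|gg] := leP g (gauge x t).
      apply: (@le_trans _ _ 0); last first.
        by rewrite !mulr_ge0 ?powR_ge0 ?ler0n ?(ltW q0) ?(ltW x0).
      rewrite mulr_ge0_le0 ?cutoff_ge0// subr_le0; apply: ge0_powR_le => //; exact: ltW.
    have G0 := gauge_gt0 x t.
    have P := powR_sub_le G0 (ltW gg).
    apply: (@le_trans _ _ (g `^ q - gauge x t `^ q)).
      rewrite ler_piMl ?cutoff_le1// subr_ge0; apply: ge0_powR_le; exact: ltW.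
    apply: (le_trans P).
    have -> : x * (242 * q * 965 `^ q * D x t `^ (q - 1)) =
      q * (242 * x / D x t) * (965 `^ q * (D x t * D x t `^ (q - 1))).
      by field; rewrite gt_eqF.
    apply: ler_pM => //; rewrite ?powR_ge0//.
      by rewrite mulr_ge0 ?divr_ge0 ?subr_ge0 ?ltW.
    rewrite ler_pM2l//; apply: ler_pM.
    - by rewrite subr_ge0 ltW.
    - by rewrite invr_ge0 ltW.
    - by rewrite lerBlDl.
    - rewrite lef_pV2 ?posrE// /gauge lerDl; apply: mulr_ge0; first by rewrite ler0n.
      by rewrite le_max ltW.
  have -> : cutoff (x / m) * g `^ q - cutoff x * gauge x t `^ q =
    (cutoff (x / m) - cutoff x) * g `^ q + cutoff x * (g `^ q - gauge x t `^ q) by ring.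
  set A := _ + _ * (g `^ q - _).
  have AB : A <= x * ((16 * 965 `^ q + 242 * q * 965 `^ q) * D x t `^ (q - 1)).
    by rewrite /A (mulrDl _ _ (D x t `^ (q - 1))) mulrDr lerD.
  set B := (_ + _) * _ in AB *.
  have B0 : 0 <= B.
    by rewrite mulr_ge0 ?powR_ge0 ?addr_ge0 ?mulr_ge0 ?powR_ge0 ?ler0n ?(ltW q0).
  have x2E : x `^ (p - 2) = x ^- 2.
    by rewrite pE sub0r powRN powR_mulrn// ltW.
  apply: (@le_trans _ _ (x `^ (p - 2) * ((x - tau * m) * (x * B)))).
    by rewrite !ler_wpM2l ?powR_ge0// subr_ge0.
  rewrite x2E.
  have -> : x ^- 2 * ((x - tau * m) * (x * B)) = (x - tau * m) / x * B.
    by field; rewrite gt_eqF.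
  by rewrite ler_piMl// ler_pdivrMr// mul1r lerBlDr lerDl mulr_ge0// ltW.
have bmp : weight_max * collar x <= weight_max * 64 `^ `|q - 1| * D x t `^ (q - 1).
  rewrite -mulrA ler_wpM2l ?weight_max_ge0//.
  have [->|[/andP[x3 x4] D1 _]] := collar_bound t (ltW x0).
    by rewrite !mulr_ge0 ?powR_ge0.
  apply: (le_trans (collar_le1 x)).
  rewrite -ler_pdivrMl ?powR_gt0// mulr1; apply: powR_lb; first by lra.
  by apply/andP; split; [lra|have := D_le x t; lra].
by rewrite /total_weight /weight_bound0 mulrDl lerD.
Qed.

End Weights.

(** * Duality and the gain at the zeros *)

Section Circle_mean.
Variable R : realType.
Implicit Types (x y t a s e eta tau r : R) (n k : nat) (U : R -> R -> R)
  (f g : R[i] -> R[i]).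
Notation radius_factor := (@radius_factor R).
Notation root_angle := (@root_angle R).

(** The shift in t is absorbed by periodicity for each fixed x; the dilation in x is then an affine
    substitution. *)
Lemma rectint_scale (w U : R -> R -> R) m s : 1 / 2 <= m -> m <= 3 / 2 ->
  continuous2 w -> continuous2 U ->
  (forall x t, w x (t + 2 * pi) = w x t) ->
  (forall x t, U x (t + 2 * pi) = U x t) ->
  (forall x t, 1 / 4 <= x -> w x t = 0) ->
  rectint 0 1 0 (2 * pi) (fun x t => w x t * U (x * m) (t + x / 2 * s)) =
  rectint 0 1 0 (2 * pi)
    (fun x t => m^-1 * w (x / m) (t - x / m / 2 * s) * U x t).
Proof.
move=> m1 m2 cw cU wp Up w0.
have m0 : 0 < m by lra.
have m38 : 3 / 8 <= m by lra.
have l38 : 3 / 8 <= 1 :> R by lra.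
have p0 : 0 <= 2 * pi :> R by rewrite mulr_ge0 ?pi_ge0.
have p00 : 0 < 2 * pi :> R by rewrite mulr_gt0 ?pi_gt0.
pose h x t := w (x / m) (t - x / m / 2 * s) * U x t.
have ch : continuous2 h.
  apply: continuous2M => //; apply: continuous2_comp2 => //.
    by apply: continuous2M; [exact: continuous2_fst|exact: continuous2_cst].
  apply: continuous2B; first exact: continuous2_snd.
  apply: continuous2M; last exact: continuous2_cst.
  apply: continuous2M; last exact: continuous2_cst.
  by apply: continuous2M; [exact: continuous2_fst|exact: continuous2_cst].
pose H x := segint 0 (2 * pi) (h x).
have cH : continuous H by exact: continuous_segint.
have H0 x : 3 / 8 <= x -> H x = 0.
  move=> x38; rewrite /H -[RHS](mul0r (2 * pi - 0)) -segint_cst//.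
  apply: eq_segint => t _; rewrite /h w0 ?mul0r//.
  by rewrite ler_pdivlMr//; lra.
(* The dilation turns [0, 1] into [0, m]; both contain [0, 3/8], beyond which the integrand vanishes
   because m <= 3/2. *)
have Hcut b : 3 / 8 <= b -> segint 0 b H = segint 0 (3 / 8) H.
  move=> b38.
  have -> := @segint_cat R 0 b (3 / 8) H ltac:(lra) b38 cH.
  rewrite (@eq_segint _ (3 / 8) b H (fun=> 0)); last by move=> x /andP[+ _]; exact: H0.
  by rewrite segint_cst// mul0r addr0.
have -> : rectint 0 1 0 (2 * pi) (fun x t => w x t * U (x * m) (t + x / 2 * s)) =
    segint 0 1 (fun x => H (x * m + 0)).
  apply: eq_segint => x _; rewrite addr0 /H.
  have E := @segint_periodic R (2 * pi) (h (x * m)) (x / 2 * s) p00 _ _.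
  rewrite -E; last 2 first.
  - exact: continuous2_row.
  - by move=> t; rewrite /h addrAC wp Up.
  by apply: eq_segint => t _; rewrite /h mulfK ?gt_eqF// addrK.
have E := segint_affine 0 (@ler01 R) m0 cH.
rewrite mul0r mul1r !addr0 in E.
transitivity (m^-1 * segint 0 m H); first by rewrite E mulKf ?gt_eqF.
rewrite (Hcut m m38) -(Hcut 1 l38).
rewrite -[LHS](rectintZ 0 1 p0 _ ch); apply: eq_rectint => x t _ _.
by rewrite /h mulrA.
Qed.

(** The radius x / 2 is proportional to the depth, so each term of the adjoint multiplies a power of
    x by a constant. *)
Definition circle_mean n U x t : R := n%:R^-1 * (\sum_(0 <= k < n)
  U (x * radius_factor n k) (t + x / 2 * sin (root_angle n k))).

Lemma continuous2_circle_mean n U : continuous2 U -> continuous2 (circle_mean n U).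
Proof.
move=> cU; apply: continuous2M; first exact: continuous2_cst.
apply: continuous2_sum => k; apply: continuous2_comp2 => //.
  by apply: continuous2M; [exact: continuous2_fst|exact: continuous2_cst].
apply: continuous2D; first exact: continuous2_snd.
apply: continuous2M; last exact: continuous2_cst.
by apply: continuous2M; [exact: continuous2_fst|exact: continuous2_cst].
Qed.

Lemma rectint_dual (D : R -> R -> R) (p q tau : R) n U :
  (forall x t, 0 <= D x t) ->
  (forall x t x' t', `|D x t - D x' t'| <= `|x - x'| + `|t - t'|) ->
  (forall x t, D x (t + 2 * pi) = D x t) -> 0 < tau ->
  continuous2 U -> (forall x t, U x (t + 2 * pi) = U x t) ->
  rectint 0 1 0 (2 * pi)
    (fun x t => weight D p q tau x t * circle_mean n U x t) =
  rectint 0 1 0 (2 * pi) (fun x t => dual_weight D p q tau n x t * U x t).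
Proof.
move=> D0 Dl Dp tau0 cU Up.
have p0 : 0 <= 2 * pi :> R by rewrite mulr_ge0 ?pi_ge0.
have cw : continuous2 (weight D p q tau) by exact: continuous2_weight.
pose T1 k x t := weight D p q tau x t *
  U (x * radius_factor n k) (t + x / 2 * sin (root_angle n k)).
pose T2 k x t := (radius_factor n k)^-1 * weight D p q tau (x / radius_factor n k)
  (t - x / radius_factor n k / 2 * sin (root_angle n k)) * U x t.
have cT1 k : continuous2 (T1 k).
  apply: continuous2M => //; apply: continuous2_comp2 => //.
    by apply: continuous2M; [exact: continuous2_fst|exact: continuous2_cst].
  apply: continuous2D; first exact: continuous2_snd.
  apply: continuous2M; last exact: continuous2_cst.
  by apply: continuous2M; [exact: continuous2_fst|exact: continuous2_cst].
have cT2 k : continuous2 (T2 k).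
  apply: continuous2M => //; apply: continuous2M; first exact: continuous2_cst.
  apply: continuous2_comp2 => //.
    by apply: continuous2M; [exact: continuous2_fst|exact: continuous2_cst].
  apply: continuous2B; first exact: continuous2_snd.
  apply: continuous2M; last exact: continuous2_cst.
  apply: continuous2M; last exact: continuous2_cst.
  by apply: continuous2M; [exact: continuous2_fst|exact: continuous2_cst].
have cS1 : continuous2 (fun x t => \sum_(0 <= k < n) T1 k x t) by exact: continuous2_sum.
have cS2 : continuous2 (fun x t => \sum_(0 <= k < n) T2 k x t) by exact: continuous2_sum.
transitivity (n%:R^-1 * \sum_(0 <= k < n) rectint 0 1 0 (2 * pi) (T1 k)).
  rewrite -(rectint_sum 0 1 p0 _ cT1) -(rectintZ 0 1 p0 _ cS1).
  by apply: eq_rectint => x t _ _; rewrite /circle_mean mulrCA; congr (_ * _); rewrite mulr_sumr.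
rewrite (eq_bigr (fun k => rectint 0 1 0 (2 * pi) (T2 k))); last first.
  move=> k _; have /andP[m1 m2] := radius_factor_bound R n k.
  apply: rectint_scale => //.
  - by move=> x t; exact: weight_periodic.
  - by move=> x t x4; apply: weight_eq0; right.
rewrite -(rectint_sum 0 1 p0 _ cT2) -(rectintZ 0 1 p0 _ cS2).
apply: eq_rectint => x t _ _; rewrite /dual_weight -mulrA mulr_suml.
by congr (_ * _).
Qed.

(* The clamp makes the field globally continuous; the weights vanish for
   x <= tau / 2. *)
Definition log_field tau eta f x t : R :=
  ltrunc eta (f (log_polar (Num.max x (tau / 2)) t)).

Lemma log_field_periodic tau eta f x t :
  log_field tau eta f x (t + 2 * pi) = log_field tau eta f x t.
Proof. by rewrite /log_field log_polar_periodic. Qed.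

Lemma log_polar_clamp_lt1 tau x t : 0 < tau ->
  cabs (log_polar (Num.max x (tau / 2)) t) < 1.
Proof.
move=> tau0; rewrite cabs_log_polar -expR0 ltr_expR oppr_lt0 lt_max.
by apply/orP; right; rewrite divr_gt0.
Qed.

Lemma continuous2_clamp_comp tau f : 0 < tau ->
  (forall z, cabs z < 1 -> cderivable f z) ->
  continuous2 (fun x t => cabs (f (log_polar (Num.max x (tau / 2)) t))).
Proof.
move=> tau0 df.
have [//|||_ _ //] := @continuous2_cabs_comp R f
  (fun x t => log_polar (Num.max x (tau / 2)) t).
- by move=> x t; apply: df; exact: log_polar_clamp_lt1.
- apply: (@continuous2_comp2 _ (fun x t => complex.Re (log_polar x t))).
  + exact: continuous2_log_polar_Re.
  + by apply: continuous2_max; [exact: continuous2_fst|exact: continuous2_cst].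
  + exact: continuous2_snd.
- apply: (@continuous2_comp2 _ (fun x t => complex.Im (log_polar x t))).
  + exact: continuous2_log_polar_Im.
  + by apply: continuous2_max; [exact: continuous2_fst|exact: continuous2_cst].
  + exact: continuous2_snd.
Qed.

Lemma continuous2_log_field tau eta f : 0 < tau -> 0 < eta ->
  (forall z, cabs z < 1 -> cderivable f z) -> continuous2 (log_field tau eta f).
Proof.
by move=> tau0 eta0 df; apply: continuous2_ltrunc => //; exact: continuous2_clamp_comp.
Qed.

(** The field is uniformly continuous on a bounded region, so its oscillation between neighbouring
    points is at most e once 2 pi / n <= d, for all (x, t) at once. *)
Lemma log_field_submean tau eta f e : 0 < tau -> 0 < eta -> 0 < e ->
  (forall z, cabs z < 1 -> cderivable f z) ->
  exists N, forall n, (N <= n)%N -> forall x t, tau <= x -> x <= 1 / 4 ->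
    0 <= t <= 2 * pi ->
    log_field tau eta f x t <= circle_mean n (log_field tau eta f) x t + e.
Proof.
move=> tau0 eta0 e0 df.
(* 20 exceeds every coordinate that occurs, because 2 pi <= 8. *)
have [d d0 dP] := continuous2_unif 20 (continuous2_log_field tau0 eta0 df) e0.
have pi4 : pi <= 4 :> R by have := @pihalf_lt2 R; lra.
have pi0 := @pi_ge0 R.
exists (Num.bound (2 * pi / d)).+1 => n Nn x t tx x4 /andP[t0 t2].
have n0 : (0 < n)%N by exact: leq_trans Nn.
have n00 : 0 < n%:R :> R by rewrite ltr0n.
have nd : 2 * pi / n%:R <= d.
  rewrite ler_pdivrMr// [d * _]mulrC -ler_pdivrMr//.
  have b0 : 0 <= 2 * pi / d by apply: divr_ge0; [exact: mulr_ge0|exact: ltW].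
  by apply: (le_trans (ltW (archi_boundP b0))); rewrite ler_nat ltnW.
have x0 : 0 < x by exact: lt_le_trans tx.
have ptE u : 1 / 2 <= 1 - cos u / 2 ->
    log_polar (Num.max (x * (1 - cos u / 2)) (tau / 2)) (t + x / 2 * sin u) =
    log_polar (x - x / 2 * cos u) (t + x / 2 * sin u).
  move=> cu; rewrite max_l; first by congr log_polar; field.
  nra.
have c2 u : 1 / 2 <= 1 - cos u / 2 :> R by have := cos_le1 u; lra.
have := @log_polar_submean R f x t (x / 2) n eta e _ _ df n0 eta0 (ltW e0) _.
move=> H; have {}H := H ltac:(lra) ltac:(lra) _.
rewrite {1}/log_field max_l; last by lra.
rewrite /circle_mean.
rewrite (eq_bigr (fun k => ltrunc eta (f (log_polar
  (x - x / 2 * cos (k%:R * (2 * pi / n%:R)))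
  (t + x / 2 * sin (k%:R * (2 * pi / n%:R))))))); last first.
  by move=> k _; rewrite /log_field /radius_factor ptE.
apply: H => u v u0 uv vn v2.
rewrite -!ptE// -lerBlDl; apply: (le_trans (ler_norm _)).
have uvd : `|v - u| <= d.
  by rewrite ger0_norm ?subr_ge0// lerBlDl (le_trans vn)// lerD2l.
apply: dP.
- have := cos_geN1 v; have := cos_le1 v => h1 h2.
  by rewrite ler_norml; apply/andP; split; nra.
- have := sin_geN1 v; have := sin_le1 v => h1 h2.
  by rewrite ler_norml; apply/andP; split; nra.
- rewrite (_ : _ - _ = - (x / 2 * (cos v - cos u))); last by field.
  rewrite normrN normrM (ger0_norm (_ : 0 <= x / 2)); last by rewrite divr_ge0 // ltW.
  apply: le_trans uvd; apply: le_trans (cos_lip v u).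
  by rewrite ler_piMl//; lra.
- rewrite (_ : _ - _ = x / 2 * (sin v - sin u)); last by ring.
  rewrite normrM (ger0_norm (_ : 0 <= x / 2)); last by rewrite divr_ge0 // ltW.
  apply: le_trans uvd; apply: le_trans (sin_lip v u).
  by rewrite ler_piMl//; lra.
Qed.

(** [ltrunc_gain] on the circle of radius r = x / 2: x <= 1/4 gives r <= 1/8, and (x, t) is within
    xa / 16 <= r / 8 of the zero. *)
Lemma log_field_gain tau eta xa ta n x t : 0 < tau -> 0 < eta -> (0 < n)%N ->
  2 * tau <= xa -> x <= 1 / 4 -> xa <= x <= xa + xa / 32 -> `|t - ta| <= xa / 32 ->
  eta <= expR (- xa) * (xa / 16) ->
  log_field tau eta (fun z => z - log_polar xa ta) x t + ln 2 <=
  circle_mean n (log_field tau eta (fun z => z - log_polar xa ta)) x t.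
Proof.
move=> tau0 eta0 n0 txa x4 /andP[xa1 xa2] ta1 etaP.
have n00 : 0 < n%:R :> R by rewrite ltr0n.
have x0 : 0 < x by lra.
rewrite /circle_mean mulrC ler_pdivlMr// mulr_natr -lerN2 -mulNrn -sumrN.
apply: sum_le_muln => k; rewrite lerN2 /log_field max_l; last by lra.
have /andP[m1 m2] := radius_factor_bound R n k.
rewrite max_l; last by nra.
rewrite (_ : x * radius_factor n k = x - x / 2 * cos (root_angle n k)); last first.
  by rewrite /radius_factor; field.
apply: ltrunc_gain => //.
- by rewrite divr_gt0.
- by lra.
- have -> : `|x - xa| = x - xa by rewrite ger0_norm ?subr_ge0.
  lra.
- apply: (le_trans etaP); rewrite cabs_log_polar ler_pM2l ?expR_gt0//; lra.
Qed.

End Circle_mean.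

(** * Truncated logarithms of products, and circle means of linear factors *)

Section Log_sum.
Variable R : realType.
Implicit Types (x y t e eta tau : R) (f g : R[i] -> R[i]).

Lemma continuous2_bounded (h : R -> R -> R) M : continuous2 h ->
  exists B : R, forall x y, `|x| <= M -> `|y| <= M -> `|h x y| <= B.
Proof.
move=> ch.
have cK : compact (`[- M, M] `*` `[- M, M] : set (R * R)).
  by apply: compact_setX; exact: segment_compact.
have := continuous_compact (continuous_subspaceT ch) cK.
move=> /compact_bounded[B [_ /(_ (B + 1))]]; rewrite ltrDl ltr01 => /(_ isT) hB.
exists (B + 1) => x y xM yM; apply: hB.
by exists (x, y) => //=; split; rewrite /= in_itv/= -ler_norml.
Qed.

(** Each maximum is at most b_i + eta; in the expanded product every term other than the product of
    the b_i carries a factor eta and is otherwise bounded. *)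
Lemma prod_max_le (T I : Type) (A : T -> Prop) (s : seq I) (b : I -> T -> R) :
  (forall i, exists B, forall u, A u -> 0 <= b i u <= B) ->
  exists2 C, 0 <= C & forall u eta, A u -> 0 <= eta <= 1 ->
    \prod_(i <- s) b i u <= C /\
    \prod_(i <- s) Num.max (b i u) eta <= \prod_(i <- s) b i u + C * eta.
Proof.
move=> hb; elim: s => [|i s [C C0 hC]].
  by exists 1 => // u eta _ /andP[e0 _]; rewrite !big_nil; split=> //; lra.
have [B hB] := hb i; exists ((`|B| + 2) * C); first by rewrite mulr_ge0// addr_ge0.
move=> u eta uA /[dup] e01 /andP[e0 e1]; have [h1 h2] := hC u eta uA e01.
have /andP[b0 bB] := hB u uA; have bB' : b i u <= `|B| := le_trans bB (ler_norm _).
have P0 : 0 <= \prod_(j <- s) b j u.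
  by apply: prodr_ge0 => j _; have [? /(_ u uA)/andP[]] := hb j.
have Q0 : 0 <= \prod_(j <- s) Num.max (b j u) eta.
  by apply: prodr_ge0 => j _; rewrite le_max e0 orbT.
rewrite !big_cons; set P := \prod_(j <- s) b j u in h1 h2 P0 *.
set Q := \prod_(j <- s) _ in h2 Q0 *; set c := b i u in b0 bB bB' *.
have B0 := normr_ge0 B; set B' := `|B| in bB' B0 *.
have h3 : c * P <= B' * C by apply: ler_pM.
have BC0 : 0 <= B' * C by exact: mulr_ge0.
split; first by lra.
have h4 : Num.max c eta <= c + eta by rewrite ge_max lerDl lerDr e0.
have h5 : Num.max c eta * Q <= (c + eta) * (P + C * eta).
  by apply: ler_pM => //; rewrite le_max e0 orbT.
apply: (le_trans h5).
have h6 : c * (C * eta) <= B' * (C * eta) by apply: ler_wpM2r => //; rewrite mulr_ge0.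
have h7 : eta * P <= eta * C by apply: ler_wpM2l.
have h8 : eta * (C * eta) <= C * eta by apply: ler_piMl => //; rewrite mulr_ge0.
clear - h6 h7 h8; lra.
Qed.

Lemma ln_add_le (b c : R) : 0 <= b -> 0 < c -> ln (b + c) <= logp b + c.
Proof.
move=> b0 c0; have bc : 0 < b + c by lra.
have [b1|b1] := leP 1 b.
  have b00 : 0 < b by lra.
  have -> : b + c = b * (1 + c / b) by field; rewrite gt_eqF.
  have cb : 0 < c / b by rewrite divr_gt0.
  rewrite lnM ?posrE//; last by lra.
  rewrite /logp lerD//; first by rewrite le_max lexx.
  apply: (le_trans (le_ln1Dx _)); first by lra.
  by rewrite ler_pdivrMr// ler_peMr// ltW.
apply: (@le_trans _ _ c); last by rewrite lerDr le_max lexx orbT.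
apply: (@le_trans _ _ (ln (1 + c))); first by rewrite ler_ln ?posrE//; lra.
by apply: le_ln1Dx; lra.
Qed.

Lemma logp_ge0 (x : R) : 0 <= logp x.
Proof. by rewrite le_max lexx orbT. Qed.

(** Truncating the factors separately lets each zero show its own gain; the discrepancy with log^+
    of the product is C eta, uniformly in (x, t). *)
Lemma log_field_sum_le (I : Type) (s : seq I) (F : I -> R[i] -> R[i]) tau :
  0 < tau -> (forall i z, cabs z < 1 -> cderivable (F i) z) ->
  exists2 C, 0 <= C & forall eta x t, 0 < eta -> eta <= 1 -> 0 <= x <= 1 ->
    0 <= t <= 2 * pi ->
    \sum_(i <- s) log_field tau eta (F i) x t <=
    logp (cabs (\prod_(i <- s) F i (log_polar (Num.max x (tau / 2)) t))) + C * eta.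
Proof.
move=> tau0 dF; pose A (u : R * R) := 0 <= u.1 <= 1 /\ 0 <= u.2 <= 2 * pi.
pose b i (u : R * R) := cabs (F i (log_polar (Num.max u.1 (tau / 2)) u.2)).
have [|C C0 hC] := @prod_max_le (R * R) I A s b.
  move=> i; have [B hB] := continuous2_bounded (1 + 2 * pi)
    (continuous2_clamp_comp tau0 (dF i)).
  exists B => -[x t] [/= /andP[x0 x1] /andP[t0 t1]].
  rewrite cabs_ge0 /=; apply: (le_trans (ler_norm _)); apply: hB => /=.
    by rewrite ger0_norm//; have := @pi_ge0 R; lra.
  by rewrite ger0_norm//; lra.
exists (C + 1); first by rewrite addr_ge0.
move=> eta x t eta0 eta1 x01 t01.
have [||_ h] := hC (x, t) eta; [by []|by rewrite (ltW eta0)|].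
have m0 i : 0 < Num.max (b i (x, t)) eta by rewrite lt_max eta0 orbT.
have -> : \sum_(i <- s) log_field tau eta (F i) x t =
    ln (\prod_(i <- s) Num.max (b i (x, t)) eta).
  elim: s {hC h} => [|i s ih]; first by rewrite !big_nil ln1.
  by rewrite !big_cons ih lnM ?posrE//; apply: prodr_gt0.
rewrite cabs_prod mulrDl mul1r.
apply: (@le_trans _ _ (ln (\prod_(i <- s) b i (x, t) + (C * eta + eta)))).
  rewrite ler_ln ?posrE; first by apply: (le_trans h); lra.
    exact: prodr_gt0.
  rewrite ltr_wpDl//; first by apply: prodr_ge0 => i _; exact: cabs_ge0.
  by rewrite ltr_wpDl// mulr_ge0// ltW.
apply: ln_add_le; first by apply: prodr_ge0 => i _; exact: cabs_ge0.
by rewrite ltr_wpDl// mulr_ge0// ltW.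
Qed.

(** For a = rho e^(i u), |r e^(i t) - a| = |r - conj(a) e^(i t)|. The right side is the modulus of a
    holomorphic function of e^(i t) whose value at 0 is r. *)
Lemma cabs_reflect (r rho t u : R) :
  cabs (circle_pt r t - circle_pt rho u) =
  cabs (r%:C - (rho * cos u -i* (rho * sin u)) * circle_pt 1 t).
Proof.
rewrite /circle_pt /=; congr Num.sqrt; apply/eqP; rewrite -subr_eq0.
set c := cos t; set s := sin t; set c' := cos u; set s' := sin u.
apply/eqP; transitivity
  ((r ^+ 2 - rho ^+ 2 * (c' ^+ 2 + s' ^+ 2)) * (c ^+ 2 + s ^+ 2 - 1)).
  by ring.
by rewrite /c /s cos2Dsin2 subrr mulr0.
Qed.

Lemma segint_log_field_ge tau eta f x : 0 < tau -> 0 < eta -> tau / 2 <= x ->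
  (forall z, cabs z < 1 -> cderivable f z) -> f 0 != 0 ->
  ln (cabs (f 0)) * (2 * pi) <= segint 0 (2 * pi) (log_field tau eta f x).
Proof.
move=> tau0 eta0 xt df f0; have x0 : 0 < x by apply: lt_le_trans xt; rewrite divr_gt0.
have p0 : 0 < 2 * pi :> R by rewrite mulr_gt0 ?pi_gt0.
have r1 : expR (- x) < 1 by rewrite -expR0 ltr_expR oppr_lt0.
have := segint_submean (expR_gt0 (- x)) r1 eta0 df.
rewrite [segint _ _ _](_ : _ = segint 0 (2 * pi) (log_field tau eta f x)); last first.
  by apply: eq_segint => t _; rewrite /log_field max_l.
apply: le_trans.
rewrite ler_pM2r// /ltrunc ler_ln ?posrE ?cabs_gt0//; first by rewrite le_max lexx.
by rewrite lt_max eta0 orbT.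
Qed.

(** The mean of ln |z - a| over |z| = exp (- x) dominates ln |a| = - xa by the submean inequality,
    and ln |z| = - x by the same inequality for the reflected factor. *)
Lemma segint_log_field_sub_ge tau eta xa ta x : 0 < tau -> 0 < eta -> tau / 2 <= x ->
  Num.max (- xa) (- x) * (2 * pi) <=
  segint 0 (2 * pi) (log_field tau eta (fun z => z - log_polar xa ta) x).
Proof.
move=> tau0 eta0 xt; have x0 : 0 < x by apply: lt_le_trans xt; rewrite divr_gt0.
have p0 : 0 < 2 * pi :> R by rewrite mulr_gt0 ?pi_gt0.
have dz z : cderivable (fun z => z - log_polar xa ta) z.
  by apply: cderivableB; [exact: cderivable_id|exact: cderivable_cst].
have ca : cabs (0 - log_polar xa ta) = expR (- xa).
  by rewrite sub0r cabsN cabs_log_polar.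
have H1 : - xa * (2 * pi) <=
    segint 0 (2 * pi) (log_field tau eta (fun z => z - log_polar xa ta) x).
  have := segint_log_field_ge tau0 eta0 xt (fun z _ => dz z).
  by rewrite ca expRK; apply; rewrite -cabs_gt0 ca expR_gt0.
rewrite /Num.max; case: ifP => // _.
pose h w : R[i] := (expR (- x))%:C -
  (expR (- xa) * cos ta -i* (expR (- xa) * sin ta)) * w.
have dh z : cderivable h z.
  apply: cderivableB; first exact: cderivable_cst.
  by apply: cderivableM; [exact: cderivable_cst|exact: cderivable_id].
have l2 : (1:R) < 2 by rewrite ltr1n.
have := segint_submean (@ltr01 R) l2 eta0 (fun z _ => dh z).
have -> : h 0 = (expR (- x))%:C by rewrite /h mulr0 subr0.
rewrite [segint _ _ _](_ : _ = segint 0 (2 * pi)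
    (log_field tau eta (fun z => z - log_polar xa ta) x)); last first.
  apply: eq_segint => t _; rewrite /log_field max_l// /ltrunc; congr (ln (Num.max _ _)).
  by rewrite /h -cabs_reflect.
apply: le_trans; rewrite ler_pM2r// /ltrunc cabs_real ger0_norm ?expR_ge0//.
rewrite -{1}[- x]expRK ler_ln ?posrE ?expR_gt0//; first by rewrite le_max lexx.
by rewrite lt_max expR_gt0.
Qed.

End Log_sum.

(** * Contribution of a single factor *)

Section Gain.
Variable R : realType.
Implicit Types (x y t e eta xa ta : R) (n : nat) (f g : R[i] -> R[i]) (a : R).
Variables (D : R -> R -> R) (p q tau : R).
Hypotheses (D_ge : forall x t, 0 <= x -> x <= 1 -> x / 2 <= D x t)
  (D_ge0 : forall x t, 0 <= D x t) (D_le : forall x t, D x t <= 2)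
  (D_lip : forall x t x' t', `|D x t - D x' t'| <= `|x - x'| + `|t - t'|)
  (D_per : forall x t, D x (t + 2 * pi) = D x t)
  (p0 : 0 <= p) (q0 : 0 < q) (tau0 : 0 < tau) (tau1 : tau <= 1 / 100).
Notation w := (weight D p q tau).
Notation W := (total_weight D p q tau).
Notation L := (log_field tau).
Notation I h := (rectint 0 1 0 (2 * pi) h).

Let pp : 0 < 2 * pi :> R. Proof. by rewrite mulr_gt0 ?pi_gt0. Qed.
Let pp0 : 0 <= 2 * pi :> R. Proof. exact: ltW. Qed.
Let cw : continuous2 w. Proof. exact: continuous2_weight. Qed.

Lemma powR_mulr a x : 0 < x -> x `^ (a + 1) = x `^ a * x.
Proof.
move=> x0; rewrite powRD; first by rewrite powRr1 ?ltW.
by apply/implyP => _; rewrite gt_eqF.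
Qed.

Definition excess n eta f : R :=
  I (fun x t => w x t * (circle_mean n (L eta f) x t - L eta f x t)).

Let c2excess n eta f : 0 < eta -> (forall z, cabs z < 1 -> cderivable f z) ->
  continuous2 (fun x t => circle_mean n (L eta f) x t - L eta f x t).
Proof.
move=> eta0 df; have cL := continuous2_log_field tau0 eta0 df.
by apply: continuous2B => //; exact: continuous2_circle_mean.
Qed.

Lemma total_weight_log_field n eta f : 0 < eta ->
  (forall z, cabs z < 1 -> cderivable f z) ->
  I (fun x t => W n x t * L eta f x t) =
  excess n eta f + weight_max p q * I (fun x t => collar x * L eta f x t).
Proof.
move=> eta0 df; have cL := continuous2_log_field tau0 eta0 df.
have cM := @continuous2_circle_mean R n _ cL.
have cd : continuous2 (dual_weight D p q tau n) by exact: continuous2_dual_weight.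
have cb : continuous2 (fun x _ : R => collar x) by apply: continuous2_lift; exact: continuous_collar.
have -> : excess n eta f = I (fun x t => dual_weight D p q tau n x t * L eta f x t) -
    I (fun x t => w x t * L eta f x t).
  rewrite -(rectint_dual p q n D_ge0 D_lip D_per tau0 cL); last first.
    exact: log_field_periodic.
  rewrite -(rectintB 0 1 pp0); [|exact: continuous2M|exact: continuous2M].
  by apply: eq_rectint => x t _ _; rewrite mulrBr.
rewrite -(rectintZ 0 1 pp0); last exact: continuous2M.
rewrite -(rectintB 0 1 pp0); [|exact: continuous2M|exact: continuous2M].
rewrite -(rectintD 0 1 pp0); first last.
- by apply: continuous2M; [exact: continuous2_cst|exact: continuous2M].
- by apply: continuous2B; exact: continuous2M.
apply: eq_rectint => x t _ _; rewrite /total_weight; ring.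
Qed.

Lemma excess_ge eta e f : 0 < eta -> 0 < e ->
  (forall z, cabs z < 1 -> cderivable f z) ->
  exists N, forall n, (N <= n)%N -> - (e * I w) <= excess n eta f.
Proof.
move=> eta0 e0 df; have [N hN] := log_field_submean tau0 eta0 e0 df.
exists N => n /hN {}hN; rewrite -mulNr -(rectintZ 0 1 pp0 _ cw).
apply: le_rectint => //.
- by apply: continuous2M => //; exact: continuous2_cst.
- by apply: continuous2M => //; exact: c2excess.
move=> x t _ t02; rewrite mulrC.
have [xt|xt] := leP x tau; first by rewrite weight_eq0 ?mul0r//; left.
have [x4|x4] := leP (1 / 4) x; first by rewrite weight_eq0 ?mul0r//; right.
apply: ler_wpM2l; first exact: weight_ge0.
by have := hN x t (ltW xt) (ltW x4) t02; lra.
Qed.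

(** The 1/8 is 1/2 times 1/4: x >= 2 tau gives x - tau >= x / 2, and x <= 33/32 * 3/16 keeps the
    cutoff above 1/4. The other constant compares the powers of x and xa. *)
Lemma weight_ge_gain xa ta x t : 2 * tau <= xa -> xa <= 3 / 16 ->
  xa <= x <= xa + xa / 32 -> `|t - ta| <= xa / 32 ->
  (2 `^ `|p - 1|)^-1 / 8 * (xa `^ (p - 1) * D xa ta `^ q) <= w x t.
Proof.
have t0 := tau0; move=> txa xa16 /andP[x1 x2] tta.
have xa0 : 0 < xa by lra.
have x0 : 0 < x by lra.
rewrite /weight max_l; last by lra.
rewrite max_r; last by lra.
have g : D xa ta <= gauge D tau x t.
  rewrite /gauge max_l; last by lra.
  have := D_lip xa ta x t => /(le_trans (ler_norm _)).
  rewrite distrC (distrC ta) (ger0_norm (_ : 0 <= x - xa)); last by rewrite subr_ge0.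
  by lra.
have g' : D xa ta `^ q <= gauge D tau x t `^ q.
  by apply: ge0_powR_le; [exact: ltW q0|exact: D_ge0|].
have xE : x `^ (p - 1) = x `^ (p - 2) * x.
  by rewrite -powR_mulr//; congr (_ `^ _); ring.
have q1 : (2 `^ `|p - 1|)^-1 * xa `^ (p - 1) <= x `^ (p - 1).
  rewrite mulrC ler_pdivrMr ?powR_gt0// mulrC.
  by apply: powR_le_quot => //; [rewrite ler1n|lra|lra].
have c1 : 1 / 4 <= cutoff x.
  rewrite /cutoff le_max; apply/orP; right; rewrite le_min.
  by apply/andP; split; lra.
have q2 : x `^ (p - 1) / 2 <= x `^ (p - 2) * (x - tau).
  rewrite xE -mulrA ler_wpM2l ?powR_ge0//; lra.
rewrite [leLHS](_ : _ = (2 `^ `|p - 1|)^-1 * xa `^ (p - 1) / 2 * (1 / 4) * D xa ta `^ q);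
  last by field; rewrite gt_eqF ?powR_gt0.
have P1 := powR_ge0 xa (p - 1); have P2 : 0 <= (2 `^ `|p - 1| : R)^-1 by rewrite invr_ge0 powR_ge0.
have P3 := powR_ge0 (D xa ta) q.
apply: ler_pM => //; first by rewrite !mulr_ge0 ?divr_ge0.
apply: ler_pM => //; first by rewrite !mulr_ge0 ?divr_ge0.
by rewrite (le_trans _ q2)// ler_wpM2r// invr_ge0.
Qed.

(** The gain ln 2 of the mean, times the constant of [weight_ge_gain], times the area 1/1024 of a
    square whose side is 1/32 of the depth of the zero. *)
Definition inner_gain : R := ln 2 * ((2 `^ `|p - 1|)^-1 / 8) / 1024.

Lemma inner_gain_gt0 : 0 < inner_gain.
Proof.
apply: divr_gt0; last by rewrite ltr0n.
apply: mulr_gt0; first by apply: ln_gt0; rewrite ltr1n.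
by apply: divr_gt0; [rewrite invr_gt0 powR_gt0|rewrite ltr0n].
Qed.

Lemma excess_gain eta e xa ta : 0 < eta -> 0 < e ->
  2 * tau <= xa -> xa <= 3 / 16 -> 0 <= ta <= 2 * pi ->
  eta <= expR (- xa) * (xa / 16) ->
  exists N, forall n, (N <= n)%N ->
    inner_gain * (xa `^ (1 + p) * D xa ta `^ q) - e * I w <=
    excess n eta (fun z => z - log_polar xa ta).
Proof.
have t0 := tau0; move=> eta0 e0 txa xa16 /andP[ta0 ta2] etaxa.
have xa0 : 0 < xa by lra.
set h := fun z : R[i] => z - log_polar xa ta.
have dh z : cabs z < 1 -> cderivable h z.
  by move=> _; apply: cderivableB; [exact: cderivable_id|exact: cderivable_cst].
have [N hN] := log_field_submean tau0 eta0 e0 dh.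
exists N.+1 => n Nn; have n0 : (0 < n)%N by exact: leq_trans Nn.
have {}hN := hN n (ltnW Nn).
have ce := c2excess eta0 dh.
rewrite lerBlDr /excess -(rectintZ 0 1 pp0)// -(rectintD 0 1 pp0); first last.
- by apply: continuous2M => //; exact: continuous2_cst.
- exact: continuous2M.
set F := fun x t : R => _ + _.
have cF : continuous2 F.
  apply: continuous2D; first exact: continuous2M.
  by apply: continuous2M => //; exact: continuous2_cst.
pose r := ln 2 * ((2 `^ `|p - 1|)^-1 / 8 * (xa `^ (p - 1) * D xa ta `^ q)).
have FE x t : F x t = w x t * (circle_mean n (L eta h) x t - L eta h x t + e).
  by rewrite /F; ring.
(* With e added the integrand is nonnegative, so the integral may be restricted to a small square
   next to the zero. *)
have F0 x t : 0 <= x <= 1 -> 0 <= t <= 2 * pi -> 0 <= F x t.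
  move=> _ t02; rewrite FE.
  have [xt|xt] := leP x tau; first by rewrite weight_eq0 ?mul0r//; left.
  have [x4|x4] := leP (1 / 4) x; first by rewrite weight_eq0 ?mul0r//; right.
  apply: mulr_ge0; first exact: weight_ge0.
  by have := hN x t (ltW xt) (ltW x4) t02; lra.
have Fr x t : xa <= x <= xa + xa / 32 -> `|t - ta| <= xa / 32 -> r <= F x t.
  move=> xx tt; rewrite FE mulrC.
  have l2 : 0 <= ln 2 :> R by rewrite ln_ge0// ler1n.
  have x4 : x <= 1 / 4 by case/andP: xx => _; lra.
  apply: ler_pM => //.
  - rewrite !mulr_ge0 ?powR_ge0// invr_ge0 powR_ge0//.
  - have := log_field_gain tau0 eta0 n0 txa x4 xx tt etaxa.
    by rewrite -/h; lra.
  - exact: weight_ge_gain.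
have key c : 0 <= c -> c + xa / 32 <= 2 * pi ->
    (forall t, c <= t <= c + xa / 32 -> `|t - ta| <= xa / 32) ->
    inner_gain * (xa `^ (1 + p) * D xa ta `^ q) <= I F.
  move=> c0 c2 cP.
  have := @rectint_sub_ge R 0 1 0 (2 * pi) pp0 F xa (xa + xa / 32) c (c + xa / 32) r.
  move=> H; apply: le_trans (H (ltW xa0) _ _ c0 _ c2 cF F0 _) => {H}.
  - have xE : xa `^ (1 + p) = xa `^ (p - 1) * xa * xa.
      by rewrite -!powR_mulr//; congr (_ `^ _); ring.
    by rewrite xE /inner_gain /r le_eqVlt; apply/orP; left; apply/eqP; field; rewrite gt_eqF ?powR_gt0.
  - by lra.
  - by lra.
  - by lra.
  - by move=> x t xx tt; apply: Fr => //; exact: cP.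
have pi2 := @pi_ge2 R.
(* The square is placed on the side of [ta] that stays within [0, 2 pi]. *)
have [tp|tp] := leP ta pi.
  apply: (key ta) => //; first by lra.
  by move=> t /andP[h1 h2]; rewrite ger0_norm; lra.
apply: (key (ta - xa / 32)); [lra|lra|].
by move=> t /andP[h1 h2]; rewrite ler0_norm; lra.
Qed.

Let cb : continuous (@collar R). Proof. exact: continuous_collar. Qed.
Definition collar_mass : R := segint 0 1 (@collar R).

Let rectint_collar eta f : 0 < eta -> (forall z, cabs z < 1 -> cderivable f z) ->
  I (fun x t => collar x * L eta f x t) =
  segint 0 1 (fun x => collar x * segint 0 (2 * pi) (L eta f x)).
Proof.
move=> eta0 df; have cL := continuous2_log_field tau0 eta0 df.
by apply: eq_segint => x _; apply: segintZ; exact: continuous2_row.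
Qed.

Let segint_collar_le (F G : R -> R) : continuous F -> continuous G ->
  (forall x, tau / 2 <= x -> F x <= G x) ->
  segint 0 1 (fun x => collar x * F x) <= segint 0 1 (fun x => collar x * G x).
Proof.
have t0 := tau0; have t1 := tau1; move=> cF cG FG; apply: le_segint.
- by move=> x; apply: cvgM; [exact: cb|exact: cF].
- by move=> x; apply: cvgM; [exact: cb|exact: cG].
move=> x _; have [x1|x1] := leP x (1 / 32); first by rewrite collar0 ?mul0r//; left.
apply: ler_wpM2l; first exact: collar_ge0.
by apply: FG; lra.
Qed.

Lemma collar_log_field_ge eta f : 0 < eta -> (forall z, cabs z < 1 -> cderivable f z) ->
  f 0 != 0 ->
  ln (cabs (f 0)) * (2 * pi) * collar_mass <= I (fun x t => collar x * L eta f x t).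
Proof.
move=> eta0 df f0; rewrite rectint_collar// -segintZ//.
rewrite [leLHS](_ : _ = segint 0 1 (fun x => collar x * (ln (cabs (f 0)) * (2 * pi)))); last first.
  by apply: eq_segint => x _; rewrite mulrC.
apply: segint_collar_le; first by move=> x; exact: cvg_cst.
  by apply: continuous_segint => //; exact: continuous2_log_field.
by move=> x xt; exact: segint_log_field_ge.
Qed.

(** The product (1/16) (2 pi) (1/16): on [1/16, 1/8] the bump is 1, and xa - x >= 1/16 when xa >
    3/16. *)
Definition outer_gain : R := pi / 128.

(** The lower bound max (- xa, - x) of the circle means is - xa plus the positive part of xa - x.
    The first term is the loss to be balanced later, the second the gain of a deep zero. *)
Lemma collar_gain eta xa ta : 0 < eta ->
  (if xa <= 3 / 16 then 0 else outer_gain) - xa * (2 * pi) * collar_mass <=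
  I (fun x t => collar x * L eta (fun z => z - log_polar xa ta) x t).
Proof.
move=> eta0; set h := fun z : R[i] => z - log_polar xa ta.
have dh z : cabs z < 1 -> cderivable h z.
  by move=> _; apply: cderivableB; [exact: cderivable_id|exact: cderivable_cst].
rewrite rectint_collar//.
have cm : continuous (fun x : R => Num.max 0 (- 1 * x + xa)).
  by apply: (continuous_minmax _ _).2; [move=> x; exact: cvg_cst|exact: continuous_affine].
have cm' : continuous (fun x : R => Num.max 0 (- 1 * x + xa) * (2 * pi) - xa * (2 * pi)).
  move=> x; apply: cvgB; last exact: cvg_cst.
  by apply: cvgM; [exact: cm|exact: cvg_cst].
apply: (@le_trans _ _ (segint 0 1
    (fun x => collar x * (Num.max 0 (- 1 * x + xa) * (2 * pi) - xa * (2 * pi))))); last first.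
  apply: segint_collar_le => //.
    by apply: continuous_segint => //; exact: continuous2_log_field.
  move=> x xt; apply: le_trans (segint_log_field_sub_ge xa ta tau0 eta0 xt).
  rewrite -mulrBl ler_pM2r// /Num.max; case: ifP => h1; case: ifP => h2.
  - by lra.
  - by move/negbT: h2; rewrite -leNgt; lra.
  - by move/negbT: h1; rewrite -leNgt; lra.
  - by lra.
have cbm : continuous (fun x : R => collar x * (Num.max 0 (- 1 * x + xa) * (2 * pi))).
  move=> x; apply: cvgM; first exact: cb.
  by apply: cvgM; [exact: cm|exact: cvg_cst].
rewrite [leRHS](_ : _ = segint 0 1 (fun x => collar x * (Num.max 0 (- 1 * x + xa) * (2 * pi)) -
   xa * (2 * pi) * collar x)); last by apply: eq_segint => x _; ring.
rewrite segintB//; last by move=> x; apply: cvgM; [exact: cvg_cst|exact: cb].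
rewrite segintZ// lerD2r.
have pos x : 0 <= collar x * (Num.max 0 (- 1 * x + xa) * (2 * pi)).
  by rewrite !mulr_ge0 ?collar_ge0 ?le_max ?lexx ?pi_ge0.
case: ifPn => [_|]; first by apply: segint_ge0.
rewrite -ltNge => xa16.
have l1 : 1 / 16 <= 1 / 8 :> R by lra.
apply: (@le_trans _ _ (segint (1 / 16) (1 / 8) (fun=> 1 / 16 * (2 * pi)))).
  by rewrite segint_cst// /outer_gain; have := pp0; lra.
apply: (@le_trans _ _ (segint (1 / 16) (1 / 8)
    (fun x => collar x * (Num.max 0 (- 1 * x + xa) * (2 * pi))))); last first.
  by apply: segint_sub => //; lra.
apply: le_segint => //; first by move=> x; exact: cvg_cst.
move=> x /andP[x1 x2]; rewrite collar1; last by apply/andP; split; lra.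
rewrite [leRHS]mul1r ler_pM2r// le_max; apply/orP; right; lra.
Qed.

End Gain.

(** * Weighted count of finitely many zeros *)

Lemma mulr_div_le (R : realFieldType) (Y e : R) : 0 <= Y -> 0 <= e ->
  Y * (e / (2 * (Y + 1))) <= e / 2.
Proof.
move=> Y0 e0; have q0 : 0 < 2 * (Y + 1) by lra.
by rewrite mulrA ler_pdivrMr//; nra.
Qed.

Lemma le_balance (R : realFieldType) (G A B X E B1 B2 k w h : R) :
  G <= A + B -> A - k <= E -> - w <= X -> k + w <= h -> B <= B1 + B2 ->
  G - h <= X + B1 + (E + B2).
Proof. by lra. Qed.

Section Mass_inequality.
Variable R : realType.
Implicit Types (x y t e eta : R) (n : nat) (f g : R[i] -> R[i]) (a : R * R)
  (s : seq (R * R)).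
Variables (D : R -> R -> R) (p q tau : R).
Hypotheses (D_ge : forall x t, 0 <= x -> x <= 1 -> x / 2 <= D x t)
  (D_ge0 : forall x t, 0 <= D x t) (D_le : forall x t, D x t <= 2)
  (D_lip : forall x t x' t', `|D x t - D x' t'| <= `|x - x'| + `|t - t'|)
  (D_per : forall x t, D x (t + 2 * pi) = D x t)
  (p0 : 0 <= p) (q0 : 0 < q) (tau0 : 0 < tau) (tau1 : tau <= 1 / 100).
Notation w := (weight D p q tau).
Notation W := (total_weight D p q tau).
Notation L := (log_field tau).
Notation I h := (rectint 0 1 0 (2 * pi) h).
Notation factor a := (fun z => z - log_polar a.1 a.2).

(** log^+ is truncation at level 1, so log^+ |f| is itself a [log_field] and inherits its
    continuity. *)
Lemma logpE x : logp x = ln (Num.max x 1).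
Proof.
rewrite /logp; have [x1|x1] := leP x 1.
  rewrite ln1 max_r//; have [x0|x0] := leP x 0; first by rewrite ln0.
  by rewrite -ln1 ler_ln ?posrE.
by rewrite max_l// ln_ge0// ltW.
Qed.

Lemma logp_field f x t :
  logp (cabs (f (log_polar (Num.max x (tau / 2)) t))) = L 1 f x t.
Proof. by rewrite logpE. Qed.

Lemma cderivable_factor a z : cderivable (factor a) z.
Proof. by apply: cderivableB; [exact: cderivable_id|exact: cderivable_cst]. Qed.

(** The bound may depend on tau but not on n: the truncation level eta is fixed before n is
    chosen. *)
Lemma total_weight_bounded : exists2 K, 0 <= K & forall n x t, (3 <= n)%N ->
  0 <= x <= 1 -> W n x t <= K.
Proof.
have t0 := tau0; have t1 := tau1.
exists (weight_bound p q * ((2 / tau) `^ `|p - 1| * 2 `^ q)).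
  by rewrite !mulr_ge0 ?powR_ge0 ?weight_bound_ge0.
move=> n x t n3 /andP[x0 x1].
have [xt|xt] := leP x (tau / 2).
  rewrite total_weight_eq0//; last by left.
  by rewrite !mulr_ge0 ?powR_ge0 ?weight_bound_ge0.
have [x2|x2] := leP (1 / 2) x.
  rewrite total_weight_eq0//; last by right.
  by rewrite !mulr_ge0 ?powR_ge0 ?weight_bound_ge0.
apply: (le_trans (total_weight_le D_ge D_ge0 D_lip p0 q0 tau0 tau1 t n3 (ltW xt) (ltW x2))).
apply: ler_wpM2l; first exact: weight_bound_ge0.
apply: ler_pM; rewrite ?powR_ge0//; last exact: ge0_powR_le (ltW q0) (D_ge0 _ _) (D_le _ _).
apply: powR_ub; first by rewrite ler_pdivlMr//; lra.
rewrite invf_div (ltW xt)/= ler_pdivlMr//; nra.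
Qed.

Lemma sum_excess s eta e : 0 < eta -> 0 < e ->
  (forall a, a \in s -> [/\ 2 * tau <= a.1, 0 <= a.2 <= 2 * pi &
    eta <= expR (- a.1) * (a.1 / 16)]) ->
  exists N, forall n, (N <= n)%N ->
    \sum_(a <- s) ((if a.1 <= 3 / 16 then
      inner_gain p * (a.1 `^ (1 + p) * D a.1 a.2 `^ q) else 0) - e * I w) <=
    \sum_(a <- s) excess D p q tau n eta (factor a).
Proof.
move=> eta0 e0; elim: s => [|a s ih] hs.
  by exists 0%N => n _; rewrite !big_nil.
have [N1 h1] := ih (fun b bs => hs b (@mem_behead _ (a :: s) b bs)).
have [|a1 a2 a3] := hs a _; first exact: mem_head.
have [N2 h2] : exists N, forall n, (N <= n)%N ->
    (if a.1 <= 3 / 16 then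
      inner_gain p * (a.1 `^ (1 + p) * D a.1 a.2 `^ q) else 0) - e * I w <=
    excess D p q tau n eta (factor a).
  case: ifPn => a4; first exact: excess_gain.
  have [N hN] := excess_ge p q D_ge0 D_lip tau0 eta0 e0
    (fun z _ => @cderivable_factor a z).
  by exists N => n /hN; rewrite sub0r.
exists (maxn N1 N2) => n; rewrite geq_max => /andP[n1 n2].
by rewrite !big_cons lerD ?h1 ?h2.
Qed.

(* Zeros far from the circle are only counted: they are detected by the radial
   bump instead of the circle means. *)
Definition zero_mass a : R :=
  if a.1 <= 3 / 16 then a.1 `^ (1 + p) * D a.1 a.2 `^ q else 1.

Definition gain : R := Num.min (inner_gain p) (weight_max p q * outer_gain R).

Lemma gain_gt0 : 0 < gain.
Proof.
rewrite lt_min inner_gain_gt0/=; apply: mulr_gt0.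
  by apply: mulr_gt0; apply: powR_gt0; rewrite ltr0n.
by rewrite divr_gt0 ?pi_gt0.
Qed.

(** In the collar each factor z - a loses a multiple of a.1, while g contributes the same multiple
    of ln |g(0)|; by hypothesis these cancel and the gains at the zeros remain. One half of e pays
    for the truncation through the choice of eta, the other for the submean errors through the
    choice of n. *)
Lemma mass_ineq s g e : (forall z, cabs z < 1 -> cderivable g z) -> 0 < e ->
  g 0 != 0 -> ln (cabs (g 0)) = \sum_(a <- s) a.1 ->
  (forall a, a \in s -> 2 * tau <= a.1 /\ 0 <= a.2 <= 2 * pi) ->
  exists2 n, (3 <= n)%N & gain * (\sum_(a <- s) zero_mass a) <=
    I (fun x t => W n x t * logp (cabs ((\prod_(a <- s)
       (log_polar (Num.max x (tau / 2)) t - log_polar a.1 a.2)) *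
       g (log_polar (Num.max x (tau / 2)) t)))) + e.
Proof.
have t0 := tau0; move=> dg e0 g0 lng hs.
have pp : 0 < 2 * pi :> R by rewrite mulr_gt0 ?pi_gt0.
have pp0 := ltW pp.
pose F (o : option (R * R)) := if o is Some a then factor a else g.
have dF o z : cabs z < 1 -> cderivable (F o) z.
  by move=> z1; case: o => [a|] /=; [exact: cderivable_factor|exact: dg].
have [C C0 hC] := log_field_sum_le (None :: map Some s) tau0 dF.
have [K K0 hK] := total_weight_bounded.
have [d d0 hd] : exists2 d, 0 < d & forall a, a \in s -> d <= expR (- a.1) * (a.1 / 16).
  elim: s hs {lng hC} => [|a s ih] hs; first by exists 1.
  have [d d0 hd] := ih (fun b bs => hs b (@mem_behead _ (a :: s) b bs)).
  have [|a1 _] := hs a _; first exact: mem_head.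
  exists (Num.min d (expR (- a.1) * (a.1 / 16))).
    by rewrite lt_min d0 mulr_gt0 ?expR_gt0//; lra.
  move=> b; rewrite inE => /predU1P[->|/hd hb]; first by rewrite ge_min lexx orbT.
  by rewrite ge_min hb.
have Y0 : 0 <= K * C * (2 * pi) by do 2 apply: mulr_ge0 => //.
have q1 : 0 < 2 * (K * C * (2 * pi) + 1) by lra.
pose eta := Num.min 1 (Num.min d (e / (2 * (K * C * (2 * pi) + 1)))).
have eta0 : 0 < eta by rewrite !lt_min ltr01 d0 divr_gt0.
have eta1 : eta <= 1 by rewrite ge_min lexx.
have etad : eta <= d by rewrite ge_min ge_min lexx orbT.
have etae : eta <= e / (2 * (K * C * (2 * pi) + 1)) by rewrite !ge_min lexx !orbT.
clearbody eta; have Iw0 : 0 <= I w by apply: rectint_ge0 => *; exact: weight_ge0.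
(* There are size s + 1 submean errors: one per linear factor and one for g. *)
have q2 : 0 < 2 * (((size s)%:R + 1) * I w + 1).
  by rewrite mulr_gt0// ltr_wpDl ?mulr_ge0// addr_ge0.
pose e' := e / (2 * (((size s)%:R + 1) * I w + 1)).
have e'0 : 0 < e' by rewrite divr_gt0.
have e'E : e' = e / (2 * (((size s)%:R + 1) * I w + 1)) by [].
clearbody e'.
have [N1 h1] := @sum_excess s eta e' eta0 e'0 (fun a as_ => let: conj u v := hs a as_ in
  And3 u v (le_trans etad (hd a as_))).
have [N2 h2] := excess_ge p q D_ge0 D_lip tau0 eta0 e'0 dg.
pose n := maxn 3 (maxn N1 N2).
have n3 : (3 <= n)%N by exact: leq_maxl.
have n1 : (N1 <= n)%N by rewrite (leq_trans (leq_maxl N1 N2))// leq_maxr.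
have n2 : (N2 <= n)%N by rewrite (leq_trans (leq_maxr N1 N2))// leq_maxr.
clearbody n; exists n => //; move: (h1 n n1) (h2 n n2) => {h1 h2 n1 n2} h1 h2.
have cW : continuous2 (W n) by exact: continuous2_total_weight.
have cL o : continuous2 (L eta (F o)) by exact (continuous2_log_field tau0 eta0 (dF o)).
have dP z : cabs z < 1 -> cderivable (fun z => (\prod_(a <- s) factor a z) * g z) z.
  move=> z1; apply: cderivableM; last exact: dg.
  by apply: cderivable_prod => a; exact: cderivable_factor.
pose P z := (\prod_(a <- s) factor a z) * g z.
have PE x t : \prod_(o <- None :: map Some s) F o (log_polar (Num.max x (tau / 2)) t) =
    P (log_polar (Num.max x (tau / 2)) t) by rewrite big_cons big_map mulrC.
rewrite (@eq_rectint _ _ _ _ _ _ (fun x t => W n x t * L 1 P x t)); last first.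
  by move=> x t _ _; rewrite -logp_field.
have cP : continuous2 (L 1 P) by exact: continuous2_log_field.
have up : \sum_(o <- None :: map Some s) I (fun x t => W n x t * L eta (F o) x t) <=
    I (fun x t => W n x t * L 1 P x t) + e / 2.
  rewrite -(rectint_sum 0 1 pp0); last by move=> o; exact: continuous2M.
  have cPc : continuous2 (fun x t => W n x t * L 1 P x t + K * (C * eta)).
    by apply: continuous2D; [exact: continuous2M|exact: continuous2_cst].
  apply: (@le_trans _ _ (I (fun x t => W n x t * L 1 P x t + K * (C * eta)))).
    apply: le_rectint => //.
      by apply: continuous2_sum => o; exact: continuous2M.
    move=> x t x01 t02; rewrite -mulr_sumr.
    have W0 : 0 <= W n x t by exact: total_weight_ge0.
    apply: (le_trans (ler_wpM2l W0 (hC eta x t eta0 eta1 x01 t02))).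
    rewrite mulrDr PE logp_field; apply: lerD; first exact: lexx.
    by apply: ler_wpM2r; [rewrite mulr_ge0// ltW|exact: hK].
  rewrite (rectintD 0 1 pp0); [|exact: continuous2M|exact: continuous2_cst].
  rewrite (rectint_cst ler01 pp0); apply: lerD; first exact: lexx.
  rewrite [leLHS](_ : _ = K * C * (2 * pi) * eta); last by ring.
  by apply: le_trans (mulr_div_le Y0 (ltW e0)); apply: ler_wpM2l.
suff low : gain * (\sum_(a <- s) zero_mass a) - e / 2 <=
    \sum_(o <- None :: map Some s) I (fun x t => W n x t * L eta (F o) x t).
  by rewrite [in leRHS](splitr e) addrA -lerBlDr; exact: le_trans low up.
rewrite big_cons big_map /=.
rewrite [X in _ <= _ + X](eq_bigr (fun a => excess D p q tau n eta (factor a) +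
  weight_max p q * I (fun x t => collar x * L eta (factor a) x t))); last first.
  move=> a _.
  exact (total_weight_log_field p q D_ge0 D_lip D_per tau0 n eta0
    (fun z _ => @cderivable_factor a z)).
rewrite total_weight_log_field// big_split/= -mulr_sumr.
have M0 := weight_max_ge0 p q.
have c1 := collar_log_field_ge tau0 tau1 eta0 dg g0.
have c2 : \sum_(a <- s) ((if a.1 <= 3 / 16 then 0 else outer_gain R) -
    a.1 * (2 * pi) * collar_mass R) <=
    \sum_(a <- s) I (fun x t => collar x * L eta (factor a) x t).
  by apply: ler_sum => a _; exact: collar_gain.
rewrite sumrB -!mulr_suml -lng in c2.
have h3 : gain * (\sum_(a <- s) zero_mass a) <=
    \sum_(a <- s) (if a.1 <= 3 / 16 then
      inner_gain p * (a.1 `^ (1 + p) * D a.1 a.2 `^ q) else 0) +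
    weight_max p q * \sum_(a <- s) (if a.1 <= 3 / 16 then 0 else outer_gain R).
  rewrite mulr_sumr mulr_sumr -big_split/=; apply: ler_sum => a _.
  rewrite /zero_mass; case: ifP => _.
    rewrite mulr0 addr0 ler_wpM2r ?mulr_ge0 ?powR_ge0//.
    by rewrite /gain ge_min lexx.
  by rewrite add0r mulr1 /gain ge_min lexx orbT.
have h4 : ((size s)%:R + 1) * (e' * I w) <= e / 2.
  rewrite [_ * (e' * _)]mulrCA [e' * _]mulrC e'E; apply: mulr_div_le (ltW e0).
  by apply: mulr_ge0; [rewrite addr_ge0 ?ler0n|exact: Iw0].
rewrite sumrB big_const_seq count_predT iter_addr_0 -[X in _ - X]mulr_natl in h1.
rewrite mulrDl mul1r in h4.
set S1 := \sum_(a <- s) (if _ then 0 else _) in h3 c2.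
set c := ln _ * _ * _ in c1 c2.
have h5 := ler_wpM2l M0 (lerD c1 c2).
(* Here the losses of the linear factors cancel against ln |g(0)|. *)
rewrite (_ : c + (S1 - c) = S1) in h5; last by ring.
rewrite mulrDr in h5.
exact: le_balance h3 h1 h2 h4 h5.
Qed.

End Mass_inequality.

(** * Comparison of polar and Cartesian integrals *)

Section Polar.
Variable R : realType.
Implicit Types (f g F : R -> R) (h H : R -> R -> R) (a b c d m r x y t : R).

Notation mu := (@lebesgue_measure R).

(** An open set is the union of the rational boxes it contains, hence measurable for the product
    sigma-algebra. *)
Lemma continuous2_measurable h : continuous2 h ->
  measurable_fun [set: measurableTypeR R * measurableTypeR R] (fun z => h z.1 z.2).
Proof.
move=> ch; apply: (measurability _ (RGenOInfty.measurableE R)).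
move=> /= _ [_ [r ->] <-]; rewrite setTI.
pose box (a b c d : rat) : set (measurableTypeR R * measurableTypeR R) :=
  `](ratr a), (ratr b)[ `*` `](ratr c), (ratr d)[.
pose U : set (measurableTypeR R * measurableTypeR R) :=
  (fun z => h z.1 z.2) @^-1` `]r, +oo[.
rewrite -/U; have -> : U = \bigcup_a \bigcup_b \bigcup_c \bigcup_d
    (if `[< box a b c d `<=` U >] then box a b c d else set0).
  apply/seteqP; split => [z Uz|z]; last first.
    by move=> [a _ [b _ [c _ [d _]]]]; case: asboolP => // bU /bU.
  have oU : open U.
    by move/continuousP : ch; apply; exact: interval_open.
  move: oU; rewrite openE => /(_ z Uz) /nbhs_ballP[e /= e0 eU].
  have lt1 (u : R) : u - e < u by rewrite ltrBlDr ltrDl.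
  have lt2 (u : R) : u < u + e by rewrite ltrDl.
  have [a] := rat_in_itvoo (lt1 z.1); have [b] := rat_in_itvoo (lt2 z.1).
  have [c] := rat_in_itvoo (lt1 z.2); have [d] := rat_in_itvoo (lt2 z.2).
  rewrite !in_itv/= => /andP[d1 d2] /andP[c1 c2] /andP[b1 b2] /andP[a1 a2].
  exists a => //; exists b => //; exists c => //; exists d => //.
  case: asboolP; first by move=> _; split; rewrite /= in_itv/=; apply/andP.
  case=> w [/=]; rewrite !in_itv/= => /andP[w1 w2] /andP[w3 w4].
  by apply: eU; split; rewrite /ball/= ltr_norml; apply/andP; split; lra.
do 4 (apply: bigcupT_measurable_rat => ?).
by case: asboolP => // _; apply: measurableX; exact: measurable_itv.
Qed.

Lemma segint_EFin a b f : continuous f ->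
  (segint a b f)%:E = (\int[mu]_(x in `[a, b]) (f x)%:E)%E.
Proof.
move=> cf; rewrite /segint /Rintegral fineK//.
apply: integral_fune_fin_num => //; exact: integrable_segment.
Qed.

Lemma rectint_EFin a b c d h : c <= d -> continuous2 h ->
  (rectint a b c d h)%:E =
  (\int[mu]_(x in `[a, b]) \int[mu]_(y in `[c, d]) (h x y)%:E)%E.
Proof.
move=> cd ch; rewrite /rectint segint_EFin; last exact: continuous_segint.
by apply: eq_integral => x _; rewrite segint_EFin//; exact: continuous2_row.
Qed.

Let patch a b c d h : measurableTypeR R * measurableTypeR R -> \bar R :=
  (fun z => (h z.1 z.2)%:E) \_ (`[a, b] `*` `[c, d]).

Let patch_ge0 a b c d h z : (forall x y, 0 <= h x y) -> (0 <= patch a b c d h z)%E.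
Proof. by move=> h0; rewrite /patch patchE; case: ifP => // _; rewrite lee_fin. Qed.

Let patch_measurable a b c d h : continuous2 h ->
  measurable_fun setT (patch a b c d h).
Proof.
move=> ch; apply/(measurable_restrictT _ _).1 => //.
  by apply: measurableX; exact: measurable_itv.
by apply: measurable_funTS; apply/measurable_EFinP; exact: continuous2_measurable.
Qed.

Let patch_row a b c d h : (forall x y, 0 <= h x y) ->
  (\int[mu]_x \int[mu]_y patch a b c d h (x, y))%E =
  (\int[mu]_(x in `[a, b]) \int[mu]_(y in `[c, d]) (h x y)%:E)%E.
Proof.
move=> h0; rewrite [RHS]integral_mkcond; apply: eq_integral => x _.
rewrite patchE; case: ifPn => xab.
  rewrite [RHS]integral_mkcond; apply: eq_integral => y _.
  rewrite /patch !patchE; congr (if _ then _ else _).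
  by apply/idP/idP; rewrite !inE/=; [case|move: xab; rewrite inE].
apply: integral0_eq => y _; rewrite /patch patchE; case: ifPn => //.
by rewrite inE => -[/= xab' _]; move: xab; rewrite notin_setE => /(_ xab').
Qed.

Lemma rectint_swap a b c d h : a <= b -> c <= d -> continuous2 h ->
  (forall x y, 0 <= h x y) ->
  rectint a b c d h = rectint c d a b (fun y x => h x y).
Proof.
move=> ab cd ch h0; apply: EFin_inj.
have ch' : continuous2 (fun y x => h x y).
  by apply: continuous2_comp2 => //; [exact: continuous2_snd|exact: continuous2_fst].
rewrite [LHS](rectint_EFin a b cd ch) [RHS](rectint_EFin c d ab ch').
rewrite -[LHS](patch_row _ _ _ _ h0) -[RHS](patch_row _ _ _ _ (fun y x => h0 x y)).
rewrite [LHS](fubini_tonelli (patch a b c d h)).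
- apply: eq_integral => y _; apply: eq_integral => x _.
  rewrite /patch !patchE; congr (if _ then _ else _).
  by apply/idP/idP; rewrite !inE /= => -[].
- exact: patch_measurable.
- by move=> z; exact: patch_ge0.
Qed.

Lemma rectint_prod a b c d h : c <= d -> continuous2 h ->
  (forall x y, 0 <= h x y) ->
  (rectint a b c d h)%:E =
  (\int[(mu \x mu)%E]_(z in `[a, b] `*` `[c, d]) (h z.1 z.2)%:E)%E.
Proof.
move=> cd ch h0.
transitivity (\int[(mu \x mu)%E]_z patch a b c d h z)%E; last first.
  by rewrite [RHS]integral_mkcond.
rewrite rectint_EFin// -patch_row// fubini_tonelli1//.
- exact: patch_measurable.
- by move=> z; exact: patch_ge0.
Qed.

(** Read off the definition of the integral as a supremum over simple functions below the integrand,
    so that it applies to a density [G] of which only nonnegativity is known. *)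
Lemma ge0_integral_mono dT (T : measurableType dT) (nu : {measure set T -> \bar R})
    (A B : set T) (f g : T -> \bar R) : A `<=` B ->
  (forall x : T, A x -> (0 <= f x)%E) -> (forall x : T, B x -> (0 <= g x)%E) ->
  (forall x : T, A x -> (f x <= g x)%E) ->
  (\int[nu]_(x in A) f x <= \int[nu]_(x in B) g x)%E.
Proof.
move=> AB f0 g0 fg; rewrite !ge0_integralE//.
apply: le_ereal_sup => _ [h hf <-]; exists h => // x; apply: le_trans (hf x) _.
rewrite !patchE; case: ifPn => xA.
  by rewrite ifT; [apply: fg; rewrite inE in xA|rewrite inE; apply: AB; rewrite inE in xA].
by case: ifPn => // xB; apply: g0; rewrite inE in xB.
Qed.

Lemma segint_subst_incr F F' a b g : a <= b ->
  {homo F : x y / x < y} -> (forall x, is_derive x 1 F (F' x)) -> continuous F' ->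
  continuous g ->
  segint (F a) (F b) g = segint a b (fun x => g (F x) * F' x).
Proof.
move=> ab Fi dF cF' cg.
have cF : continuous F.
  move=> x; apply/differentiable_continuous/derivable1_diffP.
  exact: (@ex_derive _ _ _ _ _ _ _ (dF x)).
have F'E : derive1 F = F' by apply/funext => x; rewrite derive1E derive_val.
have cFF : continuous (fun x => g (F x) * F' x).
  by move=> x; apply: cvgM; [exact: (continuous_comp (cF x) (cg (F x)))|exact: cF'].
apply: EFin_inj; rewrite !segint_EFin//.
rewrite integration_by_substitution_increasing ?F'E//.
- by move=> x y _ _; exact: Fi.
- apply: (cvgP (F' a)); apply: cvg_at_right_filter; exact: cF'.
- apply: (cvgP (F' b)); apply: cvg_at_left_filter; exact: cF'.
- split; first by move=> x _; exact: (@ex_derive _ _ _ _ _ _ _ (dF x)).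
    by apply: cvg_at_right_filter; exact: cF.
  by apply: cvg_at_left_filter; exact: cF.
- exact: continuous_subspaceT.
Qed.

Lemma segint_oppr a b f : a <= b -> continuous f ->
  segint a b f = segint (- b) (- a) (fun x => f (- x)).
Proof.
move=> ab cf.
have cf' : continuous (fun x => f (- x)).
  by move=> x; apply: (@continuous_comp _ _ _ -%R f); [exact: oppr_continuous|exact: cf].
apply: EFin_inj; rewrite !segint_EFin//.
rewrite integration_by_substitution_oppr//; last exact: continuous_subspaceT.
by apply: eq_integral => x _ /=; rewrite opprK.
Qed.

End Polar.

(** * From log-polar to Cartesian coordinates by one-dimensional substitutions *)

Section Polar_coordinates.
Variable R : realType.
Implicit Types (f g F : R -> R) (h H : R -> R -> R) (a b c d m r x y t : R).

Lemma cos_atan_bound x : `|x| <= 1 -> 1 / 2 <= cos (atan x) <= 1.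
Proof.
move=> x1; rewrite cos_le1 andbT cos_atan -[1 / 2]invrK lef_pV2 ?posrE ?invr_gt0//; last first.
  by rewrite sqrtr_gt0 ltr_wpDr// sqr_ge0.
have x2 : x ^+ 2 <= 1 by rewrite -real_normK ?num_real// expr_le1.
rewrite -[leRHS]ger0_norm ?invr_ge0// -sqrtr_sqr ler_wsqrtr//; lra.
Qed.

Lemma sin_atan x : sin (atan x) = cos (atan x) * x.
Proof.
have c0 : cos (atan x) != 0.
  by rewrite cos_atan invr_neq0// sqrtr_eq0 -ltNge ltr_wpDr// sqr_ge0.
by rewrite -[X in _ = _ * X]atanK /tan mulrC divfK.
Qed.

Lemma continuous_atan_comp f : continuous f -> continuous (fun x => f (atan x)).
Proof.
by move=> cf x; apply: continuous_comp; [exact: continuous_atan|exact: cf].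
Qed.

Let polar_comp H x t : R := H (complex.Re (log_polar x t)) (complex.Im (log_polar x t)).

Let continuous2_polar_comp H : continuous2 H -> continuous2 (polar_comp H).
Proof.
move=> cH; apply: continuous2_comp2 => //.
  exact: continuous2_log_polar_Re.
exact: continuous2_log_polar_Im.
Qed.

(** The slope replaces the angle; its Jacobian 1 / (1 + t^2) is at most 1. *)
Let sector_tan H x1 x2 : continuous2 H -> (forall x y, 0 <= H x y) ->
  rectint x1 x2 (- (pi / 4)) (pi / 4) (polar_comp H) <=
  rectint x1 x2 (- 1) 1
    (fun x t => H (expR (- x) * cos (atan t)) (expR (- x) * cos (atan t) * t)).
Proof.
move=> cH H0; have cP := continuous2_polar_comp cH.
have pi4 : - (pi / 4) <= pi / 4 :> R by have := @pi_ge0 R; lra.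
have cE : continuous2 (fun x t : R => polar_comp H x (atan t)).
  apply: continuous2_comp2 => //; first exact: continuous2_fst.
  apply: (@continuous2_comp _ (@atan R)); last exact: continuous2_snd.
  by move=> x; exact: continuous_atan.
rewrite (_ : (fun x t => H _ _) = (fun x t => polar_comp H x (atan t))); last first.
  by apply/funext => x; apply/funext => t; rewrite /polar_comp /= sin_atan mulrA.
apply: le_segint; try exact: continuous_segint.
move=> x _.
have ci : continuous (fun t : R => (1 + t ^+ 2)^-1).
  move=> t; apply: cvgV; first by rewrite gt_eqF// ltr_wpDr// sqr_ge0.
  by apply: cvgD; [exact: cvg_cst|exact: exprn_continuous].
have E := @segint_subst_incr R (@atan R) (fun t => (1 + t ^+ 2)^-1) (- 1) 1
  (polar_comp H x) ltac:(lra) (@lt_atan R) (@is_derive1_atan R) ci (@continuous2_row R _ x cP).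
rewrite atanN atan1 in E; rewrite E.
apply: le_segint.
- move=> t; apply: cvgM; last exact: ci.
  by apply: continuous_atan_comp; exact: continuous2_row.
- by apply: continuous_atan_comp; exact: continuous2_row.
move=> t _; rewrite ler_piMr ?H0// invf_le1 ?ltr_wpDr ?sqr_ge0//.
by rewrite lerDl sqr_ge0.
Qed.

(** Along the ray of slope t the abscissa u = exp (- x) cos (atan t) replaces x, with |dx| = du / u.
    As x <= 1 and the cosine is at least 1/2, u >= 1/8. *)
Let sector_exp H x1 x2 t : 0 <= x1 -> x1 <= x2 -> x2 <= 1 -> `|t| <= 1 ->
  continuous2 H -> (forall x y, 0 <= H x y) ->
  segint x1 x2
    (fun x => H (expR (- x) * cos (atan t)) (expR (- x) * cos (atan t) * t)) <=
  segint (1 / 8) 1 (fun x => 8 * H x (x * t)).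
Proof.
move=> x10 x12 x21 t1 cH H0; set k := cos (atan t).
have /andP[k1 k2] : 1 / 2 <= k <= 1 by exact: cos_atan_bound.
have cHt : continuous (fun x => H x (x * t)).
  have : continuous2 (fun x _ : R => H x (x * t)).
    apply: continuous2_comp2 => //; first exact: continuous2_fst.
    by apply: continuous2M; [exact: continuous2_fst|exact: continuous2_cst].
  by move=> c x; exact (@continuous2_col R (fun x _ => H x (x * t)) 0 c x).
have cmx : continuous (fun x : R => Num.max x (1 / 8)).
  apply: (continuous_minmax (f := fun x => x) (g := fun=> 1 / 8) _ _).2 => y.
    exact: cvg_id.
  exact: cvg_cst.
have cm : continuous (fun x : R => (Num.max x (1 / 8))^-1).
  move=> x; apply: cvgV; first by rewrite gt_eqF// lt_max divr_gt0// orbT.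
  exact: cmx.
(* The clamp at 1/8 makes the Jacobian globally continuous and is inactive on the range of
   integration. *)
pose g x := H x (x * t) * (Num.max x (1 / 8))^-1.
have cg : continuous g by move=> x; apply: cvgM; [exact: cHt|exact: cm].
pose F x : R := expR x * k.
have cF : continuous F.
  by move=> x; apply: cvgM; [exact: continuous_expR|exact: cvg_cst].
have dF x : is_derive x 1 F (F x).
  have := is_deriveM (is_derive_expR x) (is_derive_cst k x 1).
  rewrite (_ : _ + _ = F x)//.
  by rewrite scaler0 add0r [RHS]mulrC.
have Fi : {homo F : x y / x < y}.
  by move=> x y xy; rewrite /F ltr_pM2r ?ltr_expR//; lra.
have E := segint_subst_incr (_ : - x2 <= - x1) Fi dF cF cg.
have {}E := E ltac:(lra).
have eN1 : 1 / 4 <= expR (- 1) :> R.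
  rewrite (_ : -1 = - (1 / 2) + - (1 / 2) :> R); last by field.
  rewrite expRD (_ : 1 / 4 = 1 / 2 * (1 / 2)); last by field.
  have h := @expR_ge1Dx R (- (1 / 2)).
  by apply: ler_pM; lra.
have F1 : 1 / 8 <= F (- x2).
  rewrite [leLHS](_ : _ = 1 / 4 * (1 / 2)); last by field.
  apply: ler_pM => //; try by rewrite divr_ge0.
  by rewrite (le_trans eN1)// ler_expR lerN2.
have F2 : F (- x1) <= 1.
  rewrite /F mulr_ile1 ?expR_ge0//; first by lra.
  by rewrite -[leRHS]expR0 ler_expR oppr_le0.
rewrite segint_oppr//; last first.
  move=> x; have : continuous2 (fun x _ : R => H (expR (- x) * k) (expR (- x) * k * t)).
    have ce : continuous2 (fun x _ : R => expR (- x) * k).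
      apply: continuous2M; last exact: continuous2_cst.
      apply: continuous2_comp; first exact: continuous_expR.
      by apply: continuous2N; exact: continuous2_fst.
    by apply: continuous2_comp2 => //; apply: continuous2M => //; exact: continuous2_cst.
  by move=> c; exact (@continuous2_col R (fun x _ => H (expR (- x) * k) (expR (- x) * k * t)) 0 c x).
rewrite (@eq_segint _ _ _ _ (fun x => g (F x) * F x)); last first.
  move=> x /andP[xl xr]; rewrite opprK /g -/(F x).
  have Fx : 1 / 8 <= F x.
    by rewrite (le_trans F1)// /F ler_wpM2r ?ler_expR//; lra.
  by rewrite max_l// -mulrA mulVf ?mulr1// gt_eqF//; lra.
rewrite -E.
apply: (@le_trans _ _ (segint (1 / 8) 1 g)).
  apply: segint_sub => //; first by apply: ltW_homo Fi _ _ _; lra.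
  by move=> x _; rewrite /g mulr_ge0 ?H0// invr_ge0 le_max divr_ge0 ?orbT.
apply: le_segint => //.
  by move=> x; apply: cvgM; [exact: cvg_cst|exact: cHt].
move=> x /andP[x8 _]; rewrite /g max_l// mulrC ler_wpM2r ?H0//.
by rewrite -[leRHS]invrK lef_pV2 ?posrE ?invr_gt0//; lra.
Qed.

(** One factor 8 is the Jacobian along the rays; the other comes from passing from the slope to the
    ordinate y = x t, again with x >= 1/8. *)
Lemma sector_le H x1 x2 : 0 <= x1 -> x1 <= x2 -> x2 <= 1 ->
  continuous2 H -> (forall x y, 0 <= H x y) ->
  rectint x1 x2 (- (pi / 4)) (pi / 4) (polar_comp H) <=
  64 * rectint (- 1) 1 (- 1) 1 H.
Proof.
move=> x10 x12 x21 cH H0.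
apply: (le_trans (sector_tan x1 x2 cH H0)).
have cE : continuous2 (fun x t : R => expR (- x) * cos (atan t)).
  apply: continuous2M.
    apply: continuous2_comp; first exact: continuous_expR.
    by apply: continuous2N; exact: continuous2_fst.
  apply: (@continuous2_comp _ (fun t => cos (atan t))); last exact: continuous2_snd.
  by apply: continuous_atan_comp; exact: continuous_cos.
have cK : continuous2 (fun x t =>
    H (expR (- x) * cos (atan t)) (expR (- x) * cos (atan t) * t)).
  by apply: continuous2_comp2 => //; apply: continuous2M => //; exact: continuous2_snd.
have c1 : -1 <= 1 :> R by lra.
have c2 : 1 / 8 <= 1 :> R by lra.
rewrite rectint_swap//.
have cHt : continuous2 (fun t x => H x (x * t)).
  apply: continuous2_comp2 => //; first exact: continuous2_snd.
  by apply: continuous2M; [exact: continuous2_snd|exact: continuous2_fst].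
apply: (@le_trans _ _ (rectint (- 1) 1 (1 / 8) 1 (fun t x => 8 * H x (x * t)))).
  apply: le_segint.
  - apply: continuous_segint => //.
    by apply: (continuous2_comp2 cK); [exact: continuous2_snd|exact: continuous2_fst].
  - apply: continuous_segint => //.
    by apply: continuous2M => //; exact: continuous2_cst.
  by move=> t tt; apply: sector_exp => //; rewrite ler_norml.
rewrite (rectintZ (-1) 1 c2 _ cHt) (rectint_swap c1 c2 cHt (fun _ _ => H0 _ _)).
rewrite (_ : 64 * _ = 8 * (8 * rectint (- 1) 1 (- 1) 1 H)); last by ring.
rewrite ler_pM2l ?ltr0n//.
have cHt' : continuous2 (fun x t => H x (x * t)).
  apply: continuous2_comp2 => //; first exact: continuous2_fst.
  by apply: continuous2M; [exact: continuous2_fst|exact: continuous2_snd].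
apply: (@le_trans _ _ (rectint (1 / 8) 1 (- 1) 1 (fun x t => 8 * H x t))); last first.
  rewrite (rectintZ (1 / 8) 1 c1)// ler_pM2l ?ltr0n//.
  apply: segint_sub => //; [lra|exact: continuous_segint|].
  by move=> x _; apply: segint_ge0 => t _; exact: H0.
apply: le_segint.
- exact: continuous_segint.
- by apply: continuous_segint => //; apply: continuous2M => //; exact: continuous2_cst.
move=> x /andP[x8 x1']; have x0 : 0 < x by lra.
have := segint_affine 0 c1 x0 (@continuous2_row R _ x cH).
rewrite mulN1r mul1r !addr0 => E.
rewrite (@eq_segint _ _ _ _ (fun t => H x (t * x + 0))); last first.
  by move=> t _; rewrite addr0 mulrC.
rewrite -(@ler_pM2l _ x)// -E segintZ; last exact: continuous2_row.
apply: (@le_trans _ _ (segint (- 1) 1 (H x))).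
  apply: segint_sub => //; try lra; first exact: continuous2_row.
rewrite mulrA ler_peMl//; last by lra.
by apply: segint_ge0 => t _; exact: H0.
Qed.

Let rot H (x y : R) := H (- y) x.

Let rect_rot H : continuous2 H -> (forall x y, 0 <= H x y) ->
  rectint (- 1) 1 (- 1) 1 (rot H) = rectint (- 1) 1 (- 1) 1 H.
Proof.
move=> cH H0; have c1 : -1 <= 1 :> R by lra.
rewrite [RHS](rectint_swap c1 c1 cH H0); apply: eq_segint => x _.
rewrite [RHS]segint_oppr ?opprK//.
by move=> y; exact (@continuous2_col R _ x cH y).
Qed.

Let rot_cont H : continuous2 H -> continuous2 (rot H).
Proof.
move=> cH; apply: (continuous2_comp2 cH); last exact: continuous2_fst.
by apply: continuous2N; exact: continuous2_snd.
Qed.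

(** The full circle is cut into four sectors, which quarter turns carry to |t| <= pi / 4; the square
    is invariant under these turns. *)
Lemma polar_rect H x1 x2 : 0 <= x1 -> x1 <= x2 -> x2 <= 1 ->
  continuous2 H -> (forall x y, 0 <= H x y) ->
  rectint x1 x2 0 (2 * pi) (polar_comp H) <= 256 * rectint (- 1) 1 (- 1) 1 H.
Proof.
move=> x10 x12 x21 cH H0; have pi0 := @pi_gt0 R.
have cP := continuous2_polar_comp cH.
have itc k : continuous2 (iter k rot H).
  by elim: k => [|k ih] //=; exact: rot_cont.
have it0 k x y : 0 <= iter k rot H x y.
  by elim: k x y => [|k ih] x y //=; exact: ih.
have itQ k : rectint (- 1) 1 (- 1) 1 (iter k rot H) = rectint (- 1) 1 (- 1) 1 H.
  elim: k => [|k ih]; first by [].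
  by rewrite iterS (rect_rot (itc k) (it0 k)).
have rotE G x t : polar_comp G x (t + pi / 2) = polar_comp (rot G) x t.
  by rewrite /polar_comp /rot /= cosDpihalf sinDpihalf mulrN.
have rowE x : segint 0 (2 * pi) (polar_comp H x) =
    \sum_(k < 4) segint (- (pi / 4)) (pi / 4) (polar_comp (iter k rot H) x).
  have p20 : 0 < 2 * pi :> R by lra.
  have cr k : continuous (polar_comp (iter k rot H) x).
    by apply: continuous2_row; exact: continuous2_polar_comp.
  have E := segint_periodic (- (pi / 4)) p20 (cr 0%N).
  rewrite -[LHS]E; last by move=> t; rewrite /polar_comp log_polar_periodic.
  rewrite segint_shift ?(ltW p20)// add0r.
  have step k b : - (pi / 4) <= b ->
      segint (- (pi / 4)) (b + pi / 2) (polar_comp (iter k rot H) x) =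
      segint (- (pi / 4)) (pi / 4) (polar_comp (iter k rot H) x) +
      segint (- (pi / 4)) b (polar_comp (iter k.+1 rot H) x).
    move=> b0; rewrite (@segint_cat _ _ _ (pi / 4))//; try lra; congr (_ + _).
    rewrite [X in segint X](_ : _ = - (pi / 4) + pi / 2); last by field.
    by rewrite -segint_shift//; apply: eq_segint => t _; rewrite rotE.
  have -> : 2 * pi + - (pi / 4) = pi / 4 + pi / 2 + pi / 2 + pi / 2 :> R by field.
  rewrite !step; try lra.
  by rewrite !big_ord_recr big_ord0 /= add0r !addrA.
rewrite /rectint (eq_segint (fun x _ => rowE x)).
have cS k : continuous (fun x => segint (- (pi / 4)) (pi / 4) (polar_comp (iter k rot H) x)).
  by apply: continuous_segint; [lra|exact: continuous2_polar_comp].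
rewrite segint_sumr//.
have -> : 256 * segint (- 1) 1 (fun x => segint (- 1) 1 (H x)) =
    \sum_(k < 4) 64 * rectint (- 1) 1 (- 1) 1 H.
  by rewrite sumr_const card_ord -mulr_natr -/(rectint (- 1) 1 (- 1) 1 H); ring.
by apply: ler_sum => k _; rewrite -(itQ k); exact: sector_le.
Qed.

Lemma polar_disc H (G : R[i] -> R) x1 x2 : 0 <= x1 -> x1 <= x2 -> x2 <= 1 ->
  continuous2 H -> (forall x y, 0 <= H x y) -> (forall z, 0 <= G z) ->
  (forall x y, cabs (x +i* y) < 1 -> H x y <= G (x +i* y)) ->
  (forall x y, 1 <= cabs (x +i* y) -> H x y = 0) ->
  ((rectint x1 x2 0 (2 * pi) (fun x t =>
     H (complex.Re (log_polar x t)) (complex.Im (log_polar x t))))%:E <=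
   256%:E * disc_int G)%E.
Proof.
move=> x10 x12 x21 cH H0 G0 HG H1.
apply: (@le_trans _ _ (256 * rectint (- 1) 1 (- 1) 1 H)%:E).
  by rewrite lee_fin; exact: polar_rect.
rewrite EFinM; apply: lee_wpmul2l; first by rewrite lee_fin ler0n.
rewrite rectint_prod//.
rewrite /disc_int [leRHS]integral_mkcond.
apply: ge0_integral_mono => //.
- by move=> z _; rewrite lee_fin.
- by move=> z _; rewrite patchE; case: ifP => // _; rewrite lee_fin.
move=> z _; rewrite patchE; case: ifPn => [|]; last first.
  by rewrite notin_setE /unit_disc/= => /negP; rewrite -leNgt => /H1 ->.
by rewrite inE /unit_disc/= lee_fin; exact: HG.
Qed.

End Polar_coordinates.

(** * Bounds by the norm *)

Section Distance.
Variable R : realType.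
Implicit Types (x y t s : R) (z w : R[i]) (f : R[i] -> R[i]).
Variable E : set R[i].
Hypotheses (E_circle : E `<=` @unit_circle R) (E_neq0 : E !=set0).

Lemma dist_set_le z w : E w -> dist_set z E <= cabs (z - w).
Proof.
move=> Ew; apply: ge_inf; last by exists w.
by exists 0 => _ [v _ <-]; exact: cabs_ge0.
Qed.

Lemma dist_set_ge z r : (forall w, E w -> r <= cabs (z - w)) -> r <= dist_set z E.
Proof.
move=> h; apply: lb_le_inf; first by have [w Ew] := E_neq0; exists (cabs (z - w)), w.
by move=> _ [w Ew <-]; exact: h.
Qed.

Lemma dist_set_ge0 z : 0 <= dist_set z E.
Proof. by apply: dist_set_ge => w _; exact: cabs_ge0. Qed.

Lemma dist_set_lip z w : `|dist_set z E - dist_set w E| <= cabs (z - w).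
Proof.
have h u v : dist_set u E - cabs (u - v) <= dist_set v E.
  apply: dist_set_ge => e Ee; rewrite lerBlDr (le_trans (dist_set_le u Ee))//.
  by rewrite [leRHS]addrC; apply: le_trans (cabsD _ _); rewrite addrA subrK.
have h1 := h z w; have h2 := h w z; rewrite cabs_sym in h2.
by rewrite ler_norml; apply/andP; split; lra.
Qed.

Lemma dist_set_circle z : 1 - cabs z <= dist_set z E.
Proof.
apply: dist_set_ge => w /E_circle; rewrite /unit_circle/= => w1.
by have := cabs_dist z w; rewrite w1 => /ler_normlP[]; lra.
Qed.

Lemma dist_set_le2 z : cabs z <= 1 -> dist_set z E <= 2.
Proof.
move=> z1; have [w Ew] := E_neq0.
apply: (le_trans (dist_set_le z Ew)); apply: (le_trans (cabsB _ _)).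
by rewrite (E_circle Ew); lra.
Qed.

Lemma circle_pt_lip t s : cabs (circle_pt 1 t - circle_pt 1 s) <= `|t - s|.
Proof.
rewrite -[leRHS]ger0_norm// -sqrtr_sqr real_normK ?num_real// ler_wsqrtr//= !mul1r.
have -> : (cos t - cos s) ^+ 2 + (sin t - sin s) ^+ 2 =
    (cos t ^+ 2 + sin t ^+ 2) + (cos s ^+ 2 + sin s ^+ 2) -
    2 * (cos t * cos s + sin t * sin s) by ring.
rewrite !cos2Dsin2 -cosB.
have -> : t - s = (t - s) / 2 *+ 2 by rewrite -mulr_natr divfK.
rewrite cos_mulr2n; set u := (t - s) / 2.
have : sin u ^+ 2 <= u ^+ 2.
  by rewrite -ler_sqrt ?sqr_ge0// !sqrtr_sqr; exact: sin_le_norm.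
rewrite cos2sin2 !mulr2n; nra.
Qed.

(** Clamping x at 0 makes the bounds and the Lipschitz property hold for all real x. *)
Definition polar_dist x t : R := dist_set (log_polar (Num.max x 0) t) E.

Lemma expRN_lip x y : 0 <= x -> 0 <= y -> `|expR (- x) - expR (- y)| <= `|x - y|.
Proof.
wlog xy : x y / x <= y => [H|] x0 y0.
  by have [/H|/ltW/H] := leP x y; [exact|rewrite distrC (distrC x); exact].
rewrite ger0_norm; last by rewrite subr_ge0 ler_expR lerN2.
rewrite distrC (ger0_norm (_ : 0 <= y - x)); last by rewrite subr_ge0.
have -> : expR (- y) = expR (- x) * expR (- (y - x)) by rewrite -expRD; congr expR; ring.
rewrite -{1}[expR (- x)]mulr1 -mulrBr.
have h1 : expR (- x) <= 1 by rewrite -expR0 ler_expR oppr_le0.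
have h2 := expR_ge1Dx (- (y - x)); have h3 := expR_gt0 (- x).
have h4 : expR (- (y - x)) <= 1 by rewrite -expR0 ler_expR; lra.
apply: (@le_trans _ _ (1 - expR (- (y - x)))); last by lra.
by apply: ler_piMl => //; lra.
Qed.

Lemma log_polar_lip x t y s : 0 <= x -> 0 <= y ->
  cabs (log_polar x t - log_polar y s) <= `|x - y| + `|t - s|.
Proof.
move=> x0 y0.
have -> : log_polar x t - log_polar y s =
    (expR (- x) - expR (- y))%:C * circle_pt 1 t +
    (expR (- y))%:C * (circle_pt 1 t - circle_pt 1 s).
  rewrite /log_polar /circle_pt; apply/eqP; rewrite eq_complex /=.
  by apply/andP; split; apply/eqP; ring.
apply: (le_trans (cabsD _ _)); rewrite !cabsM !cabs_real cabs_circle_pt normr1 mulr1.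
apply: lerD; first exact: expRN_lip.
apply: le_trans (circle_pt_lip t s); rewrite ger0_norm ?expR_ge0//.
by apply: ler_piMl; [exact: cabs_ge0|rewrite -expR0 ler_expR oppr_le0].
Qed.

Lemma polar_dist_lip x t y s :
  `|polar_dist x t - polar_dist y s| <= `|x - y| + `|t - s|.
Proof.
apply: (le_trans (dist_set_lip _ _)).
apply: (@le_trans _ _ (`|Num.max x 0 - Num.max y 0| + `|t - s|)).
  by apply: log_polar_lip; rewrite le_max lexx orbT.
rewrite lerD2r; have [x0|x0] := leP x 0; have [y0|y0] := leP y 0 => //.
- by rewrite subrr normr0.
- by rewrite sub0r normrN distrC !ger0_norm; lra.
- by rewrite subr0 !ger0_norm; lra.
Qed.

Lemma polar_dist_ge0 x t : 0 <= polar_dist x t.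
Proof. exact: dist_set_ge0. Qed.

Lemma polar_dist_le2 x t : polar_dist x t <= 2.
Proof.
apply: dist_set_le2; rewrite cabs_log_polar -expR0 ler_expR oppr_le0.
by rewrite le_max lexx orbT.
Qed.

Lemma polar_dist_periodic x t : polar_dist x (t + 2 * pi) = polar_dist x t.
Proof. by rewrite /polar_dist log_polar_periodic. Qed.

Lemma expRN_half x : 0 <= x -> x <= 1 -> x / 2 <= 1 - expR (- x).
Proof.
move=> x0 x1; have h := expR_ge1Dx x.
have h2 : expR (- x) * expR x = 1 by rewrite -expRD addNr expR0.
have h3 := expR_gt0 (- x); nra.
Qed.

Lemma polar_dist_ge x t : 0 <= x -> x <= 1 -> x / 2 <= polar_dist x t.
Proof.
move=> x0 x1; apply: le_trans (dist_set_circle _).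
by rewrite cabs_log_polar max_l//; exact: expRN_half.
Qed.

End Distance.

(** * Integrals over log-polar rectangles against area integrals of the norm *)

Section Disc_bound.
Variable R : realType.
Implicit Types (x y t s al be : R) (z w : R[i]) (f : R[i] -> R[i]).
Variable E : set R[i].
Hypotheses (E_circle : E `<=` @unit_circle R) (E_neq0 : E !=set0).

Lemma eq_continuous2 (h k : R -> R -> R) : (forall x y, h x y = k x y) ->
  continuous2 h -> continuous2 k.
Proof.
by move=> hk; rewrite (_ : h = k)//; apply/funext => x; apply/funext => y; exact: hk.
Qed.

(** Exponents p - 1 and q give the integrand of [term_pos]; exponents 0 and q - 1 give the first
    area integrand of [term_zero]. *)
Definition disc_density s al be f z : R :=
  (1 - cabs z) `^ al * dist_set (s%:C * z) E `^ be * logp (cabs (f (s%:C * z))).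

Lemma disc_density_ge0 s al be f z : 0 <= disc_density s al be f z.
Proof. by rewrite !mulr_ge0 ?powR_ge0 ?logp_ge0. Qed.

(* Multiplying the density by a radial cutoff and precomposing it with a radial
   retraction gives a globally continuous function, to which the comparison of
   polar and Cartesian integrals applies. *)
Lemma disc_bound sg x1 x2 K al be f (F : R -> R -> R) : 0 < sg -> sg <= x1 ->
  x1 <= x2 -> x2 <= 1 -> 0 <= K -> (forall z, cabs z < 1 -> cderivable f z) ->
  continuous2 F ->
  (forall x t, x1 <= x <= x2 ->
     F x t <= K * disc_density (expR (- sg)) al be f (log_polar x t)) ->
  ((rectint x1 x2 0 (2 * pi) F)%:E <=
   (256 * K)%:E * disc_int (disc_density (expR (- sg)) al be f))%E.
Proof.
move=> sg0 sgx x12 x21 K0 df cF FK; set s := expR (- sg) in FK *.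
have s0 : 0 < s by exact: expR_gt0.
have s1 : s < 1 by rewrite -expR0 ltr_expR oppr_lt0.
pose r := (1 + s) / 2; have r0 : 0 < r by rewrite /r; lra.
have sr : s < r by rewrite /r; lra.
have r1 : r < 1 by rewrite /r; lra.
(* The lower bound r / 2 only avoids dividing by 0; [k] is 1 whenever the modulus is at most r. *)
pose m (x y : R) := Num.max (cabs (x +i* y)) (r / 2).
pose k (x y : R) := Num.min 1 (r / m x y).
pose rho (x y : R) : R[i] := (k x y * x) +i* (k x y * y).
have m0 x y : 0 < m x y by rewrite lt_max divr_gt0// orbT.
have rhoE x y : rho x y = (k x y)%:C * (x +i* y).
  by rewrite /rho; apply/eqP; rewrite eq_complex /= !mul0r subr0 addr0 !eqxx.
have k0 x y : 0 <= k x y by rewrite le_min ler01 divr_ge0// ltW.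
have rho1 x y : cabs (rho x y) <= r.
  rewrite rhoE cabsM cabs_real ger0_norm//.
  apply: (@le_trans _ _ (r / m x y * m x y)); last by rewrite divfK// gt_eqF.
  by apply: ler_pM; rewrite ?cabs_ge0// ?ge_min ?lexx ?orbT// /m le_max lexx.
have rhoid x y : cabs (x +i* y) <= r -> rho x y = x +i* y.
  move=> zr; have kE : k x y = 1.
    rewrite /k min_l// ler_pdivlMr// mul1r /m ge_max zr/=; lra.
  by rewrite /rho kE !mul1r.
have cabsxy : continuous2 (fun x y : R => cabs (x +i* y)).
  have [//|||_ _ //] := @continuous2_cabs_comp R id (fun x y => x +i* y).
  - by move=> x y; exact: cderivable_id.
  - exact: continuous2_fst.
  - exact: continuous2_snd.
have cm : continuous2 m by apply: continuous2_max => //; exact: continuous2_cst.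
have ck : continuous2 k.
  have -> : k = fun x y => Num.min 1 (r / m x y) by [].
  apply: (@continuous2_comp _ (fun u : R => Num.min 1 u)).
    by apply: (continuous_minmax (f := fun=> 1) (g := fun x => x) _ _).1 => u;
      [exact: cvg_cst|exact: cvg_id].
  apply: continuous2M; first exact: continuous2_cst.
  have -> : (fun x y => (m x y)^-1) = (fun x y => m x y `^ (-1)).
    by apply/funext => x; apply/funext => y; rewrite powR_inv1// ltW.
  exact: continuous2_powR.
have cr1 : continuous2 (fun x y => complex.Re (rho x y)).
  by apply: continuous2M => //; exact: continuous2_fst.
have cr2 : continuous2 (fun x y => complex.Im (rho x y)).
  by apply: continuous2M => //; exact: continuous2_snd.
have crho : continuous2 (fun x y => cabs (rho x y)).
  have [//|||_ _ //] := @continuous2_cabs_comp R id rho => // x y.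
  exact: cderivable_id.
have srho x y : cabs (s%:C * rho x y) < 1.
  rewrite cabsM cabs_real (ger0_norm (ltW s0)).
  by rewrite mulr_ilt1 ?cabs_ge0 ?ltW// (le_lt_trans (rho1 _ _)).
have cdist : continuous2 (fun x y => dist_set (s%:C * rho x y) E).
  have c1 : continuous2 (fun x y => dist_set (x +i* y) E).
    apply: continuous2_lip => x y x' y'; apply: (le_trans (dist_set_lip E_neq0 _ _)).
    exact: cabs_le_ReIm.
  apply: eq_continuous2 (continuous2_comp2 c1 (continuous2M (@continuous2_cst R s) cr1)
    (continuous2M (@continuous2_cst R s) cr2)) => x y; congr (dist_set _ E).
  by apply/eqP; rewrite eq_complex /= !mul0r subr0 addr0 !eqxx.
have clog : continuous2 (fun x y => logp (cabs (f (s%:C * rho x y)))).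
  have c3 : continuous2 (fun x y => cabs (f (s%:C * rho x y))).
    have [//|||_ _ //] := @continuous2_cabs_comp R f (fun x y => s%:C * rho x y).
    - by move=> x y; apply: df.
    - apply: eq_continuous2 (continuous2M (@continuous2_cst R s) cr1) => x y.
      by rewrite /= mul0r subr0.
    - apply: eq_continuous2 (continuous2M (@continuous2_cst R s) cr2) => x y.
      by rewrite /= mul0r addr0.
  by apply: eq_continuous2 (continuous2_ltrunc (@ltr01 R) c3) => x y; rewrite logpE.
pose chi (u : R) := Num.max 0 (Num.min 1 (- (r - s)^-1 * u + (r - s)^-1 * r)).
have rs0 : 0 < r - s by rewrite subr_gt0.
have cchi : continuous chi.
  apply: (continuous_minmax _ _).2; first by move=> x; exact: cvg_cst.
  apply: (continuous_minmax _ _).1; first by move=> x; exact: cvg_cst.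
  exact: continuous_affine.
have chi0 u : 0 <= chi u by rewrite le_max lexx.
have chi1 u : chi u <= 1 by rewrite ge_max ler01 ge_min lexx.
have chiE u : chi u = Num.max 0 (Num.min 1 ((r - u) / (r - s))).
  by rewrite /chi; congr (Num.max _ (Num.min _ _)); ring.
have chi_in u : u <= s -> chi u = 1.
  by move=> us; rewrite chiE min_l ?max_r// ler_pdivlMr//; lra.
have chi_out u : r <= u -> chi u = 0.
  move=> us; rewrite chiE max_l// ge_min; apply/orP; right.
  by rewrite ler_pdivrMr// mul0r subr_le0.
pose H (x y : R) := chi (cabs (x +i* y)) * disc_density s al be f (rho x y).
have cH : continuous2 H.
  apply: continuous2M; first exact: (continuous2_comp cchi cabsxy).
  apply: continuous2M => //; apply: continuous2M.
    apply: continuous2_powR; last first.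
      by apply: continuous2B => //; exact: continuous2_cst.
    by move=> x y; rewrite subr_gt0 (le_lt_trans (rho1 _ _)).
  apply: continuous2_powR => // x y.
  by apply: lt_le_trans (dist_set_circle E_circle E_neq0 _); rewrite subr_gt0.
have H0 x y : 0 <= H x y by rewrite mulr_ge0// disc_density_ge0.
have KH : rectint x1 x2 0 (2 * pi) F <= K * rectint x1 x2 0 (2 * pi) (fun x t =>
    H (complex.Re (log_polar x t)) (complex.Im (log_polar x t))).
  have pp0 : 0 <= 2 * pi :> R by rewrite mulr_ge0 ?pi_ge0.
  have cHp : continuous2 (fun x t =>
      H (complex.Re (log_polar x t)) (complex.Im (log_polar x t))).
    apply: continuous2_comp2 => //.
      exact: continuous2_log_polar_Re.
    exact: continuous2_log_polar_Im.
  rewrite -(rectintZ x1 x2 pp0)//; apply: le_rectint => //.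
    by apply: continuous2M => //; exact: continuous2_cst.
  move=> x t xx _; have zE : complex.Re (log_polar x t) +i* complex.Im (log_polar x t) =
    log_polar x t by [].
  rewrite /H rhoid zE ?cabs_log_polar; last first.
    by rewrite (le_trans _ (ltW sr))// ler_expR lerN2; case/andP: xx => + _; exact: le_trans.
  rewrite chi_in ?mul1r; first exact: FK.
  by rewrite ler_expR lerN2; case/andP: xx => + _; exact: le_trans.
apply: (@le_trans _ _ (K%:E * (256%:E * disc_int (disc_density s al be f)))%E); last first.
  by rewrite muleA -EFinM mulrC.
apply: (@le_trans _ _ (K%:E * (rectint x1 x2 0 (2 * pi) (fun x t =>
    H (complex.Re (log_polar x t)) (complex.Im (log_polar x t))))%:E)%E).
  by rewrite -EFinM lee_fin.
apply: lee_wpmul2l; first by rewrite lee_fin.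
apply: polar_disc => //.
- by apply: le_trans sgx; exact: ltW.
- by move=> z; exact: disc_density_ge0.
- move=> x y z1; rewrite /H; have [zr|zr] := leP (cabs (x +i* y)) r.
    by rewrite rhoid// ler_piMl// disc_density_ge0.
  by rewrite chi_out ?(ltW zr)// mul0r disc_density_ge0.
- by move=> x y z1; rewrite /H chi_out ?mul0r// (le_trans (ltW r1)).
Qed.

End Disc_bound.

(** * The weighted integral of log^+ |f| against the norm *)

Section Upper_bound.
Variable R : realType.
Implicit Types (x y t s al be c N K : R) (z w : R[i]) (n : nat).
Variables (E : set R[i]) (p q tau : R) (f : R[i] -> R[i]).
Hypotheses (E_circle : E `<=` @unit_circle R) (E_neq0 : E !=set0)
  (p0 : 0 <= p) (q0 : 0 < q) (tau0 : 0 < tau) (tau1 : tau <= 1 / 100)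
  (df : forall z, cabs z < 1 -> cderivable f z).

Notation D := (polar_dist E).
Notation W := (total_weight D p q tau).
Notation Lf x t := (logp (cabs (f (log_polar (Num.max x (tau / 2)) t)))).
Notation I := (fun n x t => W n x t * Lf x t).

Let pp0 : 0 <= 2 * pi :> R. Proof. by rewrite mulr_ge0 ?pi_ge0. Qed.

Lemma continuous2_integrand n : continuous2 (I n).
Proof.
apply: continuous2M.
  by apply: continuous2_total_weight => //; [exact: polar_dist_ge0|exact: polar_dist_lip].
apply: eq_continuous2 (continuous2_log_field tau0 ltr01 df) => x t.
by rewrite logp_field.
Qed.

Let S n x := segint 0 (2 * pi) (I n x).

Let cS n : continuous (S n).
Proof. by apply: continuous_segint => //; exact: continuous2_integrand. Qed.

Let S0 n x : 0 <= x -> x <= tau / 2 -> S n x = 0.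
Proof.
move=> x0 xt; rewrite /S (@eq_segint _ _ _ _ (fun=> 0)); last first.
  by move=> t _; rewrite total_weight_eq0 ?mul0r//; left.
by rewrite segint_cst// mul0r.
Qed.

(** The norm evaluates f at s z. With s = exp (- tau / 4) this is a translation of the depth by tau
    / 4, which explains the shifted argument of 1 - |z|. *)
Lemma disc_part n c al be K : tau / 2 <= c -> c <= 1 -> 0 <= K ->
  (forall x t, c <= x <= 1 ->
     W n x t <= K * ((1 - expR (- (x - tau / 4))) `^ al * D x t `^ be)) ->
  ((segint c 1 (S n))%:E <=
   (256 * K)%:E * disc_int (disc_density E (expR (- (tau / 4))) al be f))%E.
Proof.
have t0 := tau0; have t1 := tau1; move=> tc c1 K0 WK; set sg := tau / 4.
have sg0 : 0 < sg by rewrite divr_gt0.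
have -> : segint c 1 (S n) = segint (c - sg) (1 - sg) (fun x => S n (x + sg)).
  by rewrite segint_shift ?subrK//; lra.
apply: (@disc_bound R E E_circle E_neq0 sg (c - sg) (1 - sg) K al be f
  (fun x t => I n (x + sg) t)) => //; try (rewrite /sg; lra).
  have cx : continuous2 (fun x _ : R => x + sg).
    by apply: continuous2D; [exact: continuous2_fst|exact: continuous2_cst].
  exact (continuous2_comp2 (@continuous2_integrand n) cx (@continuous2_snd R)).
move=> x t /andP[xc x1].
have xx : c <= x + sg <= 1 by apply/andP; split; lra.
have x0 : tau / 2 <= x + sg by case/andP: xx => + _; exact: le_trans.
have zE : (expR (- sg))%:C * log_polar x t = log_polar (x + sg) t.
  rewrite /log_polar /circle_pt opprD expRD; apply/eqP; rewrite eq_complex /=.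
  by apply/andP; split; apply/eqP; ring.
rewrite /disc_density zE cabs_log_polar max_l// mulrA ler_wpM2r ?logp_ge0//.
apply: (le_trans (WK _ t xx)); rewrite -/sg addrK /polar_dist max_l//.
by apply: le_trans x0; rewrite divr_ge0// ltW.
Qed.

(** For x >= tau / 2 one has x - tau / 4 >= x / 2, so 1 - |z| lies between x / 4 and x: hence the
    power of 4. *)
Lemma integral_le_pos n N : p != 0 -> (3 <= n)%N ->
  (term_pos E q p f (expR (- (tau / 4))) <= N%:E)%E ->
  rectint 0 1 0 (2 * pi) (I n) <= 256 * (weight_bound p q * 4 `^ `|p - 1|) * N.
Proof.
have t0 := tau0; have t1 := tau1; move=> p1 n3 TN.
rewrite /rectint -/(S n) (@segint_cat _ _ _ (tau / 2))//; try lra.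
rewrite (@eq_segint _ _ _ _ (fun=> 0)); last first.
  by move=> x /andP[x0 xt]; rewrite -/(S n x); exact: S0.
rewrite segint_cst ?divr_ge0 ?(ltW tau0)// mul0r add0r.
have K0 : 0 <= weight_bound p q * 4 `^ `|p - 1| by rewrite mulr_ge0 ?powR_ge0 ?weight_bound_ge0.
rewrite -lee_fin EFinM.
apply: (@le_trans _ _ ((256 * (weight_bound p q * 4 `^ `|p - 1|))%:E *
  term_pos E q p f (expR (- (tau / 4))))%E); last first.
  apply: lee_wpmul2l; last exact: TN.
  by rewrite lee_fin; apply: mulr_ge0; [rewrite ler0n|exact: K0].
apply: disc_part => //; first by lra.
move=> x t /andP[xt x1]; have x0 : 0 < x by lra.
have [x2|x2] := leP (1 / 2) x.
  rewrite total_weight_eq0 ?(ltW x0)//; last by right.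
  by rewrite !mulr_ge0 ?powR_ge0 ?weight_bound_ge0.
have := total_weight_le (@polar_dist_ge _ _ E_circle E_neq0) (@polar_dist_ge0 _ _ E_neq0)
  (@polar_dist_lip _ _ E_neq0) p0 q0 tau0 tau1 t n3 xt (ltW x2).
move=> h; apply: (le_trans h); rewrite -mulrA ler_wpM2l ?weight_bound_ge0//.
rewrite mulrA ler_wpM2r ?powR_ge0//.
have y0 : 0 <= x - tau / 4 by lra.
have y1 : x - tau / 4 <= 1 by lra.
have h1 := expRN_half y0 y1; have h2 := expR_ge1Dx (- (x - tau / 4)).
by apply: powR_le_quot; [rewrite ler1n|lra|lra|lra|lra].
Qed.

(** As 2 tau < delta, the circle of radius exp (- x) is admissible for every positive x <= 2 tau.
    There the weight is at most a multiple of [D] to the q over tau, and the length 2 tau of the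
    range removes the division by tau. *)
Lemma integral_le_zero n N delta : p = 0 -> (3 <= n)%N -> 2 * tau < delta ->
  (forall s, 1 - delta < s < 1 -> (term_zero E q f s <= N%:E)%E) ->
  rectint 0 1 0 (2 * pi) (I n) <=
  (256 * weight_bound0 p q + 4 * weight_bound p q) * N.
Proof.
have t0 := tau0; have t1 := tau1; move=> pE n3 td TN.
have rad x : 0 < x -> x <= 2 * tau -> 1 - delta < expR (- x) < 1.
  move=> x0 x2; have := expR_ge1Dx (- x); rewrite -{3}expR0 ltr_expR oppr_lt0 x0 andbT.
  by lra.
have ci0 s : (0 <= circle_int (fun t =>
    (dist_set (circle_pt s t) E `^ q * logp (cabs (f (circle_pt s t))))%R))%E.
  by apply: integral_ge0 => t _; rewrite lee_fin mulr_ge0 ?powR_ge0 ?logp_ge0.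
have di0 (G : R[i] -> R) : (forall z, 0 <= G z) -> (0 <= disc_int G)%E.
  by move=> G0; apply: integral_ge0 => u _; rewrite lee_fin.
have disc1 s : (0 <= disc_int (fun z =>
     (dist_set (s%:C * z) E `^ (q - 1) * logp (cabs (f (s%:C * z))))%R))%E.
  by apply: di0 => z; rewrite mulr_ge0 ?powR_ge0 ?logp_ge0.
have disc2 s : (0 <= disc_int (fun z =>
     ((1 - cabs (s%:C * z) ^+ 2) `^ (q - 1) * logp (cabs (f (s%:C * z))))%R))%E.
  by apply: di0 => z; rewrite mulr_ge0 ?powR_ge0 ?logp_ge0.
have wb0 := weight_bound_ge0 p q; have wb1 : 0 <= weight_bound0 p q by exact: weight_bound0_ge0.
have near x : 0 <= x -> x <= 2 * tau -> S n x <= 2 * weight_bound p q / tau * N.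
  have N0 : 0 <= N.
    have /TN : 1 - delta < expR (- tau) < 1 by apply: rad; lra.
    rewrite -lee_fin; apply: le_trans.
    by apply: adde_ge0 => //; apply: adde_ge0.
  move=> x0 x2; have [xt|xt] := leP x (tau / 2).
    by rewrite S0// mulr_ge0// divr_ge0 ?(ltW tau0)// mulr_ge0.
  have x0' : 0 < x by lra.
  pose g t := D (Num.max x (tau / 2)) t `^ q * Lf x t.
  have cg : continuous g.
    have c2 : continuous2 (fun y t => D (Num.max y (tau / 2)) t `^ q * Lf y t).
      apply: continuous2M; last first.
        apply: eq_continuous2 (continuous2_log_field tau0 ltr01 df) => y t.
        by rewrite logp_field.
      apply: continuous2_powR => [y t|].
        have m0 : tau / 2 <= Num.max y (tau / 2) by rewrite le_max lexx orbT.
        apply: lt_le_trans (dist_set_circle E_circle E_neq0 _).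
        rewrite cabs_log_polar subr_gt0 -[ltRHS]expR0 ltr_expR oppr_lt0.
        by rewrite lt_max; apply/orP; left; apply: lt_le_trans m0; rewrite divr_gt0.
      have cx : continuous2 (fun y _ : R => Num.max y (tau / 2)).
        by apply: continuous2_max; [exact: continuous2_fst|exact: continuous2_cst].
      exact (continuous2_comp2 (continuous2_lip (polar_dist_lip E_neq0)) cx
        (@continuous2_snd R)).
    by move=> t; exact: (@continuous2_row R _ x c2 t).
  have gE : ((segint 0 (2 * pi) g)%:E <= N%:E)%E.
    rewrite segint_EFin//; apply: le_trans (TN _ (rad x x0' x2)).
    rewrite /term_zero -addeA; apply: le_trans (leeDl _ _); last by apply: adde_ge0.
    rewrite le_eqVlt; apply/orP; left; apply/eqP; apply: eq_integral => t _.
    by rewrite /g /polar_dist !max_l// ltW.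
  rewrite lee_fin in gE.
  apply: (@le_trans _ _ (segint 0 (2 * pi) (fun t => 2 * weight_bound p q / tau * g t))).
    apply: le_segint.
    - by move=> t; exact (@continuous2_row R _ x (@continuous2_integrand n) t).
    - by move=> t; apply: cvgM; [exact: cvg_cst|exact: cg].
    move=> t _; rewrite /g mulrA ler_wpM2r ?logp_ge0// max_l ?(ltW xt)//.
    apply: (le_trans (total_weight_le (@polar_dist_ge _ _ E_circle E_neq0)
      (@polar_dist_ge0 _ _ E_neq0) (@polar_dist_lip _ _ E_neq0) p0 q0 tau0 tau1 t n3
      (ltW xt) ltac:(lra))).
    rewrite mulrA ler_wpM2r ?powR_ge0// mulrC [leRHS]mulrAC ler_wpM2r//.
    by rewrite pE sub0r powR_inv1 ?(ltW x0')// -[leRHS]invf_div lef_pV2 ?posrE ?divr_gt0// ltW.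
  rewrite segintZ//; apply: ler_wpM2l => //.
  by rewrite divr_ge0 ?(ltW tau0)// mulr_ge0.
rewrite /rectint -/(S n) (@segint_cat _ _ _ (2 * tau))//; try lra.
rewrite [leRHS]mulrDl [leLHS]addrC; apply: lerD.
  rewrite -lee_fin EFinM.
  apply: (@le_trans _ _ ((256 * weight_bound0 p q)%:E *
    disc_int (disc_density E (expR (- (tau / 4))) 0 (q - 1) f))%E); last first.
    apply: lee_wpmul2l; first by rewrite lee_fin; apply: mulr_ge0; [rewrite ler0n|exact: wb1].
    have r4 := rad (tau / 4) ltac:(lra) ltac:(lra).
    apply: le_trans (TN _ r4).
    rewrite /term_zero (_ : disc_density E (expR (- (tau / 4))) 0 (q - 1) f = (fun z =>
      (dist_set ((expR (- (tau / 4)))%:C * z) E `^ (q - 1) *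
       logp (cabs (f ((expR (- (tau / 4)))%:C * z))))%R)); last first.
      by apply/funext => z; rewrite /disc_density powRr0 mul1r.
    by rewrite addeAC; apply: leeDr; apply: adde_ge0.
  apply: disc_part => //; [by lra|by lra|].
  move=> x t /andP[xt x1]; have x0 : 0 < x by lra.
  rewrite powRr0 mul1r; have [x2|x2] := leP (1 / 2) x.
    by rewrite total_weight_eq0 ?(ltW x0)//; [rewrite mulr_ge0 ?powR_ge0|right].
  by apply: total_weight_le0 => //; [exact: polar_dist_ge|exact: polar_dist_ge0|
    exact: polar_dist_le2|exact: polar_dist_lip|exact: ltW].
apply: (@le_trans _ _ (segint 0 (2 * tau) (fun=> 2 * weight_bound p q / tau * N))).
  apply: le_segint => //; first by move=> x; exact: cvg_cst.
  by move=> x /andP[x0 xt]; exact: near.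
rewrite segint_cst ?mulr_ge0 ?(ltW tau0)// subr0 le_eqVlt; apply/orP; left; apply/eqP.
by field; rewrite gt_eqF.
Qed.

End Upper_bound.

(** * Zeros and the theorem *)

Section Zeros.
Variable R : realType.
Implicit Types (f g h : R[i] -> R[i]) (a b z w : R[i]) (m k : nat).

Lemma cderivable_exp f z m : cderivable f z -> cderivable (fun w => f w ^+ m) z.
Proof.
move=> df; elim: m => [|m ih]; first exact: cderivable_cst.
have -> : (fun w => f w ^+ m.+1) = (fun w => f w * f w ^+ m).
  by apply/funext => w; rewrite exprS.
exact (cderivableM df ih).
Qed.

(** The new quotient is g / (z - a)^m away from a. At a it is given by h / Q, where f = (z - a)^m h
    and Q is the product over the other points; the two formulas agree near a, since Q does not
    vanish there. *)
Lemma factor_zeros f (P : seq R[i]) (m : R[i] -> nat) : holomorphic f -> uniq P ->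
  (forall a, a \in P -> cabs a < 1 /\ zero_order f a (m a)) ->
  exists2 g, holomorphic g & forall z, cabs z < 1 ->
    f z = (\prod_(a <- P) (z - a) ^+ m a) * g z.
Proof.
move=> hf; elim: P => [_ _|a P ih /= /andP[aP uP] hP].
  by exists f => // z _; rewrite big_nil mul1r.
have [|g hg fg] := ih uP; first by move=> b bP; apply: hP; rewrite inE bP orbT.
have [a1 [h [hh ha fh]]] := hP a (mem_head _ _).
pose Q z := \prod_(b <- P) (z - b) ^+ m b.
have Q0 z : z \notin P -> Q z != 0.
  move=> zP; rewrite prodf_seq_neq0; apply/allP => b bP /=.
  by rewrite expf_neq0// subr_eq0; apply: contraNneq zP => ->.
have dQ z : cderivable Q z.
  apply: cderivable_prod => b; apply: cderivable_exp.
  by apply: cderivableB; [exact: cderivable_id|exact: cderivable_cst].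
have dx z : cderivable (fun w => (w - a) ^+ m a) z.
  apply: cderivable_exp.
  by apply: cderivableB; [exact: cderivable_id|exact: cderivable_cst].
pose g' z := if z == a then h a / Q a else g z / (z - a) ^+ m a.
exists g'; last first.
  move=> z z1; rewrite big_cons -/(Q z) /g'; case: eqVneq => [->|za].
    rewrite fh// subrr -!mulrA; congr (_ * _).
    by rewrite mulrC divfK// Q0.
  have um : (z - a) ^+ m a != 0 by rewrite expf_neq0// subr_eq0.
  by rewrite fg// -/(Q z); move: um; set u := _ ^+ _ => u0; field.
move=> z z1; have [->|za] := eqVneq z a; last first.
  have r0 : 0 < cabs (z - a) by rewrite cabs_gt0 subr_eq0.
  have d1 : cderivable (fun w => g w / (w - a) ^+ m a) z.
    apply: cderivableM; first exact: hg.
    by apply: (@cderivableV _ (fun w => (w - a) ^+ m a)) => //; rewrite expf_neq0// subr_eq0.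
  apply: (near_cderivable r0 _ d1) => w wz; rewrite /g'; case: eqVneq => // wa.
  by rewrite wa cabs_sym ltxx in wz.
have d1 : cderivable (fun w => h w / Q w) a.
  by apply: cderivableM; [exact: hh|apply: cderivableV => //; exact: Q0].
have Qa0 : 0 < cabs (Q a) by rewrite cabs_gt0 Q0.
have e0 : 0 < cabs (Q a) / 2 by rewrite divr_gt0.
have [d d0 dQa] := cderivable_continuous (dQ a) e0.
have r0 : 0 < Num.min d (1 - cabs a) by rewrite lt_min d0 subr_gt0.
apply: (near_cderivable r0 _ d1) => w; rewrite lt_min => /andP[wd wa].
rewrite /g'; case: eqVneq => [->//|wna].
have w1 : cabs w < 1.
  by have := cabs_dist w a => /ler_normlP[_ h1]; lra.
have Qw : Q w != 0.
  apply/eqP => Qw0; have := dQa w wd; rewrite Qw0 sub0r cabsN.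
  by move: Qa0; clear; lra.
have wm : (w - a) ^+ m a != 0 by rewrite expf_neq0// subr_eq0.
have E : Q w * g w = (w - a) ^+ m a * h w by rewrite -fg// -fh.
by apply: (mulfI wm); rewrite mulrC divfK//; apply: (mulfI Qw); rewrite E; field.
Qed.

(** The witness is the largest of the orders attached to the members of s over a: it exceeds every
    index there and is itself an order. *)
Lemma common_order f (s : seq (R[i] * nat)) a : (forall u, u \in s -> Zset f u) ->
  exists m, (forall u, u \in s -> u.1 = a -> (u.2 < m)%N) /\
    ((exists2 u, u \in s & u.1 = a) -> zero_order f a m).
Proof.
elim: s => [|v s ih] hs; first by exists 0%N; split => // -[].
have [|m [m1 m2]] := ih; first by move=> u us; apply: hs; rewrite inE us orbT.
have [va|va] := eqVneq v.1 a; last first.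
  exists m; split=> [u|[u]]; rewrite inE => /predU1P[->|us].
  - by move/eqP; rewrite (negPf va).
  - exact: m1.
  - by move/eqP; rewrite (negPf va).
  - by move=> ua; apply: m2; exists u.
have [_ [k fk vk]] : Zset f v by apply: hs; rewrite mem_head.
rewrite va in fk.
have [[u us ua]|nu] := pselect (exists2 u, u \in s & u.1 = a).
  exists (maxn m k); split=> [w|_].
    rewrite inE leq_max => /predU1P[->|ws] wa; first by rewrite vk orbT.
    by rewrite m1.
  by case: leqP => // _; apply: m2; exists u.
exists k; split=> // w; rewrite inE => /predU1P[->//|ws] wa.
by case: nu; exists w.
Qed.

(** A may contain only some copies of a zero. The list completes each point to its full order,
    because [zero_order] splits off the whole power at once. *)
Lemma zero_list f (A : set (R[i] * nat)) : holomorphic f -> finite_set A ->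
  A `<=` Zset f -> exists s : seq (R[i] * nat), exists g : R[i] -> R[i],
  [/\ uniq s, (forall u, A u -> u \in s), (forall u, u \in s -> cabs u.1 < 1),
      holomorphic g &
      forall z, cabs z < 1 -> f z = (\prod_(u <- s) (z - u.1)) * g z].
Proof.
move=> hf /finite_seqP[s0 ->] As.
have hs0 u : u \in s0 -> Zset f u by move=> us; apply: As.
have [m hm] := choice (fun a => common_order a hs0).
pose P := undup (map fst s0).
have [||g hg fg] := @factor_zeros f P m hf; first exact: undup_uniq.
  move=> a; rewrite mem_undup => /mapP[u us ->]; split; first by have [] := hs0 u us.
  by apply: (hm u.1).2; exists u.
pose s := [seq (a, k) | a <- P, k <- iota 0 (m a)].
exists s, g; split => //.
- apply: allpairs_uniq_dep; first exact: undup_uniq.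
    by move=> a _; exact: iota_uniq.
  by move=> [a k] [b l] _ _ [-> ->].
- move=> u us; apply/allpairsPdep; exists u.1, u.2; split.
  + by rewrite mem_undup map_f.
  + by rewrite mem_iota add0n/=; apply: (hm u.1).1.
  + by case: u us.
- move=> u /allpairsPdep[a [k [+ _ ->]]] /=.
  by rewrite mem_undup => /mapP[v vs ->]; have [] := hs0 v vs.
- move=> z z1; rewrite fg//; congr (_ * _); rewrite big_allpairs_dep/=.
  apply: eq_bigr => a _.
  by rewrite big_const_seq count_predT size_iota iter_mulr_1.
Qed.

Lemma circle_angle z : cabs z = 1 -> exists2 t, 0 <= t <= 2 * pi & z = circle_pt 1 t.
Proof.
case: z => x y z1.
have xy : x ^+ 2 + y ^+ 2 = 1.
  have : Num.sqrt (x ^+ 2 + y ^+ 2) = 1 by [].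
  by move/(congr1 (fun u => u ^+ 2)); rewrite sqr_sqrtr ?addr_ge0 ?sqr_ge0// expr1n.
have x1 : -1 <= x <= 1.
  have := sqr_ge0 y => y2; apply/andP; split; nra.
have pi0 := @pi_ge0 R.
have c := acosK (_ : x \in `[-1, 1]); have {}c := c x1.
have s := sin_acos x1.
have yE : Num.sqrt (1 - x ^+ 2) = `|y| by rewrite -xy addrC addKr sqrtr_sqr.
have a0 := acos_ge0 x1; have a1 := acos_lepi x1.
have [y0|y0] := leP 0 y.
  exists (acos x); first by apply/andP; split; lra.
  by rewrite /circle_pt !mul1r c s yE ger0_norm.
exists (2 * pi - acos x); first by apply/andP; split; lra.
rewrite /circle_pt !mul1r addrC mulr_natl cosD2pi sinD2pi cosN sinN c s yE.
by rewrite ltr0_norm// opprK.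
Qed.

Lemma polar_form a : a != 0 -> cabs a < 1 -> exists xt : R * R,
  [/\ 0 < xt.1, 0 <= xt.2 <= 2 * pi & a = log_polar xt.1 xt.2].
Proof.
move=> a0 a1; have r0 : 0 < cabs a by rewrite cabs_gt0.
have [|t t02 tE] := @circle_angle ((cabs a)^-1%:C * a).
  by rewrite cabsM cabs_real ger0_norm ?invr_ge0 ?ltW// mulVf// gt_eqF.
exists (- ln (cabs a), t); split => //=; first by rewrite oppr_gt0 ln_lt0// r0.
have cE : (cabs a)%:C * (cabs a)^-1%:C = 1 :> R[i].
  apply/eqP; rewrite eq_complex /=; apply/andP; split; apply/eqP.
    by rewrite mulr0 subr0 mulfV ?gt_eqF.
  by rewrite mulr0 mul0r addr0.
rewrite -[LHS]mul1r -cE -mulrA.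
rewrite tE /log_polar /circle_pt opprK lnK ?posrE//.
by apply/eqP; rewrite eq_complex /=; apply/andP; split; apply/eqP; ring.
Qed.

End Zeros.

(** * Choice of the parameters and the final constant *)

Section Main.
Variable R : realType.
Implicit Types (p q : R) (E : set R[i]) (f g : R[i] -> R[i]) (a z : R[i]).

Lemma sq_expRN_le (x : R) : 0 <= x -> 0 <= 1 - expR (- x) ^+ 2 <= 2 * x.
Proof.
move=> x0; have -> : expR (- x) ^+ 2 = expR (- (2 * x)).
  by rewrite expr2 -expRD; congr expR; ring.
have := expR_ge1Dx (- (2 * x)).
have : expR (- (2 * x)) <= 1 by rewrite -[leRHS]expR0 ler_expR; lra.
by move=> h1 h2; apply/andP; split; lra.
Qed.

(** For a zero of depth x, 1 - |a|^2 = 1 - exp (- 2 x) is at most 2 x and at most 1. The first bound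
    serves zeros near the circle; for deep zeros both factors are bounded, matching the value 1 of
    [zero_mass]. *)
Lemma term_le_mass E p q (v : R * R) : E `<=` @unit_circle R -> E !=set0 ->
  0 <= p -> 0 < q -> 0 < v.1 ->
  (1 - cabs (log_polar v.1 v.2) ^+ 2) `^ (1 + p) * phi E q (log_polar v.1 v.2) <=
  2 `^ (1 + p) * 2 `^ q * zero_mass (polar_dist E) p q v.
Proof.
move=> EC E0 p0 q0 v0; have v00 := ltW v0.
have p10 : 0 <= 1 + p by rewrite addr_ge0.
rewrite cabs_log_polar; have /andP[h1 h2] := sq_expRN_le v00.
have h3 : 1 - expR (- v.1) ^+ 2 <= 1 by rewrite gerBl sqr_ge0.
have -> : phi E q (log_polar v.1 v.2) = polar_dist E v.1 v.2 `^ q.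
  by rewrite /phi /polar_dist max_l.
have d0 := polar_dist_ge0 E0 v.1 v.2; have d2 := polar_dist_le2 EC E0 v.1 v.2.
have q1 : 1 <= 2 `^ q :> R.
  by have := @ge0_powR_le R q 1 2 (ltW q0) ler01 ltac:(lra); rewrite powR1.
have q2 : polar_dist E v.1 v.2 `^ q <= 2 `^ q by apply: ge0_powR_le => //; exact: ltW.
rewrite /zero_mass; case: ifP => _.
  rewrite [leRHS]mulrACA -powRM//.
  apply: ler_pM; rewrite ?powR_ge0//; first exact: ge0_powR_le.
  by rewrite ler_peMl ?powR_ge0.
rewrite mulr1; apply: ler_pM; rewrite ?powR_ge0//.
apply: (@le_trans _ _ (1 `^ (1 + p))); first exact: ge0_powR_le.
by apply: ge0_powR_le => //; rewrite ler1n.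
Qed.

(** The constants of the cases p > 0 and p = 0 are added, so that one constant serves both. *)
Definition blaschke_const p q : R :=
  256 * (weight_bound p q * 4 `^ `|p - 1|) + 256 * weight_bound0 p q +
  4 * weight_bound p q.

Lemma blaschke_const_ge0 p q : 0 < q -> 0 <= blaschke_const p q.
Proof.
move=> q0; have h1 := weight_bound_ge0 p q; have h2 : 0 <= weight_bound0 p q.
  exact: weight_bound0_ge0.
apply: addr_ge0; last by apply: mulr_ge0; [rewrite ler0n|exact: h1].
apply: addr_ge0; last by apply: mulr_ge0; [rewrite ler0n|exact: h2].
by apply: mulr_ge0; [rewrite ler0n|apply: mulr_ge0 => //; exact: powR_ge0].
Qed.

Lemma term_ge0 E p q f s : (0 <= if p == 0%R then term_zero E q f s else term_pos E q p f s)%E.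
Proof.
have di0 (G : R[i] -> R) : (forall z, 0 <= G z) -> (0 <= disc_int G)%E.
  by move=> G0; apply: integral_ge0 => u _; rewrite lee_fin.
case: ifP => _; last by apply: di0 => z; rewrite !mulr_ge0 ?powR_ge0 ?logp_ge0.
apply: adde_ge0; last by apply: di0 => z; rewrite mulr_ge0 ?powR_ge0 ?logp_ge0.
apply: adde_ge0; last by apply: di0 => z; rewrite mulr_ge0 ?powR_ge0 ?logp_ge0.
by apply: integral_ge0 => t _; rewrite lee_fin mulr_ge0 ?powR_ge0 ?logp_ge0.
Qed.

Lemma mass_le E p q f g (s : seq (R * R)) delta N :
  E `<=` @unit_circle R -> E !=set0 -> 0 <= p -> 0 < q -> holomorphic f ->
  holomorphic g -> 0 < delta -> 0 <= N ->
  (forall u, 1 - delta < u < 1 ->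
    ((if p == 0%R then term_zero E q f u else term_pos E q p f u) <= N%:E)%E) ->
  (forall v, v \in s -> 0 < v.1 /\ 0 <= v.2 <= 2 * pi) ->
  (forall z, cabs z < 1 -> f z = (\prod_(v <- s) (z - log_polar v.1 v.2)) * g z) ->
  cabs (f 0) = 1 ->
  gain p q * (\sum_(v <- s) zero_mass (polar_dist E) p q v) <= blaschke_const p q * N.
Proof.
move=> EC E0 p0 q0 hf hg d0 N0 TN hs fg f0.
(* Here tau depends on delta and on the zeros, which is harmless because neither [gain] nor
   [blaschke_const] involves it. *)
have [tau [t0 t1 td ts]] : exists tau, [/\ 0 < tau, tau <= 1 / 100, 2 * tau < delta &
    forall v, v \in s -> 2 * tau <= v.1].
  have [r r0 rs] : exists2 r, 0 < r & forall v, v \in s -> r <= v.1.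
    elim: s hs {fg} => [|v s ih] hs; first by exists 1.
    have [|r r0 rs] := ih; first by move=> u us; apply: hs; rewrite inE us orbT.
    have [|v0 _] := hs v; first exact: mem_head.
    exists (Num.min r v.1); first by rewrite lt_min r0.
    move=> u; rewrite inE => /predU1P[->|/rs ur]; first by rewrite ge_min lexx orbT.
    by rewrite ge_min ur.
  have d4 : 0 < delta / 4 by rewrite divr_gt0.
  have r2 : 0 < r / 2 by rewrite divr_gt0.
  have h100 : 0 < 1 / 100 :> R by rewrite divr_gt0.
  exists (Num.min (1 / 100) (Num.min (delta / 4) (r / 2))); split.
  - by rewrite !lt_min h100 d4 r2.
  - by rewrite ge_min lexx.
  - have : Num.min (1 / 100) (Num.min (delta / 4) (r / 2)) <= delta / 4.
      by rewrite !ge_min lexx !orbT.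
    by move: d0; lra.
  - move=> v /rs rv; have : Num.min (1 / 100) (Num.min (delta / 4) (r / 2)) <= r / 2.
      by rewrite !ge_min lexx !orbT.
    by move: rv; lra.
have c0 : cabs (0 : R[i]) < 1 by rewrite cabs0.
(* The normalisation |f(0)| = 1 turns into ln |g(0)| = sum of the depths of the zeros. *)
have f0E : (\prod_(v <- s) expR (- v.1)) * cabs (g 0) = 1.
  rewrite -[RHS]f0 fg// cabsM cabs_prod; congr (_ * _); apply: eq_bigr => v _.
  by rewrite sub0r cabsN cabs_log_polar.
have g0E : cabs (g 0) = expR (\sum_(v <- s) v.1).
  have e0 : expR (\sum_(v <- s) (- v.1)) != 0 by rewrite gt_eqF ?expR_gt0.
  have eV : expR (\sum_(v <- s) (- v.1)) * expR (\sum_(v <- s) v.1) = 1.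
    by rewrite -expRD sumrN addNr expR0.
  by apply: (mulfI e0); rewrite [RHS]eV expR_sum.
have g0 : g 0 != 0 by rewrite -cabs_gt0 g0E expR_gt0.
apply/ler_addgt0Pr => e e0.
have [||n n3 h] := @mass_ineq R (polar_dist E) p q tau (polar_dist_ge EC E0)
  (polar_dist_ge0 E0) (polar_dist_le2 EC E0) (polar_dist_lip E0) (@polar_dist_periodic R E)
  p0 q0 t0 t1 s g e hg e0 g0.
- by rewrite g0E expRK.
- by move=> v vs; split; [exact: ts|have [] := hs v vs].
apply: (le_trans h); rewrite lerD2r.
rewrite (@eq_rectint _ _ _ _ _ _ (fun x t => total_weight (polar_dist E) p q tau n x t *
   logp (cabs (f (log_polar (Num.max x (tau / 2)) t))))); last first.
  by move=> x t _ _; rewrite fg//; exact: log_polar_clamp_lt1.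
have wb := weight_bound_ge0 p q; have wb0 : 0 <= weight_bound0 p q.
  exact: weight_bound0_ge0.
have wb4 : 0 <= weight_bound p q * 4 `^ `|p - 1| by rewrite mulr_ge0 ?powR_ge0.
have [pE|pE] := eqVneq p 0.
  apply: (le_trans (@integral_le_zero R E p q tau f EC E0 p0 q0 t0 t1 hf n N delta pE n3 td _)).
    by move=> u u1; have := TN u u1; rewrite pE eqxx.
  by rewrite ler_wpM2r// /blaschke_const; lra.
apply: (le_trans (@integral_le_pos R E p q tau f EC E0 p0 q0 t0 t1 hf n N pE n3 _)).
  have := TN (expR (- (tau / 4))); rewrite (negPf pE); apply.
  rewrite -[X in _ < _ < X]expR0 ltr_expR oppr_lt0 divr_gt0// andbT.
  by have := expR_ge1Dx (- (tau / 4)); lra.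
by rewrite ler_wpM2r// /blaschke_const; lra.
Qed.

End Main.

Theorem theorem1p3 (R : realType) (E : set R[i]) (p q : R) :
  E `<=` @unit_circle R -> E !=set0 -> closed_plane E -> 0 <= p -> 0 < q ->
  exists c : R, 0 < c /\
    forall f : R[i] -> R[i], Nclass E q p f -> cabs (f 0) = 1 ->
    forall delta : R, admissible E q p f delta ->
    (zero_sum E q p f <= c%:E * Nnorm E q p delta f)%E.
Proof.
move=> EC E0 _ p0 q0.
pose C : R := 2 `^ (1 + p) * 2 `^ q.
have C0 : 0 <= C by rewrite mulr_ge0 ?powR_ge0.
have G0 := gain_gt0 p q; have K0 := blaschke_const_ge0 p q0.
(* The added 1 makes the constant positive. *)
exists (C / gain p q * blaschke_const p q + 1); split.
  by rewrite ltr_wpDl// mulr_ge0// divr_ge0// ltW.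
move=> f [hf _] f0 delta [/andP[d0 d1] Nfin].
pose TT s := if p == 0 then term_zero E q f s else term_pos E q p f s.
have TN s : 1 - delta < s < 1 -> (TT s <= Nnorm E q p delta f)%E.
  by move=> s1; apply: ereal_sup_ubound; exists s.
have Nge : (0 <= Nnorm E q p delta f)%E.
  have s1 : 1 - delta < 1 - delta / 2 < 1 by apply/andP; split; lra.
  by apply: le_trans (TN _ s1); exact: term_ge0.
have [N NE] : exists N, Nnorm E q p delta f = N%:E.
  by case: (Nnorm E q p delta f) Nfin Nge => // N; exists N.
rewrite NE in TN Nge *; rewrite lee_fin in Nge.
(* The sum is the supremum of its finite partial sums, so finite sets of zeros suffice. *)
apply: ge_ereal_sup => _ [A [Afin AZ] <-].
have [s [g [us As s1 hg fg]]] := zero_list hf Afin AZ.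
pose F (u : R[i] * nat) : R := (1 - cabs u.1 ^+ 2) `^ (1 + p) * phi E q u.1.
have F0 u : 0 <= F u by rewrite mulr_ge0 ?powR_ge0.
have AE : A = [set` [seq u <- s | u \in A]].
  apply/seteqP; split => u /=; rewrite mem_filter.
    by move=> Au; rewrite As// andbT inE.
  by case/andP; rewrite inE.
rewrite AE -fsbig_seq ?filter_uniq// big_filter sumEFin lee_fin.
apply: (@le_trans _ _ (\sum_(u <- s) F u)).
  rewrite big_mkcond; apply: ler_sum => u _; case: ifP => // _; exact: F0.
(* A total map is needed for the choice; (0, 0) is a default outside the punctured disc. *)
have polar a : exists v : R * R, a != 0 /\ cabs a < 1 ->
    [/\ 0 < v.1, 0 <= v.2 <= 2 * pi & a = log_polar v.1 v.2].
  have [[a0 a1]|na] := pselect (a != 0 /\ cabs a < 1); last by exists (0, 0) => /na.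
  by have [v hv] := polar_form a0 a1; exists v.
have [xt hxt] := choice polar.
(* A zero at the origin would contradict |f(0)| = 1, so every zero has a finite depth. *)
have s0 u : u \in s -> u.1 != 0 /\ cabs u.1 < 1.
  move=> us'; split; last exact: s1.
  apply/eqP => u0; move: f0; rewrite fg ?cabs0// cabsM cabs_prod.
  suff -> : \prod_(v <- s) cabs (0 - v.1) = 0 by rewrite mul0r => /esym/eqP; rewrite oner_eq0.
  by apply/eqP; rewrite prodf_seq_eq0; apply/hasP; exists u => //=; rewrite u0 subrr cabs0.
have key : gain p q * (\sum_(v <- map (fun u => xt u.1) s)
    zero_mass (polar_dist E) p q v) <= blaschke_const p q * N.
  apply: (@mass_le R E p q f g _ delta N) => //.
    by move=> v /mapP[u us' ->]; have [] := hxt _ (s0 u us').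
  move=> z z1; rewrite fg// big_map; congr (_ * _); rewrite !big_seq.
  by apply: eq_bigr => u us'; have [_ _ <-] := hxt _ (s0 u us').
apply: (@le_trans _ _ (C * \sum_(u <- s) zero_mass (polar_dist E) p q (xt u.1))).
  rewrite mulr_sumr !big_seq; apply: ler_sum => u us'.
  have [x0 _ uE] := hxt _ (s0 u us').
  rewrite /F {1 2}uE; exact: term_le_mass.
rewrite big_map in key.
apply: (@le_trans _ _ (C / gain p q * blaschke_const p q * N)); last first.
  by rewrite ler_wpM2r// lerDl.
rewrite -[leRHS]mulrA -[C / _ * _]mulrA; apply: ler_wpM2l => //.
by rewrite [leRHS]mulrC ler_pdivlMr// mulrC.
Qed.
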